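(* Let $\Gamma\subset\mathbb{R}^2$ be a closed simple analytic curve with parametrization $\mathbf{x}$, and let $\phi$ be a real $2\pi$-periodic analytic function. Let $M\ge 1$ be an integer and suppose there exists $U_N:\mathbb{R}^2\times\Gamma\to\mathbb{R}$, with $U_N(\cdot,\mathbf{x}(t))$ harmonic in $\mathbb{R}^2$ for all $t\in[0,2\pi]$, such that its Dirichlet trace $P_N(\tau,t)=U_N(\mathbf{x}(\tau),\mathbf{x}(t))$ satisfies $$\lim_{\tau\to t}\frac{\partial^m}{\partial\tau^m}\{P_N(\tau,t)-\phi(\tau)\}=0\quad\text{for } m=0,\dots,M$$ and all $t\in[0,2\pi]$. Let $Q_N(\tau,t)=\nabla U_N(\mathbf{x}(\tau),\mathbf{x}(t))\cdot\mathbf{n}(\tau)$ (gradient in the first variable) denote the Neumann trace of $U_N$. Then the hypersingular operator can be expressed as $$\tilde N[\phi](t)=-\frac{Q_N(t,t)}{2}+\int_0^{2\pi}\left\{R^{(P)}_N(\tau,t)+R^{(Q)}_N(\tau,t)\right\}|\mathbf{x}'(\tau)|\,d\tau,$$ where, for $\tau\ne t$, $$R^{(P)}_N(\tau,t)=\left(\frac{\mathbf{n}(\tau)\cdot\mathbf{n}(t)}{2\pi|\mathbf{x}(t)-\mathbf{x}(\tau)|^2}-\frac{\{\mathbf{x}(t)-\mathbf{x}(\tau)\}\cdot\mathbf{n}(t)\;\{\mathbf{x}(t)-\mathbf{x}(\tau)\}\cdot\mathbf{n}(\tau)}{\pi|\mathbf{x}(t)-\mathbf{x}(\tau)|^4}\right)\{\phi(\tau)-P_N(\tau,t)\},$$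 $$R^{(Q)}_N(\tau,t)=-\frac{1}{2\pi}\frac{\{\mathbf{x}(t)-\mathbf{x}(\tau)\}\cdot\mathbf{n}(t)}{|\mathbf{x}(t)-\mathbf{x}(\tau)|^2}\,Q_N(\tau,t),$$ and, for $\tau=t$, $$R^{(P)}_N(t,t)=\frac{1}{4\pi|\mathbf{x}'(t)|^2}\frac{\partial^2}{\partial\tau^2}\{\phi(\tau)-P_N(\tau,t)\}\Big|_{\tau=t},\qquad R^{(Q)}_N(t,t)=\frac{\mathbf{x}''(t)\cdot\mathbf{n}(t)}{4\pi|\mathbf{x}'(t)|^2}\,Q_N(t,t).$$ Moreover $R^{(P)}_N(\cdot,t)$ and $R^{(Q)}_N(\cdot,t)$ are real analytic $2\pi$-periodic functions of $\tau\in[0,2\pi]$ for all $t\in[0,2\pi]$.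
   Context: The simple closed curve $\Gamma$ is given by a regular ($\mathbf{x}'(t)\neq 0$), real analytic, $2\pi$-periodic counterclockwise parametrization $\mathbf{x}(t)=(\mathrm{x}_1(t),\mathrm{x}_2(t))$, injective on $[0,2\pi)$. The unit normal is $\mathbf{n}(t)=(\mathrm{x}_2'(t),-\mathrm{x}_1'(t))/|\mathbf{x}'(t)|$ (outward). Functions of the parameters $\tau,t$ are extended $2\pi$-periodically, and ''$\tau=t$'', ''$\tau\neq t$'' are understood modulo $2\pi$. Let $G(x,y)=-\frac{1}{2\pi}\log|x-y|$ be the free-space Green function of the Laplace equation in $\mathbb{R}^2$. The hypersingular operator applied to $\varphi:\Gamma\to\mathbb{R}$ is $$N[\varphi](x)=\mathrm{f.p.}\int_\Gamma\frac{\partial^2G(x,y)}{\partial n(x)\,\partial n(y)}\varphi(y)\,ds(y),\qquad x\in\Gamma,$$ where f.p. denotes the Hadamard finite part, i.e. $N[\varphi](x)=\lim_{\varepsilon\to0^+}\left(\int_{\Gamma\cap\{|x-y|>\varepsilon\}}\frac{\partial^2G(x,y)}{\partial n(x)\partial n(y)}\varphi(y)\,ds(y)-\frac{\varphi(x)}{\pi\varepsilon}\right)$. In parameter space, $\tilde N[\phi](t)=N[\varphi](\mathbf{x}(t))$ where $\phi(t)=\varphi(\mathbf{x}(t))$. *)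

(* Defs.v *)
From Stdlib Require Import Reals ClassicalEpsilon.
From Coquelicot Require Import Coquelicot.
Open Scope R_scope.

(** * The Euclidean plane *)

Definition dot (v w : R * R) : R := fst v * fst w + snd v * snd w.

Definition vsub (v w : R * R) : R * R := (fst v - fst w, snd v - snd w).

Definition enorm (v : R * R) : R := sqrt (dot v v).

Definition grad (f : R * R -> R) (p : R * R) : R * R :=
  (Derive (fun u => f (u, snd p)) (fst p), Derive (fun v => f (fst p, v)) (snd p)).

Definition harmonic (f : R * R -> R) : Prop :=
  forall u v : R,
    ex_diff_n (fun a b => f (a, b)) 2 u v /\
    partial_derive 2 0 (fun a b => f (a, b)) u v
      + partial_derive 0 2 (fun a b => f (a, b)) u v = 0.

(** * Analyticity and periodicity *)

Definition analytic (f : R -> R) : Prop :=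
  forall t : R, exists a : nat -> R,
    locally 0 (fun h : R => is_pseries a h (f (t + h))).

Definition periodic {T : Type} (f : R -> T) : Prop :=
  forall t : R, f (t + 2 * PI) = f t.

Definition eqmod2pi (tau t : R) : Prop :=
  exists k : Z, tau = t + 2 * PI * IZR k.

(** * Parametrized closed curves *)

Definition vel (x : R -> R * R) (t : R) : R * R :=
  (Derive (fun s => fst (x s)) t, Derive (fun s => snd (x s)) t).

Definition acc (x : R -> R * R) (t : R) : R * R :=
  (Derive_n (fun s => fst (x s)) 2 t, Derive_n (fun s => snd (x s)) 2 t).

Definition speed (x : R -> R * R) (t : R) : R := enorm (vel x t).

Definition normal (x : R -> R * R) (t : R) : R * R :=
  (snd (vel x t) / speed x t, - fst (vel x t) / speed x t).

Definition winding_number (x : R -> R * R) (p : R * R) : R :=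
  / (2 * PI) *
  RInt (fun t =>
          (fst (vsub (x t) p) * snd (vel x t) - snd (vsub (x t) p) * fst (vel x t))
            / dot (vsub (x t) p) (vsub (x t) p)) 0 (2 * PI).

(* [p] and [q] lie in the same path component of the complement of the curve. *)
Definition joined_off (x : R -> R * R) (p q : R * R) : Prop :=
  exists gam : R -> R * R,
    (forall s, 0 <= s <= 1 -> continuous gam s) /\
    gam 0 = p /\ gam 1 = q /\
    forall s t, 0 <= s <= 1 -> gam s <> x t.

(* The complement of the curve is open, so its connected components are its path
   components; the interior is made of the bounded ones. *)
Definition in_interior (x : R -> R * R) (p : R * R) : Prop :=
  (forall t, x t <> p) /\
  exists B : R, forall q, joined_off x p q -> enorm q <= B.

Definition counterclockwise (x : R -> R * R) : Prop :=
  forall p, in_interior x p -> winding_number x p = 1.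

Record analytic_simple_closed_curve (x : R -> R * R) : Prop := {
  curve_analytic1 : analytic (fun t => fst (x t));
  curve_analytic2 : analytic (fun t => snd (x t));
  curve_periodic : periodic x;
  curve_regular : forall t, vel x t <> (0, 0);
  curve_injective : forall s t,
    0 <= s < 2 * PI -> 0 <= t < 2 * PI -> x s = x t -> s = t;
  curve_counterclockwise : counterclockwise x
}.

(** * The hypersingular operator *)

Definition G (p q : R * R) : R := - / (2 * PI) * ln (enorm (vsub p q)).

(* The second normal derivative of [G p q], along [np] in [p] and [nq] in [q]. *)
Definition d2G (p np q nq : R * R) : R :=
  dot (grad (fun p' => dot (grad (fun q' => G p' q') q) nq) p) np.

(* The arc length integrand, in the parameter [tau], over the part of the curve at
   Euclidean distance more than [eps] from [x t]. *)
Definition truncated_integrand (x : R -> R * R) (phi : R -> R) (t eps tau : R) : R :=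
  if Rlt_dec eps (enorm (vsub (x t) (x tau)))
  then d2G (x t) (normal x t) (x tau) (normal x tau) * phi tau * speed x tau
  else 0.

(* [is_hypersingular x phi t l]: the Hadamard finite part defining the operator in
   parameter space, applied to [phi], exists at [t] and equals [l]. *)
Definition is_hypersingular (x : R -> R * R) (phi : R -> R) (t l : R) : Prop :=
  at_right 0 (fun eps => ex_RInt (truncated_integrand x phi t eps) 0 (2 * PI)) /\
  filterlim
    (fun eps => RInt (truncated_integrand x phi t eps) 0 (2 * PI) - phi t / (PI * eps))
    (at_right 0) (locally l).

(** * Traces and regularized integrands *)

(* [U p y] is the value at [p] of the harmonic function attached to [y] on the curve. *)
Definition dirichlet_trace (x : R -> R * R) (U : R * R -> R * R -> R) (tau t : R) : R :=
  U (x tau) (x t).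

Definition neumann_trace (x : R -> R * R) (U : R * R -> R * R -> R) (tau t : R) : R :=
  dot (grad (fun p => U p (x t)) (x tau)) (normal x tau).

Definition RP (x : R -> R * R) (phi : R -> R) (U : R * R -> R * R -> R)
    (tau t : R) : R :=
  let P := dirichlet_trace x U in
  let d := vsub (x t) (x tau) in
  if excluded_middle_informative (eqmod2pi tau t)
  then / (4 * PI * speed x t ^ 2) * Derive_n (fun s => phi s - P s t) 2 t
  else (dot (normal x tau) (normal x t) / (2 * PI * enorm d ^ 2)
        - dot d (normal x t) * dot d (normal x tau) / (PI * enorm d ^ 4))
       * (phi tau - P tau t).

Definition RQ (x : R -> R * R) (U : R * R -> R * R -> R) (tau t : R) : R :=
  let Q := neumann_trace x U in
  let d := vsub (x t) (x tau) in
  if excluded_middle_informative (eqmod2pi tau t)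
  then dot (acc x t) (normal x t) / (4 * PI * speed x t ^ 2) * Q t t
  else - / (2 * PI) * (dot d (normal x t) / enorm d ^ 2) * Q tau t.

(* Main.v *)
Require Import Defs.
From Stdlib Require Import Reals Lra Lia Psatz ZArith ClassicalEpsilon.
From Coquelicot Require Import Coquelicot.
Open Scope R_scope.

(** Fix [t] and identify the plane with the complex numbers. The harmonic function [U(.,x(t))] is
    the real part of a power series [Phi] about [w = x(t)], normalized by [Im Phi(w) = 0]. With
    [H(z) = n(t) / (2 pi (z - w))], the kernels are [|x'| d2G = d(Im H)/dtau] and
    [dG/dn(x) = Re H], so that on the truncated curve the integrand is
    [(RP + RQ) |x'|] plus [Im (Phi H' dz) - d(Re H Im Phi)]. The latter has an explicit primitive,
    since [Phi = phi(t) + Phi'(w)(z - w) + O((z - w)^2)]: the constant term produces the Hadamard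
    divergence [phi(t)/(pi eps)], the linear term the logarithm of [z - w], whose real part takes
    the same value [ln eps] at both ends, and the rest tends to zero. What remains is
    [- Q(t,t)/(2 pi)] times the variation of the argument of [z - w], which must tend to [pi].

    For the latter, the orientation hypothesis only speaks about points off the curve. It gives
    that every winding number off the curve is 0 or 1 (a point that is not interior can be joined
    to points arbitrarily far away). Crossing the curve at [x(t)] changes the winding number by
    one, so it is 1 on the left and 0 on the right of [x(t)], and the principal value at [x(t)]
    is the average of the two.

    Analyticity along the curve is proved by complexification: the real analytic functions are
    the restrictions of holomorphic germs, which are stable under all the operations involved. *)

(** Harmonicity is given as a second-order differentiability condition with vanishing Laplacian, so
    the power series has to be earned. It comes from the gradient: [u_x - i u_y] is holomorphic with
    a continuous derivative, Cauchy's formula expands it, and termwise integration yields [Phi]. The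
    normalization [Im Phi(w) = 0] is what kills the boundary term [Re H Im Phi]: along the curve
    [Re H] stays bounded, since the chord leaves the tangent only to second order, while [Im Phi]
    tends to 0. The argument of [z - w] is kept out of the primitive because it is not single valued
    along the closed curve. The jump of the winding number is not obtained by following a path
    across the curve. Each one-sided limit lies in {0, 2 pi}, and two half-angle expressions for the
    argument on the same small arc show that the limits differ by exactly 2 pi; this forces both
    values. Truncation by Euclidean distance is not symmetric in the parameter: the cut points
    [t - a] and [t + b] are related only by the common chord length [eps], so the end estimates are
    made on each side separately. *)

(** * Complex differentiation *)

(** These fix the structure on the complex numbers whose balls are those of [Cmod]; the product
    structure on [R * R], used for paths in the plane, has square balls. *)
Notation cder := (@is_derive C_AbsRing (AbsRing_NormedModule C_AbsRing)).
Notation clocally := (@locally (AbsRing_UniformSpace C_AbsRing)).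
Notation ccont := (@continuous (AbsRing_UniformSpace C_AbsRing) (AbsRing_UniformSpace C_AbsRing)).

Lemma clocally_eps (z : C) (P : C -> Prop) :
  clocally z P <-> exists d, 0 < d /\ forall y : C, Cmod (y - z) < d -> P y.
Proof.
  split.
  - intros [d Hd]. exists d. split; [apply cond_pos|]. intros y Hy. apply Hd. exact Hy.
  - intros [d [Hd H]]. exists (mkposreal d Hd). intros y Hy. apply H. exact Hy.
Qed.

Lemma ccont_eps (f : C -> C) (z : C) :
  ccont f z <-> forall eps, 0 < eps -> exists d, 0 < d /\
    forall y : C, Cmod (y - z) < d -> Cmod (f y - f z) < eps.
Proof.
  split.
  - intros H eps He.
    specialize (H (fun u => Cmod (u - f z) < eps)).
    destruct H as [d Hd].
    { exists (mkposreal eps He). intros y Hy. exact Hy. }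
    exists d. split; [apply cond_pos|]. intros y Hy. apply Hd. exact Hy.
  - intros H P [e He].
    destruct (H e (cond_pos e)) as [d [Hd Hd']].
    exists (mkposreal d Hd). intros y Hy. apply He. apply Hd'. exact Hy.
Qed.

Lemma cder_eps (f : C -> C) (z l : C) :
  cder f z l <-> forall eps, 0 < eps -> exists d, 0 < d /\
    forall y : C, Cmod (y - z) < d ->
      Cmod (f y - f z - l * (y - z)) <= eps * Cmod (y - z).
Proof.
  split.
  - intros [_ H] eps He.
    specialize (H z (fun P HP => HP) (mkposreal eps He)).
    apply clocally_eps in H. destruct H as [d [Hd H]].
    exists d. split; [exact Hd|]. intros y Hy. specialize (H y Hy).
    unfold norm, minus, plus, opp, scal in H. simpl in H.
    replace (f y - f z - l * (y - z))%C with (f y + - f z + - ((y + - z) * l))%C by ring.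
    exact H.
  - intros H. split; [apply is_linear_scal_l|].
    intros z' Hz' eps.
    assert (E : z = z') by (apply is_filter_lim_locally_unique with (1 := Hz')).
    subst z'. destruct (H eps (cond_pos eps)) as [d [Hd Hd']].
    apply clocally_eps. exists d. split; [exact Hd|]. intros y Hy. specialize (Hd' y Hy).
    replace (f y - f z - l * (y - z))%C with (f y + - f z + - ((y + - z) * l))%C in Hd' by ring.
    exact Hd'.
Qed.

Lemma cder_cont (f : C -> C) (z l : C) : cder f z l -> ccont f z.
Proof.
  intros H. apply (ex_derive_continuous (K := C_AbsRing) (V := AbsRing_NormedModule C_AbsRing)).
  exists l. exact H.
Qed.

Lemma cder_mult (f g : C -> C) (z df dg : C) : cder f z df -> cder g z dg ->
  cder (fun y => f y * g y)%C z (df * g z + f z * dg)%C.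
Proof. intros Hf Hg. apply (is_derive_mult (K := C_AbsRing) f g z df dg Hf Hg). exact Cmult_comm. Qed.

Lemma cder_plus (f g : C -> C) (z df dg : C) : cder f z df -> cder g z dg ->
  cder (fun y => f y + g y)%C z (df + dg)%C.
Proof. apply (is_derive_plus (K := C_AbsRing) (V := AbsRing_NormedModule C_AbsRing) f g z df dg). Qed.

Lemma cder_const (c z : C) : cder (fun _ => c) z (RtoC 0).
Proof. apply (is_derive_const (K := C_AbsRing) (V := AbsRing_NormedModule C_AbsRing) c z). Qed.

Lemma cder_id (z : C) : cder (fun y => y) z (RtoC 1).
Proof. apply (is_derive_id (K := C_AbsRing) z). Qed.

Lemma cder_comp (f g : C -> C) (z df dg : C) : cder f (g z) df -> cder g z dg ->
  cder (fun y => f (g y)) z (dg * df)%C.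
Proof. apply (is_derive_comp (K := C_AbsRing) (V := AbsRing_NormedModule C_AbsRing) f g z df dg). Qed.

Lemma cder_eq (f : C -> C) (z l l' : C) : cder f z l -> l = l' -> cder f z l'.
Proof. intros H <-. exact H. Qed.

Lemma ccont_mult (f g : C -> C) (z : C) : ccont f z -> ccont g z -> ccont (fun y => f y * g y)%C z.
Proof. apply (continuous_mult (K := C_AbsRing) (U := AbsRing_UniformSpace C_AbsRing) f g z). Qed.

Lemma ccont_plus (f g : C -> C) (z : C) : ccont f z -> ccont g z -> ccont (fun y => f y + g y)%C z.
Proof. apply (continuous_plus (K := C_AbsRing) (U := AbsRing_UniformSpace C_AbsRing) (V :=
  AbsRing_NormedModule C_AbsRing) f g z). Qed.

Lemma ccont_const (c z : C) : ccont (fun _ => c) z.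
Proof. apply continuous_const. Qed.

Lemma ccont_id (z : C) : ccont (fun y => y) z.
Proof. apply (continuous_id (U := AbsRing_UniformSpace C_AbsRing)). Qed.

Lemma ccont_comp (f g : C -> C) (z : C) : ccont g z -> ccont f (g z) -> ccont (fun y => f (g y)) z.
Proof. apply (continuous_comp (U := AbsRing_UniformSpace C_AbsRing) (V := AbsRing_UniformSpace C_AbsRing) (W
  := AbsRing_UniformSpace C_AbsRing) g f z). Qed.

Lemma Cmod_minus_sym (a b : C) : Cmod (a - b) = Cmod (b - a).
Proof. rewrite <- Cmod_opp. f_equal. ring. Qed.

Lemma Cmod_triangle_minus (a b : C) : Cmod a - Cmod b <= Cmod (a - b).
Proof.
  pose proof (Cmod_triangle (a - b) b).
  replace (a - b + b)%C with a in H by ring. lra.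
Qed.

(** Stated with an explicit lower bound, and not just nonvanishing, because the continuity of the
    inverse needs the bound on the denominator. *)
Lemma ccont_neq_0 (f : C -> C) (z : C) : ccont f z -> f z <> 0%C ->
  clocally z (fun y => Cmod (f z) / 2 <= Cmod (f y)).
Proof.
  intros Hf H0. apply Cmod_gt_0 in H0.
  apply ccont_eps with (eps := Cmod (f z) / 2) in Hf; [|lra].
  destruct Hf as [d [Hd H]]. apply clocally_eps. exists d. split; [exact Hd|].
  intros y Hy. specialize (H y Hy). rewrite Cmod_minus_sym in H.
  pose proof (Cmod_triangle_minus (f z) (f y)). lra.
Qed.

Lemma ccont_inv (f : C -> C) (z : C) : ccont f z -> f z <> 0%C -> ccont (fun y => / f y)%C z.
Proof.
  intros Hf H0. pose proof (ccont_neq_0 f z Hf H0) as Hn.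
  pose proof (proj1 (Cmod_gt_0 _) H0) as Hp.
  apply clocally_eps in Hn. destruct Hn as [d1 [Hd1 Hn]].
  rewrite ccont_eps in Hf. apply ccont_eps. intros eps He.
  set (m := Cmod (f z)) in *.
  (* The difference of inverses is [|f z - f y| / (|f y| m)], and [|f y| >= m / 2]. *)
  destruct (Hf (eps * (m * m / 2))) as [d2 [Hd2 H2]]; [assert (0 < m * m) by nra; nra|].
  exists (Rmin d1 d2). split; [apply Rmin_glb_lt; assumption|].
  intros y Hy.
  specialize (Hn y (Rlt_le_trans _ _ _ Hy (Rmin_l _ _))).
  specialize (H2 y (Rlt_le_trans _ _ _ Hy (Rmin_r _ _))).
  assert (Hy0 : f y <> 0%C) by (apply Cmod_gt_0; lra).
  replace (/ f y - / f z)%C with ((f z - f y) / (f y * f z))%C by (field; split; assumption).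
  rewrite Cmod_div by (apply Cmult_neq_0; assumption).
  rewrite Cmod_mult, Cmod_minus_sym. fold m.
  apply Rmult_lt_reg_r with (Cmod (f y) * m); [nra|].
  unfold Rdiv. rewrite Rmult_assoc, Rinv_l by nra.
  assert (m / 2 * (eps * m) <= Cmod (f y) * (eps * m)) by (apply Rmult_le_compat_r; [nra | exact Hn]).
  nra.
Qed.

(** Carathéodory's criterion: convenient where the difference quotient has a closed form that is
    visibly continuous, as for the inverse and the square root. *)
Lemma cder_caratheodory (f psi : C -> C) (z : C) :
  clocally z (fun y => f y - f z = psi y * (y - z))%C -> ccont psi z -> cder f z (psi z).
Proof.
  intros H Hc. apply cder_eps. intros eps He.
  apply clocally_eps in H. destruct H as [d1 [Hd1 H1]].
  rewrite ccont_eps in Hc. destruct (Hc eps He) as [d2 [Hd2 H2]].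
  exists (Rmin d1 d2). split; [apply Rmin_glb_lt; assumption|].
  intros y Hy.
  specialize (H1 y (Rlt_le_trans _ _ _ Hy (Rmin_l _ _))).
  specialize (H2 y (Rlt_le_trans _ _ _ Hy (Rmin_r _ _))).
  rewrite H1. replace (psi y * (y - z) - psi z * (y - z))%C with ((psi y - psi z) * (y - z))%C by ring.
  rewrite Cmod_mult. pose proof (Cmod_ge_0 (y - z)%C). nra.
Qed.

Lemma cder_inv (z : C) : z <> 0%C -> cder (fun y => / y)%C z (- / (z * z))%C.
Proof.
  intros H0.
  assert (Hc : ccont (fun y => - (/ y * / z))%C z).
  { apply (ccont_comp (fun u => - u)%C);
    [|apply (continuous_opp (V:=AbsRing_NormedModule C_AbsRing) (fun u => u)), continuous_id].
    apply ccont_mult; [|apply ccont_const]. apply (ccont_inv (fun y => y)); [apply ccont_id | exact H0]. }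
  eapply cder_eq; [apply (cder_caratheodory (fun y => / y)%C (fun y => - (/ y * / z))%C)|].
  - pose proof (ccont_neq_0 (fun y => y) z (ccont_id z) H0) as Hn.
    apply clocally_eps in Hn. destruct Hn as [d [Hd Hn]]. apply clocally_eps. exists d. split; [exact Hd|].
    intros y Hy. specialize (Hn y Hy).
    pose proof (proj1 (Cmod_gt_0 z) H0).
    assert (y <> 0%C) by (apply Cmod_gt_0; lra).
    field. split; assumption.
  - exact Hc.
  - simpl. field. exact H0.
Qed.

Lemma ccont_opp (f : C -> C) (z : C) : ccont f z -> ccont (fun y => - f y)%C z.
Proof.
  intros H. apply (ccont_comp (fun u => - u)%C f z H).
  apply (continuous_opp (V:=AbsRing_NormedModule C_AbsRing) (fun u => u)), continuous_id.
Qed.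

Lemma cder_opp (f : C -> C) (z df : C) : cder f z df -> cder (fun y => - f y)%C z (- df)%C.
Proof. apply (is_derive_opp (K := C_AbsRing) (V := AbsRing_NormedModule C_AbsRing) f z df). Qed.

(** * Complex power series *)

(** Summation by components lets the theory of real series do the work; convergence always comes
    from summability of the moduli. *)
Definition CSeries (c : nat -> C) : C :=
  (Series (fun n => fst (c n)), Series (fun n => snd (c n))).

Definition abs_summable (c : nat -> C) : Prop := ex_series (fun n => Cmod (c n)).

Lemma Cmod_fst (z : C) : Rabs (fst z) <= Cmod z.
Proof. eapply Rle_trans; [apply Rmax_l | apply Rmax_Cmod]. Qed.

Lemma Cmod_snd (z : C) : Rabs (snd z) <= Cmod z.
Proof. eapply Rle_trans; [apply Rmax_r | apply Rmax_Cmod]. Qed.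

Lemma Cmod_le_sum (z : C) : Cmod z <= Rabs (fst z) + Rabs (snd z).
Proof.
  apply Rsqr_incr_0_var; [|pose proof (Rabs_pos (fst z)); pose proof (Rabs_pos (snd z)); lra].
  unfold Rsqr. replace (Cmod z * Cmod z) with (Cmod z ^ 2) by ring. rewrite Cmod2_alt. unfold Re, Im.
  rewrite <- (pow2_abs (fst z)), <- (pow2_abs (snd z)).
  pose proof (Rabs_pos (fst z)); pose proof (Rabs_pos (snd z)); nra.
Qed.

Lemma abs_summable_fst (c : nat -> C) : abs_summable c -> ex_series (fun n => Rabs (fst (c n))).
Proof.
  intros H. apply (ex_series_le (K := R_AbsRing) (V := R_CompleteNormedModule) _ (fun n => Cmod (c n)));
    [|exact H].
  intros n. unfold norm; simpl. unfold abs; simpl. rewrite Rabs_Rabsolu. apply Cmod_fst.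
Qed.

Lemma abs_summable_snd (c : nat -> C) : abs_summable c -> ex_series (fun n => Rabs (snd (c n))).
Proof.
  intros H. apply (ex_series_le (K := R_AbsRing) (V := R_CompleteNormedModule) _ (fun n => Cmod (c n)));
    [|exact H].
  intros n. unfold norm; simpl. unfold abs; simpl. rewrite Rabs_Rabsolu. apply Cmod_snd.
Qed.

Lemma abs_summable_le (c : nat -> C) (b : nat -> R) :
  (forall n, Cmod (c n) <= b n) -> ex_series b -> abs_summable c.
Proof.
  intros H Hb. apply (ex_series_le (K := R_AbsRing) (V := R_CompleteNormedModule) _ b); [|exact Hb].
  intros n. unfold norm; simpl. unfold abs; simpl. rewrite Rabs_pos_eq by apply Cmod_ge_0. apply H.
Qed.

(** The factor 2 comes from bounding the real and imaginary parts separately; only the existence of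
    some constant matters later. *)
Lemma CSeries_bound (c : nat -> C) (b : nat -> R) :
  (forall n, Cmod (c n) <= b n) -> ex_series b -> Cmod (CSeries c) <= 2 * Series b.
Proof.
  intros H Hb. pose proof (abs_summable_le c b H Hb) as Hc.
  eapply Rle_trans; [apply Cmod_le_sum|]. unfold CSeries; simpl.
  assert (Rabs (Series (fun n => fst (c n))) <= Series b).
  { eapply Rle_trans; [apply Series_Rabs, abs_summable_fst, Hc|].
    apply Series_le; [|exact Hb]. intros n. split; [apply Rabs_pos|].
    eapply Rle_trans; [apply Cmod_fst | apply H]. }
  assert (Rabs (Series (fun n => snd (c n))) <= Series b).
  { eapply Rle_trans; [apply Series_Rabs, abs_summable_snd, Hc|].
    apply Series_le; [|exact Hb]. intros n. split; [apply Rabs_pos|].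
    eapply Rle_trans; [apply Cmod_snd | apply H]. }
  lra.
Qed.

Lemma CSeries_minus (c d : nat -> C) : abs_summable c -> abs_summable d ->
  (CSeries c - CSeries d)%C = CSeries (fun n => c n - d n)%C.
Proof.
  intros Hc Hd. unfold CSeries. apply injective_projections; simpl.
  - symmetry. apply (Series_minus (fun n => fst (c n)) (fun n => fst (d n)));
    apply ex_series_Rabs, abs_summable_fst; assumption.
  - symmetry. apply (Series_minus (fun n => snd (c n)) (fun n => snd (d n)));
    apply ex_series_Rabs, abs_summable_snd; assumption.
Qed.

Lemma CSeries_scal (k : C) (c : nat -> C) : abs_summable c ->
  (CSeries c * k)%C = CSeries (fun n => c n * k)%C.
Proof.
  intros Hc.
  pose proof (ex_series_Rabs _ (abs_summable_fst _ Hc)) as H1.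
  pose proof (ex_series_Rabs _ (abs_summable_snd _ Hc)) as H2.
  unfold CSeries. apply injective_projections; simpl.
  - rewrite <- !Series_scal_r. rewrite <- Series_minus; [reflexivity| |];
      apply ex_series_scal_r; assumption.
  - rewrite <- !Series_scal_r. rewrite <- Series_plus; [reflexivity| |];
      apply ex_series_scal_r; assumption.
Qed.

Lemma CSeries_incr_1 (c : nat -> C) : abs_summable c ->
  CSeries c = (c 0%nat + CSeries (fun n => c (S n)))%C.
Proof.
  intros Hc. unfold CSeries. apply injective_projections; simpl; apply Series_incr_1;
    apply ex_series_Rabs; [apply abs_summable_fst | apply abs_summable_snd]; exact Hc.
Qed.

Lemma CSeries_ext (c d : nat -> C) : (forall n, c n = d n) -> CSeries c = CSeries d.
Proof. intros H. unfold CSeries. f_equal; apply Series_ext; intros n; rewrite H; reflexivity. Qed.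

Definition pser (a : nat -> C) (z : C) : C := CSeries (fun n => a n * z ^ n)%C.

(** Passing to moduli makes the real theory of the radius of convergence available for complex
    coefficients. *)
Definition crad (a : nat -> C) : Rbar := CV_radius (fun n => Cmod (a n)).

Definition dcoef (a : nat -> C) (n : nat) : C := (INR (S n) * a (S n))%C.

Lemma Series_zero (a : nat -> R) : (forall n, a n = 0) -> Series a = 0.
Proof.
  intros H. rewrite (Series_ext a (fun n => 0 * 0)) by (intros n; rewrite H; ring).
  rewrite Series_scal_l. ring.
Qed.

Lemma Cmod_INR (n : nat) : Cmod (INR n) = INR n.
Proof. rewrite Cmod_R. apply Rabs_pos_eq, pos_INR. Qed.

Lemma Cmod_dcoef (a : nat -> C) (n : nat) :
  Cmod (dcoef a n) = PS_derive (fun n => Cmod (a n)) n.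
Proof. unfold dcoef, PS_derive. rewrite Cmod_mult, Cmod_INR. reflexivity. Qed.

Lemma crad_dcoef (a : nat -> C) : crad (dcoef a) = crad a.
Proof.
  unfold crad. rewrite <- (CV_radius_derive (fun n => Cmod (a n))).
  apply CV_radius_ext. intros n. apply Cmod_dcoef.
Qed.

Lemma crad_bound (a : nat -> C) (r M : R) : 0 <= r ->
  (forall n, Cmod (a n) * r ^ n <= M) -> Rbar_le r (crad a).
Proof.
  intros Hr H. unfold crad. apply (CV_radius_bounded (fun n => Cmod (a n))).
  exists M. intros n. rewrite Rabs_pos_eq; [apply H|].
  apply Rmult_le_pos; [apply Cmod_ge_0 | apply pow_le, Hr].
Qed.

Lemma crad_ex_series (a : nat -> C) (r : R) : 0 <= r -> Rbar_lt r (crad a) ->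
  ex_series (fun n => Cmod (a n) * r ^ n).
Proof.
  intros Hr H.
  assert (H' : Rbar_lt (Rabs r) (CV_radius (fun n => Cmod (a n)))) by (rewrite Rabs_pos_eq; assumption).
  apply CV_disk_inside in H'. apply ex_series_Rabs. exact H'.
Qed.

Lemma pser_summable (a : nat -> C) (z : C) : Rbar_lt (Cmod z) (crad a) ->
  abs_summable (fun n => a n * z ^ n)%C.
Proof.
  intros H. apply (abs_summable_le _ (fun n => Cmod (a n) * Cmod z ^ n)).
  - intros n. rewrite Cmod_mult, Cmod_pow. lra.
  - apply crad_ex_series; [apply Cmod_ge_0 | exact H].
Qed.

Lemma Rbar_between (x : R) (y : Rbar) : Rbar_lt x y -> exists r : R, x < r /\ Rbar_lt r y.
Proof.
  destruct y as [y| |]; simpl; intros H.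
  - exists ((x + y) / 2). split; lra.
  - exists (x + 1). split; [lra | exact I].
  - contradiction.
Qed.

(** The constant is twice the sharp one; it is chosen so that, multiplied by [|a (n + 2)|], it gives
    the terms of the second derivative of the series of moduli at [rho]. In the induction, the
    remainder for the next power is [y] times the old remainder plus [(n + 2) z ^ (n + 1) h ^ 2]. *)
Lemma pow_taylor2 (rho : R) (y z : C) (n : nat) : Cmod y <= rho -> Cmod z <= rho ->
  Cmod (y ^ (S (S n)) - z ^ (S (S n)) - INR (S (S n)) * z ^ (S n) * (y - z))%C
    <= INR (S n) * INR (S (S n)) * rho ^ n * Cmod (y - z) ^ 2.
Proof.
  intros Hy Hz. assert (Hr : 0 <= rho) by (eapply Rle_trans; [apply Cmod_ge_0 | exact Hy]).
  induction n as [|n IH].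
  - replace (y ^ 2 - z ^ 2 - INR 2 * z ^ 1 * (y - z))%C with ((y - z) * (y - z))%C.
    2:{ replace (RtoC (INR 2)) with (RtoC 2) by (f_equal; simpl; ring). ring. }
    rewrite Cmod_mult. simpl. pose proof (Cmod_ge_0 (y - z)%C). nra.
  - set (h := (y - z)%C) in *.
    replace (y ^ S (S (S n)) - z ^ S (S (S n)) - INR (S (S (S n))) * z ^ S (S n) * h)%C
      with (y * (y ^ (S (S n)) - z ^ (S (S n)) - INR (S (S n)) * z ^ (S n) * h)
              + INR (S (S n)) * z ^ (S n) * (h * h))%C.
    2:{ rewrite (S_INR (S (S n))), RtoC_plus. unfold h. rewrite !(Cpow_S _ (S n)), !(Cpow_S _ (S (S n))).
        rewrite !(Cpow_S _ (S n)). ring. }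
    eapply Rle_trans; [apply Cmod_triangle|].
    rewrite (Cmod_mult y), !Cmod_mult, Cmod_INR, Cmod_pow.
    pose proof (Cmod_ge_0 h) as Hh.
    assert (Hzn : Cmod z ^ S n <= rho ^ S n) by (apply pow_incr; split; [apply Cmod_ge_0 | exact Hz]).
    assert (H1 : Cmod y * Cmod (y ^ S (S n) - z ^ S (S n) - INR (S (S n)) * z ^ S n * h)
                 <= rho * (INR (S n) * INR (S (S n)) * rho ^ n * Cmod h ^ 2)).
    { apply Rmult_le_compat; try apply Cmod_ge_0; assumption. }
    assert (H2 : INR (S (S n)) * Cmod z ^ S n * (Cmod h * Cmod h)
                 <= INR (S (S n)) * rho ^ S n * (Cmod h * Cmod h)).
    { apply Rmult_le_compat_r; [nra|]. apply Rmult_le_compat_l; [apply pos_INR | exact Hzn]. }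
    eapply Rle_trans; [apply Rplus_le_compat; [exact H1 | exact H2]|].
    rewrite !S_INR. simpl. pose proof (pos_INR n). pose proof (pow_le rho n Hr).
    set (p := rho ^ n) in *. set (m := INR n) in *. set (H' := Cmod h) in *.
    assert (0 <= rho * p) by nra. assert (0 <= rho * p * (H' * H')) by (apply Rmult_le_pos; nra).
    nra.
Qed.

(** Each term of the series has a quadratic remainder in [y - z], with constants that are summable
    because differentiating twice does not change the radius. *)
Lemma pser_cder (a : nat -> C) (z : C) : Rbar_lt (Cmod z) (crad a) ->
  cder (pser a) z (pser (dcoef a) z).
Proof.
  intros Hz.
  destruct (Rbar_between _ _ Hz) as [rho [Hzr Hr]].
  assert (Hr0 : 0 < rho) by (pose proof (Cmod_ge_0 z); lra).
  (* Terms of degree 0 and 1 have no second-order remainder. *)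
  set (B := fun n => match n with S (S k) =>
      INR (S k) * INR (S (S k)) * rho ^ k * Cmod (a n) | _ => 0 end).
  assert (HB : ex_series B).
  { apply ex_series_incr_1, ex_series_incr_1.
    assert (H' : Rbar_lt (Rabs rho) (CV_radius (PS_derive (PS_derive (fun n => Cmod (a n)))))).
    { rewrite !CV_radius_derive. rewrite Rabs_pos_eq by lra. exact Hr. }
    apply CV_disk_inside in H'. apply ex_series_Rabs in H'.
    eapply ex_series_ext; [|exact H'].
    intros n. unfold PS_derive, B.
    change (INR (S n) * (INR (S (S n)) * Cmod (a (S (S n)))) * rho ^ n = INR (S n) * INR (S (S n)) * rho ^ n
      * Cmod (a (S (S n)))). ring. }
  assert (HB0 : 0 <= Series B).
  { rewrite <- (Series_zero (fun _ => 0)) by reflexivity. apply Series_le; [|exact HB].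
    intros [|[|k]]; unfold B; split; try lra.
    repeat apply Rmult_le_pos; try apply pos_INR; try apply Cmod_ge_0. apply pow_le; lra. }
  apply cder_eps. intros eps He.
  (* The first bound keeps [y] in the disc of radius [rho]. In the second, [2 * Series B] is the
     constant of [CSeries_bound], and the [+ 1] avoids a zero denominator. *)
  exists (Rmin (rho - Cmod z) (eps / (2 * Series B + 1))). split.
  { apply Rmin_glb_lt; [lra|]. apply Rdiv_lt_0_compat; lra. }
  intros y Hy.
  pose proof (Rlt_le_trans _ _ _ Hy (Rmin_l _ _)) as Hy1.
  pose proof (Rlt_le_trans _ _ _ Hy (Rmin_r _ _)) as Hy2.
  assert (Hyr : Cmod y < rho).
  { replace y with (z + (y - z))%C by ring. eapply Rle_lt_trans; [apply Cmod_triangle|]. lra. }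
  assert (Hy' : Rbar_lt (Cmod y) (crad a)).
  { eapply Rbar_lt_trans; [|exact Hr]. exact Hyr. }
  (* The derived series is re-indexed to align with [a n * z ^ n]; the term [n = 0] vanishes thanks
     to [INR 0], whatever [pred 0] gives. *)
  assert (HD : abs_summable (fun n => INR n * a n * z ^ (pred n))%C).
  { apply ex_series_incr_1.
    eapply ex_series_ext; [|apply (pser_summable (dcoef a) z); rewrite crad_dcoef; exact Hz].
    intros n. simpl pred. reflexivity. }
  assert (E : pser (dcoef a) z = CSeries (fun n => INR n * a n * z ^ (pred n))%C).
  { rewrite (CSeries_incr_1 _ HD). simpl (INR 0). rewrite !Cmult_0_l, Cplus_0_l.
    unfold pser. apply CSeries_ext. intros n. reflexivity. }
  rewrite E. unfold pser.
  assert (HD' : abs_summable (fun n => INR n * a n * z ^ pred n * (y - z))%C).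
  { unfold abs_summable. eapply ex_series_ext; [|apply (ex_series_scal_r (Cmod (y - z)) _ HD)].
    intros n. simpl. rewrite <- Cmod_mult. reflexivity. }
  pose proof (pser_summable a y Hy') as Sy. pose proof (pser_summable a z Hz) as Sz.
  assert (Syz : abs_summable (fun n => a n * y ^ n - a n * z ^ n)%C).
  { eapply abs_summable_le; [|exact (ex_series_plus (K:=R_AbsRing) (V:=R_NormedModule) _ _ Sy Sz)]. intros n.
    eapply Rle_trans; [apply Cmod_triangle|]. rewrite Cmod_opp. apply Rle_refl. }
  rewrite (CSeries_scal _ _ HD), (CSeries_minus _ _ Sy Sz), (CSeries_minus _ _ Syz HD').
  assert (Hterm : forall n, Cmod (a n * y ^ n - a n * z ^ n - INR n * a n * z ^ pred n * (y - z))%C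
                     <= B n * Cmod (y - z) ^ 2).
  { intros n. destruct n as [|[|k]].
  - unfold B. simpl. replace (a 0%nat * 1 - a 0%nat * 1 - 0 * a 0%nat * 1 * (y - z))%C with (RtoC 0) by ring.
    rewrite Cmod_0. lra.
  - unfold B. simpl. replace (a 1%nat * (y * 1) - a 1%nat * (z * 1) - 1 * a 1%nat * 1 * (y - z))%C with (RtoC
    0) by ring.
    rewrite Cmod_0. lra.
  - simpl pred. unfold B.
    replace (a (S (S k)) * y ^ S (S k) - a (S (S k)) * z ^ S (S k) - INR (S (S k)) * a (S (S k)) * z ^ S k *
      (y - z))%C
      with (a (S (S k)) * (y ^ S (S k) - z ^ S (S k) - INR (S (S k)) * z ^ S k * (y - z)))%C by ring.
    rewrite Cmod_mult.
    pose proof (pow_taylor2 rho y z k (Rlt_le _ _ Hyr) (Rlt_le _ _ Hzr)) as Ht.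
    apply Rmult_le_compat_l with (r := Cmod (a (S (S k)))) in Ht; [|apply Cmod_ge_0].
    eapply Rle_trans; [exact Ht|]. apply Req_le. ring. }
  assert (Hsc : ex_series (fun n => B n * Cmod (y - z) ^ 2)) by (apply ex_series_scal_r; exact HB).
  eapply Rle_trans; [apply (CSeries_bound _ _ Hterm Hsc)|].
  rewrite Series_scal_r.
  assert (Hy3 : (2 * Series B + 1) * Cmod (y - z) <= eps).
  { apply Rmult_lt_compat_l with (r := 2 * Series B + 1) in Hy2; [|lra].
    replace ((2 * Series B + 1) * (eps / (2 * Series B + 1))) with eps in Hy2 by (field; lra). lra. }
  pose proof (Cmod_ge_0 (y - z)%C). simpl. nra.
Qed.

Lemma pser_ccont (a : nat -> C) (z : C) : Rbar_lt (Cmod z) (crad a) -> ccont (pser a) z.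
Proof. intros H. eapply cder_cont. apply pser_cder. exact H. Qed.

Lemma pser_0 (a : nat -> C) : pser a 0 = a 0%nat.
Proof.
  unfold pser.
  assert (E : forall n, Cmod (a (S n) * 0 ^ (S n))%C = 0).
  { intros n. rewrite Cpow_S, Cmult_0_l, Cmult_0_r. apply Cmod_0. }
  rewrite CSeries_incr_1.
  - simpl. rewrite Cmult_1_r.
    replace (CSeries (fun n => a (S n) * (0 * 0 ^ n))%C) with (RtoC 0); [ring|].
    rewrite (CSeries_ext _ (fun _ => RtoC 0)) by (intros n; rewrite Cmult_0_l, Cmult_0_r; reflexivity).
    unfold CSeries. apply injective_projections; simpl; symmetry; apply Series_zero; reflexivity.
  - apply ex_series_incr_1. eapply ex_series_ext; [intros n; symmetry; apply E|].
    apply (ex_series_ext (fun n => 0 ^ n * 0)); [intros n; apply Rmult_0_r|].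
    apply ex_series_scal_r. exists (/ (1 - 0)).
    apply is_series_geom. rewrite Rabs_R0. lra.
Qed.

(** * Cauchy's formula and power series expansion *)

(** The derivative of a complex-valued function of a real parameter. *)
Definition pder (g : R -> C) (t : R) (l : C) : Prop :=
  is_derive (fun s => fst (g s)) t (fst l) /\ is_derive (fun s => snd (g s)) t (snd l).

(** The Cauchy-Riemann equations: multiplication by [l] is the matrix with rows [(l1, - l2)] and
    [(l2, l1)]. The halved [eps] in the proof compares [Cmod] with the maximum norm. *)
Lemma cder_differentiable (F : C -> C) (z l : C) : cder F z l ->
  differentiable_pt_lim (fun u v => fst (F (u, v))) (fst z) (snd z) (fst l) (- snd l) /\
  differentiable_pt_lim (fun u v => snd (F (u, v))) (fst z) (snd z) (snd l) (fst l).
Proof.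
  intros H. rewrite cder_eps in H.
  assert (K : forall eps : posreal, locally_2d (fun u v =>
     Cmod (F (u, v) - F z - l * ((u,
       v) - z)) <= eps * Rmax (Rabs (u - fst z)) (Rabs (v - snd z))) (fst z) (snd z)).
  { intros eps. destruct (H (eps / 2)) as [d [Hd Hd']]; [pose proof (cond_pos eps); lra|].
    assert (Hd2 : 0 < d / 2) by lra.
    exists (mkposreal _ Hd2). simpl. intros u v Hu Hv.
    assert (Hm : Cmod ((u, v) - z) <= 2 * Rmax (Rabs (u - fst z)) (Rabs (v - snd z))).
    { eapply Rle_trans; [apply Cmod_le_sum|]. simpl.
      pose proof (Rmax_l (Rabs (u - fst z)) (Rabs (v - snd z))).
      pose proof (Rmax_r (Rabs (u - fst z)) (Rabs (v - snd z))).
      unfold Rminus in *. lra. }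
    assert (Hm' : Rmax (Rabs (u - fst z)) (Rabs (v - snd z)) < d / 2) by (apply Rmax_lub_lt; assumption).
    eapply Rle_trans; [apply Hd'; lra|].
    apply Rmult_le_compat_l with (r := eps / 2) in Hm; [|pose proof (cond_pos eps); lra]. lra. }
  destruct z as [z1 z2]. simpl in *.
  split; intros eps; destruct (K eps) as [d Hd]; exists d; intros u v Hu Hv;
    (eapply Rle_trans; [|apply Hd; assumption]).
  - eapply Rle_trans; [|apply Cmod_fst]. simpl. apply Req_le. f_equal. ring.
  - eapply Rle_trans; [|apply Cmod_snd]. simpl. apply Req_le. f_equal. ring.
Qed.

Lemma pder_comp (F : C -> C) (g : R -> C) (t : R) (l v : C) :
  cder F (g t) l -> pder g t v -> pder (fun s => F (g s)) t (l * v)%C.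
Proof.
  intros HF [H1 H2]. apply cder_differentiable in HF. destruct HF as [F1 F2].
  split; apply is_derive_Reals.
  - replace (fst (l * v)%C) with (fst l * fst v + - snd l * snd v) by (simpl; ring).
    pose proof (derivable_pt_lim_comp_2d _ (fun s => fst (g s)) (fun s => snd (g s)) t _ _ _ _
      F1 (proj1 (is_derive_Reals _ _ _) H1) (proj1 (is_derive_Reals _ _ _) H2)) as K.
    eapply derivable_pt_lim_ext; [|exact K]. intros s. simpl. rewrite <- surjective_pairing. reflexivity.
  - replace (snd (l * v)%C) with (snd l * fst v + fst l * snd v) by (simpl; ring).
    pose proof (derivable_pt_lim_comp_2d _ (fun s => fst (g s)) (fun s => snd (g s)) t _ _ _ _
      F2 (proj1 (is_derive_Reals _ _ _) H1) (proj1 (is_derive_Reals _ _ _) H2)) as K.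
    eapply derivable_pt_lim_ext; [|exact K]. intros s. simpl. rewrite <- surjective_pairing. reflexivity.
Qed.

Lemma pder_eq (g : R -> C) (t : R) (l l' : C) : pder g t l -> l = l' -> pder g t l'.
Proof. intros H <-. exact H. Qed.

(** Joint continuity in homotopy parameter and angle, as required for differentiation under the
    integral sign. *)
Definition ccont2 (g : R -> R -> C) (u v : R) : Prop :=
  forall eps, 0 < eps -> exists d, 0 < d /\ forall u' v',
    Rabs (u' - u) < d -> Rabs (v' - v) < d -> Cmod (g u' v' - g u v) < eps.

Lemma ccont2_comp (F : C -> C) (g : R -> R -> C) (u v : R) :
  ccont F (g u v) -> ccont2 g u v -> ccont2 (fun u v => F (g u v)) u v.
Proof.
  intros HF Hg eps He. rewrite ccont_eps in HF. destruct (HF eps He) as [d1 [Hd1 H1]].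
  destruct (Hg d1 Hd1) as [d [Hd H]]. exists d. split; [exact Hd|]. intros u' v' Hu Hv.
  apply H1, H; assumption.
Qed.

Lemma ccont2_components (g : R -> R -> C) (u v : R) :
  ccont2 g u v <-> continuity_2d_pt (fun u v => fst (g u v)) u v /\ continuity_2d_pt (fun u v => snd (g u v))
    u v.
Proof.
  split.
  - intros H. split; intros eps; destruct (H eps (cond_pos eps)) as [d [Hd Hd']];
      exists (mkposreal d Hd); intros u' v' Hu Hv; (eapply Rle_lt_trans; [|apply Hd'; eassumption]).
    + eapply Rle_trans; [|apply Cmod_fst]. apply Req_le. reflexivity.
    + eapply Rle_trans; [|apply Cmod_snd]. apply Req_le. reflexivity.
  - intros [H1 H2] eps He. assert (He2 : 0 < eps / 2) by lra.
    destruct (H1 (mkposreal _ He2)) as [d1 K1]. destruct (H2 (mkposreal _ He2)) as [d2 K2]. simpl in *.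
    exists (Rmin d1 d2). split; [apply Rmin_glb_lt; apply cond_pos|].
    intros u' v' Hu Hv.
    specialize (K1 u' v' (Rlt_le_trans _ _ _ Hu (Rmin_l _ _)) (Rlt_le_trans _ _ _ Hv (Rmin_l _ _))).
    specialize (K2 u' v' (Rlt_le_trans _ _ _ Hu (Rmin_r _ _)) (Rlt_le_trans _ _ _ Hv (Rmin_r _ _))).
    eapply Rle_lt_trans; [apply Cmod_le_sum|]. simpl. unfold Rminus in *. lra.
Qed.

Lemma ccont2_mult (f g : R -> R -> C) (u v : R) : ccont2 f u v -> ccont2 g u v ->
  ccont2 (fun u v => f u v * g u v)%C u v.
Proof.
  rewrite !ccont2_components. intros [F1 F2] [G1 G2]. simpl. split.
  - apply (continuity_2d_pt_minus (fun u v => fst (f u v) * fst (g u v)) (fun u v => snd (f u v) * snd (g u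
    v)));
      apply continuity_2d_pt_mult; assumption.
  - apply (continuity_2d_pt_plus (fun u v => fst (f u v) * snd (g u v)) (fun u v => snd (f u v) * fst (g u
    v)));
      apply continuity_2d_pt_mult; assumption.
Qed.

Lemma ccont2_plus (f g : R -> R -> C) (u v : R) : ccont2 f u v -> ccont2 g u v ->
  ccont2 (fun u v => f u v + g u v)%C u v.
Proof.
  rewrite !ccont2_components. intros [F1 F2] [G1 G2]. simpl. split; apply continuity_2d_pt_plus; assumption.
Qed.

Lemma ccont2_const (c : C) (u v : R) : ccont2 (fun _ _ => c) u v.
Proof. apply ccont2_components. split; apply continuity_2d_pt_const. Qed.

Lemma ccont2_slice (g : R -> R -> C) (u v : R) : ccont2 g u v ->
  continuous (fun s => fst (g u s)) v /\ continuous (fun s => snd (g u s)) v.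
Proof.
  intros H. apply ccont2_components in H. destruct H as [H1 H2].
  split; apply continuity_pt_filterlim, continuity_pt_locally; intros eps;
    [destruct (H1 eps) as [d Hd] | destruct (H2 eps) as [d Hd]]; exists d; intros s Hs; apply Hd;
      try exact Hs;
    rewrite Rminus_diag, Rabs_R0; apply cond_pos.
Qed.

Lemma RInt_primitive (f df : R -> R) (a b : R) :
  (forall x, Rmin a b <= x <= Rmax a b -> is_derive f x (df x)) ->
  (forall x, Rmin a b <= x <= Rmax a b -> continuous df x) ->
  RInt df a b = f b - f a.
Proof.
  intros H1 H2. apply is_RInt_unique.
  apply (is_RInt_derive (V := R_CompleteNormedModule) f df a b H1 H2).
Qed.

Definition circ (r theta : R) : C := (r * cos theta, r * sin theta).

Lemma Cmod_circ (r theta : R) : 0 <= r -> Cmod (circ r theta) = r.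
Proof.
  intros Hr. unfold Cmod, circ. simpl.
  replace (r * cos theta * (r * cos theta * 1) + r * sin theta * (r * sin theta * 1))
    with (r * r * ((sin theta)² + (cos theta)²)) by (unfold Rsqr; ring).
  rewrite sin2_cos2, Rmult_1_r. apply sqrt_square, Hr.
Qed.

Lemma circ_neq_0 (r theta : R) : 0 < r -> circ r theta <> 0%C.
Proof. intros Hr. apply Cmod_gt_0. rewrite Cmod_circ; lra. Qed.

Lemma circ_ccont2 (r u v : R) : ccont2 (fun _ theta => circ r theta) u v.
Proof.
  apply ccont2_components. unfold circ; simpl.
  split; apply continuity_2d_pt_mult; try apply continuity_2d_pt_const;
   intros eps.
  - destruct (proj1 (continuity_pt_locally cos v) (continuity_cos v) eps) as [d Hd].
    exists d. intros u' v' _ Hv. apply Hd. exact Hv.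
  - destruct (proj1 (continuity_pt_locally sin v) (continuity_sin v) eps) as [d Hd].
    exists d. intros u' v' _ Hv. apply Hd. exact Hv.
Qed.

Lemma circ_geom (r theta : R) (z : C) : Cmod z < r ->
  r - Cmod z <= Cmod (circ r theta - z) /\ (circ r theta - z)%C <> 0%C.
Proof.
  intros Hz. pose proof (Cmod_ge_0 z).
  assert (H0 : r - Cmod z <= Cmod (circ r theta - z)).
  { pose proof (Cmod_triangle_minus (circ r theta) z) as H1. rewrite Cmod_circ in H1; lra. }
  split; [exact H0|]. apply Cmod_gt_0. lra.
Qed.

(** Continuity of the derivative is built in, so that Cauchy's theorem follows by differentiating an
    integral over a homotopy. *)
Definition disc_holo (f f' : C -> C) (R0 : R) : Prop :=
  forall z, Cmod z < R0 -> cder f z (f' z) /\ ccont f' z.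

Section Cauchy.

Variables (f f' : C -> C) (R0 r : R).
Hypothesis Hf : disc_holo f f' R0.
Hypothesis Hr : 0 < r < R0.

(** The circle of radius [r] contracted linearly to [z]. *)
Let homot (z : C) (l theta : R) : C := (z + l * (circ r theta - z))%C.

(** The range of [l] exceeds [0, 1] on both sides because the integral is differentiated at the end
    points too. *)
Lemma homot_lt (z : C) (l theta : R) : Cmod z < r ->
  - ((R0 - r) / (2 * r)) < l < 1 + (R0 - r) / (2 * r) -> Cmod (homot z l theta) < R0.
Proof.
  intros Hz Hl. pose proof (Cmod_ge_0 z).
  (* With [l] clamped to [0, 1] the point is a convex combination of [z] and a point of the circle;
     the excess [l - l0] moves it by less than [R0 - r], since [|circ - z| < 2 r]. *)
  set (l0 := Rmax 0 (Rmin 1 l)).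
  assert (H0 : 0 <= l0 <= 1) by (unfold l0; split; [apply Rmax_l | apply Rmax_lub; [lra | apply Rmin_l]]).
  assert (H1 : Rabs (l - l0) < (R0 - r) / (2 * r)).
  { unfold l0, Rmax, Rmin. assert (0 < (R0 - r) / (2 * r)) by (apply Rdiv_lt_0_compat; lra).
    destruct (Rle_dec 1 l); destruct (Rle_dec 0 _); apply Rabs_def1; lra. }
  replace (homot z l theta) with ((1 - l0)%R * z + l0 * circ r theta + (l - l0)%R * (circ r theta - z))%C.
  2:{ unfold homot. rewrite !RtoC_minus. ring. }
  eapply Rle_lt_trans; [apply Cmod_triangle|].
  assert (Cmod ((1 - l0)%R * z + l0 * circ r theta) <= r).
  { eapply Rle_trans; [apply Cmod_triangle|]. rewrite !Cmod_mult, !Cmod_R, Cmod_circ by lra.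
    rewrite !Rabs_pos_eq by lra. nra. }
  assert (Cmod ((l - l0)%R * (circ r theta - z)) < (R0 - r) / (2 * r) * (2 * r)).
  { rewrite Cmod_mult, Cmod_R.
    assert (Cmod (circ r theta - z) < 2 * r).
    { eapply Rle_lt_trans; [apply Cmod_triangle|]. rewrite Cmod_opp, Cmod_circ; lra. }
    pose proof (Cmod_ge_0 (circ r theta - z)). pose proof (Rabs_pos (l - l0)). nra. }
  replace ((R0 - r) / (2 * r) * (2 * r)) with (R0 - r) in H3 by (field; lra). lra.
Qed.

Lemma homot_ccont2 (z : C) (l theta : R) : ccont2 (homot z) l theta.
Proof.
  unfold homot. apply ccont2_plus; [apply ccont2_const|]. apply ccont2_mult.
  - apply ccont2_components. simpl. split; [apply continuity_2d_pt_id1 | apply continuity_2d_pt_const].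
  - apply ccont2_plus; [apply circ_ccont2 | apply ccont2_const].
Qed.

(** On the circle [d gamma = i gamma d theta], so this is the Cauchy kernel [d gamma / (gamma - z)]
    up to the factor [i d theta]. *)
Let kern (z : C) (theta : R) : C := (circ r theta / (circ r theta - z))%C.

Lemma kern_ccont2 (z : C) (u v : R) : Cmod z < r -> ccont2 (fun _ => kern z) u v.
Proof.
  intros Hz. unfold kern, Cdiv. apply ccont2_mult; [apply circ_ccont2|].
  apply (ccont2_comp (fun y => / y)%C (fun _ th => circ r th - z)%C).
  - apply (ccont_inv (fun y => y)); [apply ccont_id | apply circ_geom, Hz].
  - apply ccont2_plus; [apply circ_ccont2 | apply ccont2_const].
Qed.

Lemma pder_homot_l (z : C) (l theta : R) : pder (fun l => homot z l theta) l (circ r theta - z)%C.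
Proof. unfold homot; split; simpl; auto_derive; trivial; ring. Qed.

Lemma pder_homot_theta (z : C) (l theta : R) : pder (homot z l) theta (l * (Ci * circ r theta))%C.
Proof. unfold homot, circ; split; simpl; auto_derive; trivial; ring. Qed.

Lemma pder_mult_const (g : R -> C) (t : R) (l c : C) : pder g t l -> pder (fun s => g s * c)%C t (l * c)%C.
Proof.
  intros H. apply (pder_comp (fun y => y * c)%C g t c l) in H.
  - eapply pder_eq; [exact H | ring].
  - eapply cder_eq; [apply cder_mult; [apply cder_id | apply cder_const]|]. simpl. ring.
Qed.

Lemma homot_integrand_der (z : C) (l theta : R) : Cmod z < r ->
  - ((R0 - r) / (2 * r)) < l < 1 + (R0 - r) / (2 * r) ->
  is_derive (fun l => fst (f (homot z l theta) * kern z theta)%C) l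
    (fst (f' (homot z l theta) * circ r theta)%C).
Proof.
  intros Hz Hl.
  pose proof (pder_comp f (fun l => homot z l theta) l _ _ (proj1 (Hf _ (homot_lt z l theta Hz Hl)))
    (pder_homot_l z l theta)) as H.
  apply (pder_mult_const _ _ _ (kern z theta)) in H. apply proj1 in H.
  replace (f' (homot z l theta) * circ r theta)%C
    with (f' (homot z l theta) * (circ r theta - z) * kern z theta)%C; [exact H|].
  unfold kern. field. apply circ_geom, Hz.
Qed.

(** The angular derivative of [f (homot z l theta)] is [i l] times the integrand, so the real part
    has the periodic primitive [Im f / l]; this is where [l] must be nonzero. *)
Lemma homot_zero (z : C) (l : R) : 0 < l < 1 -> Cmod z < r ->
  RInt (fun theta => fst (f' (homot z l theta) * circ r theta)%C) 0 (2 * PI) = 0.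
Proof.
  intros Hl Hz. assert (0 < (R0 - r) / (2 * r)) by (apply Rdiv_lt_0_compat; lra).
  assert (Hl' : - ((R0 - r) / (2 * r)) < l < 1 + (R0 - r) / (2 * r)) by lra.
  rewrite (RInt_primitive (fun th => snd (f (homot z l th)) / l)).
  - unfold homot, circ. rewrite cos_2PI, sin_2PI, cos_0, sin_0. apply Rminus_diag.
  - intros th _.
    pose proof (pder_comp f (homot z l) th _ _ (proj1 (Hf _ (homot_lt z l th Hz Hl'))) (pder_homot_theta z l
      th)) as K.
    apply proj2 in K.
    replace (fst (f' (homot z l th) * circ r th)%C) with
      (/ l * (snd (f' (homot z l th) * (l * (Ci * circ r th)))%C)) by (simpl; field; lra).
    eapply is_derive_ext; [|apply (is_derive_scal _ _ (/ l) _ K)].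
    intros s. simpl. unfold Rdiv. apply Rmult_comm.
  - intros th _. apply (ccont2_slice (fun l th => f' (homot z l th) * circ r th)%C l th).
    apply ccont2_mult; [|apply circ_ccont2].
    apply (ccont2_comp f' (homot z)); [|apply homot_ccont2]. apply Hf, homot_lt; assumption.
Qed.

Lemma cauchy_homotopy (z : C) : Cmod z < r ->
  RInt (fun theta => fst (f (circ r theta) * kern z theta)%C) 0 (2 * PI)
  = RInt (fun theta => fst (f z * kern z theta)%C) 0 (2 * PI).
Proof.
  intros Hz. assert (Hpos : 0 < (R0 - r) / (2 * r)) by (apply Rdiv_lt_0_compat; lra).
  set (Phi := fun l => RInt (fun theta => fst (f (homot z l theta) * kern z theta)%C) 0 (2 * PI)).
  assert (D : forall l, 0 <= l <= 1 -> is_derive Phi l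
     (RInt (fun theta => fst (f' (homot z l theta) * circ r theta)%C) 0 (2 * PI))).
  { intros l Hl.
    assert (Hloc : locally l (fun l => - ((R0 - r) / (2 * r)) < l < 1 + (R0 - r) / (2 * r))).
    { exists (mkposreal _ Hpos). intros y Hy. apply Rabs_def2 in Hy.
      unfold minus, plus, opp in Hy; simpl in Hy. lra. }
    assert (E : RInt (fun theta => fst (f' (homot z l theta) * circ r theta)%C) 0 (2 * PI)
      = RInt (fun theta => Derive (fun l => fst (f (homot z l theta) * kern z theta)%C) l) 0 (2 * PI)).
    { apply RInt_ext. intros th _. symmetry. apply is_derive_unique, homot_integrand_der; [exact Hz|].
      apply locally_singleton in Hloc. exact Hloc. }
    rewrite E. apply (is_derive_RInt_param (fun l theta => fst (f (homot z l theta) * kern z theta)%C)).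
    - eapply filter_imp; [|exact Hloc]. intros y Hy th _. eexists. apply homot_integrand_der; assumption.
    - intros th _.
      apply (continuity_2d_pt_ext_loc (fun l th => fst (f' (homot z l th) * circ r th)%C)).
      + destruct Hloc as [d Hd]. exists d. intros u v Hu _. symmetry.
        apply is_derive_unique, homot_integrand_der; [exact Hz|]. apply Hd. exact Hu.
      + apply ccont2_components, ccont2_mult; [|apply circ_ccont2].
        apply (ccont2_comp f' (homot z)); [|apply homot_ccont2]. apply Hf, homot_lt; [exact Hz|].
        apply locally_singleton in Hloc. exact Hloc.
    - eapply filter_imp; [|exact Hloc]. intros y Hy.
      apply (ex_RInt_continuous (V := R_CompleteNormedModule)). intros th _.
      apply (ccont2_slice (fun l th => f (homot z l th) * kern z th)%C y th).
      apply ccont2_mult; [|apply kern_ccont2, Hz].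
      apply (ccont2_comp f (homot z)); [|apply homot_ccont2].
      eapply cder_cont. apply Hf, homot_lt; assumption. }
  assert (E : Phi 1 = Phi 0).
  (* The mean value theorem asks for the zero derivative only inside (0, 1), where [homot_zero]
     applies, and for continuity at the end points. *)
  { destruct (MVT_gen Phi 0 1 (fun _ => 0)) as [c [_ Hc]].
    - rewrite Rmin_left, Rmax_right by lra. intros l Hl.
      rewrite <- (homot_zero z l Hl Hz). apply D. lra.
    - rewrite Rmin_left, Rmax_right by lra. intros l Hl.
      apply continuity_pt_filterlim, (ex_derive_continuous Phi). eexists. apply D, Hl.
    - lra. }
  unfold Phi in E.
  transitivity (RInt (fun theta => fst (f (homot z 1 theta) * kern z theta)%C) 0 (2 * PI)).
  { apply RInt_ext. intros th _. do 3 f_equal. unfold homot. ring. }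
  rewrite E. apply RInt_ext. intros th _. do 3 f_equal. unfold homot. ring.
Qed.

End Cauchy.

Lemma RInt_fst_Cmult (d : C) (g : R -> C) (a b : R) :
  ex_RInt (fun t => fst (g t)) a b -> ex_RInt (fun t => snd (g t)) a b ->
  RInt (fun t => fst (d * g t)%C) a b
  = fst (d * (RInt (fun t => fst (g t)) a b, RInt (fun t => snd (g t)) a b))%C.
Proof.
  intros H1 H2. simpl.
  transitivity (RInt (fun t => minus (scal (fst d) (fst (g t))) (scal (snd d) (snd (g t)))) a b).
  { apply RInt_ext. intros t _. reflexivity. }
  rewrite (RInt_minus (V := R_CompleteNormedModule)).
  - rewrite !(RInt_scal (V := R_CompleteNormedModule)) by assumption. reflexivity.
  - apply (ex_RInt_scal (V := R_NormedModule)); assumption.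
  - apply (ex_RInt_scal (V := R_NormedModule)); assumption.
Qed.

Lemma RInt_bound (g : R -> R) (a b M : R) : a <= b -> ex_RInt g a b ->
  (forall t, a <= t <= b -> Rabs (g t) <= M) -> Rabs (RInt g a b) <= (b - a) * M.
Proof.
  intros Hab Hg HM.
  apply (norm_RInt_le_const (V := R_NormedModule) g a b (RInt g a b) M Hab HM).
  apply (RInt_correct (V := R_CompleteNormedModule)). exact Hg.
Qed.

(** Cauchy's coefficient integral of [f gamma ^ (- k - 1) d gamma / (2 pi i)], written in the
    angle. *)
Definition tcoef (f : C -> C) (r : R) (k : nat) : C :=
  ( / (2 * PI) * RInt (fun th => fst (f (circ r th) * (/ circ r th) ^ k)%C) 0 (2 * PI),
    / (2 * PI) * RInt (fun th => snd (f (circ r th) * (/ circ r th) ^ k)%C) 0 (2 * PI))%R.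

Section Expansion.

Variables (f f' : C -> C) (R0 r : R).
Hypothesis Hf : disc_holo f f' R0.
Hypothesis Hr : 0 < r < R0.

Lemma disc_holo_circ_ccont2 (u v : R) : ccont2 (fun _ th => f (circ r th)) u v.
Proof.
  apply (ccont2_comp f (fun _ th => circ r th)); [|apply circ_ccont2].
  eapply cder_cont. apply Hf. rewrite Cmod_circ; lra.
Qed.

Lemma ccont2_pow (g : R -> R -> C) (u v : R) (n : nat) : ccont2 g u v -> ccont2 (fun u v => g u v ^ n)%C u v.
Proof.
  intros H. induction n as [|n IH]; simpl; [apply ccont2_const|].
  apply (ccont2_mult g (fun u v => g u v ^ n)%C); assumption.
Qed.

Lemma circ_inv_ccont2 (u v : R) : ccont2 (fun _ th => / circ r th)%C u v.
Proof.
  apply (ccont2_comp (fun y => / y)%C (fun _ th => circ r th)); [|apply circ_ccont2].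
  apply (ccont_inv (fun y => y)); [apply ccont_id | apply circ_neq_0; lra].
Qed.

Lemma ex_RInt_ccont2 (g : R -> C) (a b : R) : (forall v, ccont2 (fun _ => g) 0 v) ->
  ex_RInt (fun t => fst (g t)) a b /\ ex_RInt (fun t => snd (g t)) a b.
Proof.
  intros H. split; apply (ex_RInt_continuous (V := R_CompleteNormedModule)); intros t _;
    apply (ccont2_slice (fun _ => g) 0 t (H t)).
Qed.

Lemma circ_bound : exists M, 0 < M /\ forall th, 0 <= th <= 2 * PI -> Cmod (f (circ r th)) <= M.
Proof.
  pose proof PI_RGT_0.
  assert (B : forall h : R -> R, (forall v, 0 <= v <= 2 * PI -> continuity_pt h v) ->
            exists M, forall v, 0 <= v <= 2 * PI -> Rabs (h v) <= M).
  { intros h Hh.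
    destruct (continuity_ab_maj (fun v => Rabs (h v)) 0 (2 * PI)) as [m [Hm _]]; [lra| |].
    - intros v Hv. apply (continuity_pt_comp h Rabs); [apply Hh, Hv | apply Rcontinuity_abs].
    - exists (Rabs (h m)). exact Hm. }
  destruct (B (fun th => fst (f (circ r th)))) as [M1 H1].
  { intros v _. apply continuity_pt_filterlim. apply (ccont2_slice _ 0 v (disc_holo_circ_ccont2 0 v)). }
  destruct (B (fun th => snd (f (circ r th)))) as [M2 H2].
  { intros v _. apply continuity_pt_filterlim. apply (ccont2_slice _ 0 v (disc_holo_circ_ccont2 0 v)). }
  exists (Rabs M1 + Rabs M2 + 1). split.
  { pose proof (Rabs_pos M1). pose proof (Rabs_pos M2). lra. }
  intros th Hth. eapply Rle_trans; [apply Cmod_le_sum|].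
  specialize (H1 th Hth). specialize (H2 th Hth). simpl in *.
  pose proof (Rle_abs M1). pose proof (Rle_abs M2). lra.
Qed.

(** Only real parts are integrated; the free factor [c] recovers the imaginary part by taking
    [c = - i]. *)
Lemma cauchy_formula (c z : C) : Cmod z < r ->
  RInt (fun th => fst (c * f (circ r th) * (circ r th / (circ r th - z)))%C) 0 (2 * PI)
  = (2 * PI * fst (c * f z)%C)%R.
Proof.
  intros Hz. pose proof (Cmod_ge_0 z) as Hz0.
  assert (Hcf : disc_holo (fun y => c * f y)%C (fun y => c * f' y)%C R0).
  { intros y Hy. destruct (Hf y Hy) as [H1 H2]. split.
    - eapply cder_eq; [apply cder_mult; [apply cder_const | exact H1]|]. simpl. ring.
    - apply ccont_mult; [apply ccont_const | exact H2]. }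
  rewrite (cauchy_homotopy _ _ R0 r Hcf Hr z Hz).
  (* [r^2 / conj gamma = gamma] on the circle, so the conjugate of the Cauchy kernel is
     holomorphic inside and its mean is its value at the centre. *)
  set (d := (c * f z)%C).
  set (g := fun y : C => (Cconj d * / (1 + (- (Cconj z / (r * r)%R)) * y))%C).
  set (g' := fun y : C => (Cconj d * ((- (Cconj z / (r * r)%R)) *
      (- / ((1 + (- (Cconj z / (r * r)%R)) * y) * (1 + (- (Cconj z / (r * r)%R)) * y)))))%C).
  set (e := (- (Cconj z / (r * r)%R))%C).
  assert (He : Cmod e = Cmod z / (r * r)).
  { unfold e. rewrite Cmod_opp, Cmod_div.
    - rewrite Cmod_conj, Cmod_R, Rabs_pos_eq by nra. reflexivity.
    - apply Cmod_gt_0. rewrite Cmod_R, Rabs_pos_eq; nra. }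
  (* The pole of [g] has modulus [r ^ 2 / |z|]; [R1] lies strictly between [r] and that value and
     still makes sense when [z = 0]. *)
  set (R1 := 2 * (r * r) / (r + Cmod z)).
  assert (HR1 : r < R1).
  { unfold R1. apply Rmult_lt_reg_r with (r + Cmod z); [lra|].
    unfold Rdiv. rewrite Rmult_assoc, Rinv_l by lra. nra. }
  assert (Hg : disc_holo g g' R1).
  { intros y Hy.
    assert (Hn : (1 + e * y)%C <> 0%C).
    { apply Cmod_gt_0. pose proof (Cmod_triangle_minus 1 (- (e * y))) as K.
      replace (1 - - (e * y))%C with (1 + e * y)%C in K by ring.
      rewrite Cmod_1, Cmod_opp, Cmod_mult, He in K.
      assert (Cmod z / (r * r) * Cmod y < 1); [|lra].
      destruct (Req_dec (Cmod z) 0) as [Z|Z]; [rewrite Z; unfold Rdiv; rewrite !Rmult_0_l; lra|].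
      assert (Hq : 0 < Cmod z / (r * r)) by (apply Rdiv_lt_0_compat; nra).
      eapply Rlt_le_trans; [apply Rmult_lt_compat_l; [exact Hq | exact Hy]|].
      unfold R1. replace (Cmod z / (r * r) * (2 * (r * r) / (r + Cmod z))) with (2 * Cmod z / (r + Cmod z))
        by (field; lra).
      apply Rmult_le_reg_r with (r + Cmod z); [lra|].
      unfold Rdiv. rewrite Rmult_assoc, Rinv_l by lra. lra. }
    assert (D0 : cder (fun y => 1 + e * y)%C y e).
    { eapply cder_eq; [apply cder_plus; [apply cder_const | apply cder_mult;
      [apply cder_const | apply cder_id]]|].
      simpl. ring. }
    split.
    - eapply cder_eq; [apply cder_mult;
      [apply cder_const | apply (cder_comp (fun y => / y)%C (fun y => 1 + e * y)%C);
        [apply cder_inv, Hn | exact D0]]|].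
      unfold g'. fold e. simpl. ring.
    - unfold g'. fold e. apply ccont_mult; [apply ccont_const|]. apply ccont_mult; [apply ccont_const|].
      apply ccont_opp. apply (ccont_inv (fun y => (1 + e * y) * (1 + e * y))%C).
      + apply ccont_mult; eapply cder_cont; exact D0.
      + apply Cmult_neq_0; exact Hn. }
  assert (Hr1 : 0 < r < R1) by lra.
  assert (H00 : Cmod 0 < r) by (rewrite Cmod_0; lra).
  pose proof (cauchy_homotopy g g' R1 r Hg Hr1 0 H00) as K.
  transitivity (RInt (fun theta => fst (g (circ r theta) * (circ r theta / (circ r theta - 0)))%C) 0 (2 *
    PI)).
  { apply RInt_ext. intros th _.
    destruct (circ_geom r th z Hz) as [_ Hn].
    assert (Hc0 : circ r th <> 0%C) by (apply circ_neq_0; lra).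
    assert (HC : (Cconj (circ r th) * circ r th)%C = RtoC (r * r)).
    { rewrite Cmult_comm, <- Cmod2_conj, Cmod_circ by lra. f_equal. ring. }
    assert (Hrr : RtoC (r * r) <> 0%C) by (intros E; apply RtoC_inj in E; nra).
    assert (HC' : Cconj (circ r th) = (RtoC (r * r) / circ r th)%C).
    { rewrite <- HC. field. exact Hc0. }
    assert (Hn' : (RtoC (r * r) - Cconj z * circ r th)%C <> 0%C).
    { rewrite <- HC. replace (Cconj (circ r th) * circ r th - Cconj z * circ r th)%C
        with (Cconj (circ r th - z) * circ r th)%C by (rewrite Cminus_conj; ring).
      apply Cmult_neq_0; [|exact Hc0]. intros E. apply Hn. apply Cmod_eq_0.
      rewrite <- Cmod_conj, E. apply Cmod_0. }
    change (Re (d * (circ r th / (circ r th - z))) = Re (g (circ r th) * (circ r th / (circ r th - 0)))).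
    rewrite <- re_conj, Cmult_conj, Cdiv_conj, Cminus_conj, HC' by exact Hn.
    f_equal. unfold g. set (rr := RtoC (r * r)) in *. field.
    repeat split; try assumption.
    intros E. apply Hn'. rewrite <- E. ring. }
  rewrite K.
  transitivity (RInt (fun _ => fst d) 0 (2 * PI)).
  { apply RInt_ext. intros th _.
    assert (Hc0 : circ r th <> 0%C) by (apply circ_neq_0; lra).
    assert (Hg0 : g 0 = Cconj d).
    { unfold g. rewrite Cmult_0_r, Cplus_0_r. field. }
    rewrite Hg0. replace (circ r th - 0)%C with (circ r th) by ring.
    replace (circ r th / circ r th)%C with (RtoC 1) by (field; exact Hc0).
    rewrite Cmult_1_r. reflexivity. }
  rewrite RInt_const. unfold scal; simpl; unfold mult; simpl. unfold d. simpl. ring.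
Qed.

(** The Cauchy kernel minus the first [n] terms of its geometric series in [z / gamma]. *)
Let wn (z : C) (n : nat) (th : R) : C := ((z / circ r th) ^ n * (circ r th / (circ r th - z)))%C.

Lemma wn_ccont2 (z : C) (n : nat) (v : R) : Cmod z < r ->
  ccont2 (fun _ th => f (circ r th) * wn z n th)%C 0 v.
Proof.
  intros Hz. apply ccont2_mult; [apply disc_holo_circ_ccont2|]. unfold wn.
  apply ccont2_mult.
  - apply (ccont2_pow (fun _ th => z / circ r th)%C). unfold Cdiv.
    apply ccont2_mult; [apply ccont2_const | apply circ_inv_ccont2].
  - apply (kern_ccont2 r z 0 v Hz).
Qed.

Lemma tcoef_ccont2 (k : nat) (v : R) : ccont2 (fun _ th => f (circ r th) * (/ circ r th) ^ k)%C 0 v.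
Proof.
  apply ccont2_mult; [apply disc_holo_circ_ccont2|].
  apply (ccont2_pow (fun _ th => / circ r th)%C), circ_inv_ccont2.
Qed.

Lemma taylor_remainder (c z : C) (n : nat) : Cmod z < r ->
  (2 * PI * (fst (c * f z)%C - sum_n (fun k => fst (c * (tcoef f r k * z ^ k))%C) n))%R
  = RInt (fun th => fst (c * (f (circ r th) * wn z (S n) th))%C) 0 (2 * PI).
Proof.
  intros Hz. pose proof PI_RGT_0 as HPI.
  (* Peeling off one geometric term: [wn z n = (z / gamma) ^ n + wn z (S n)], and the integral of
     the first summand against [f] is a Taylor term. *)
  assert (Step : forall n, (RInt (fun th => fst (c * (f (circ r th) * wn z n th))%C) 0 (2 * PI)
     - 2 * PI * fst (c * (tcoef f r n * z ^ n))%C)%R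
     = RInt (fun th => fst (c * (f (circ r th) * wn z (S n) th))%C) 0 (2 * PI)).
  { clear n. intros n.
    destruct (ex_RInt_ccont2 _ 0 (2 * PI) (tcoef_ccont2 n)) as [T1 T2].
    destruct (ex_RInt_ccont2 _ 0 (2 * PI) (fun v => wn_ccont2 z n v Hz)) as [W1 W2].
    assert (E : (2 * PI * fst (c * (tcoef f r n * z ^ n))%C)%R =
       RInt (fun th => fst ((c * z ^ n) * (f (circ r th) * (/ circ r th) ^ n))%C) 0 (2 * PI)).
    { rewrite RInt_fst_Cmult by assumption. unfold tcoef.
      set (I1 := RInt (fun th => fst (f (circ r th) * (/ circ r th) ^ n)%C) 0 (2 * PI)).
      set (I2 := RInt (fun th => snd (f (circ r th) * (/ circ r th) ^ n)%C) 0 (2 * PI)).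
      set (q := (z ^ n)%C). simpl. field. lra. }
    rewrite E. symmetry.
    rewrite <- (RInt_minus (V := R_CompleteNormedModule)).
    - apply RInt_ext. intros th _.
      change (fst (c * (f (circ r th) * wn z (S n) th))%C =
         fst (c * (f (circ r th) * wn z n th))%C - fst (c * z ^ n * (f (circ r th) * (/ circ r th) ^ n))%C).
      assert (Hc0 : circ r th <> 0%C) by (apply circ_neq_0; lra).
      destruct (circ_geom r th z Hz) as [_ Hn].
      replace (c * (f (circ r th) * wn z n th))%C
        with (c * (f (circ r th) * wn z (S n) th) + c * z ^ n * (f (circ r th) * (/ circ r th) ^ n))%C.
      + set (A := (c * (f (circ r th) * wn z (S n) th))%C). simpl. ring.
      + unfold wn. rewrite Cpow_S. unfold Cdiv at 1 2 4. rewrite !Cpow_mult_l.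
        set (p := ((/ circ r th) ^ n)%C). set (q := (z ^ n)%C). set (F := f (circ r th)).
        field. split; assumption.
    - apply (ex_RInt_ext (fun th => minus (scal (fst c) (fst (f (circ r th) * wn z n th)%C)) (scal (snd c)
      (snd (f (circ r th) * wn z n th)%C)))).
      { intros th _. reflexivity. }
      apply (ex_RInt_minus (V := R_NormedModule)); apply (ex_RInt_scal (V := R_NormedModule)); assumption.
    - apply (ex_RInt_ext (fun th => minus (scal (fst (c * z ^ n)%C) (fst (f (circ r th) * (/ circ r th) ^
      n)%C)) (scal (snd (c * z ^ n)%C) (snd (f (circ r th) * (/ circ r th) ^ n)%C)))).
      { intros th _. reflexivity. }
      apply (ex_RInt_minus (V := R_NormedModule)); apply (ex_RInt_scal (V := R_NormedModule)); assumption. }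
  assert (Base : RInt (fun th => fst (c * (f (circ r th) * wn z 0 th))%C) 0 (2 * PI) = (2 * PI * fst (c * f
    z)%C)%R).
  { rewrite <- (cauchy_formula c z Hz). apply RInt_ext. intros th _. apply (f_equal (fun u : C => fst u)).
    unfold wn. change ((z / circ r th) ^ 0)%C with (RtoC 1). set (F := f (circ r th)). set (g := circ r th).
    change ((c * (F * (1 * (g / (g - z)))))%C = (c * F * (g / (g - z)))%C). ring. }
  induction n as [|n IH].
  - rewrite sum_O, <- Step, Base. ring.
  - rewrite sum_Sn, <- Step, <- IH.
    set (A := sum_n _ n). set (B := fst (c * (tcoef f r (S n) * z ^ S n))%C).
    change (plus A B) with (A + B). ring.
Qed.

Lemma wn_bound (z : C) (n : nat) (th : R) : Cmod z < r ->
  Cmod (wn z n th) <= (Cmod z / r) ^ n * (r / (r - Cmod z)).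
Proof.
  intros Hz. unfold wn. pose proof (Cmod_ge_0 z) as Hz0.
  destruct (circ_geom r th z Hz) as [Hg Hn].
  assert (Hc0 : circ r th <> 0%C) by (apply circ_neq_0; lra).
  rewrite Cmod_mult, Cmod_pow, !Cmod_div, Cmod_circ by (assumption || lra).
  apply Rmult_le_compat_l.
  - apply pow_le. apply Rdiv_le_0_compat; lra.
  - apply Rmult_le_compat_l; [lra|]. apply Rinv_le_contravar; lra.
Qed.

(** The bound is uniform in [n], which is exactly what [crad_bound] turns into a radius of
    convergence at least [r]. *)
Lemma tcoef_bound : exists M, forall n, Cmod (tcoef f r n) * r ^ n <= M.
Proof.
  pose proof PI_RGT_0 as HPI. destruct circ_bound as [M [HM HB]]. exists (2 * M). intros n.
  destruct (ex_RInt_ccont2 _ 0 (2 * PI) (tcoef_ccont2 n)) as [T1 T2].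
  assert (Hrn : 0 < r ^ n) by (apply pow_lt; lra).
  assert (Hp : forall th, 0 <= th <= 2 * PI -> Cmod (f (circ r th) * (/ circ r th) ^ n) <= M * / r ^ n).
  { intros th Hth. assert (Hc0 : circ r th <> 0%C) by (apply circ_neq_0; lra).
    rewrite Cpow_inv, Cmod_mult, Cmod_inv, Cmod_pow, Cmod_circ by (lra || assumption || (apply Cpow_nz;
      assumption)).
    apply Rmult_le_compat_r; [left; apply Rinv_0_lt_compat, Hrn | apply HB, Hth]. }
  assert (B : forall I, Rabs I <= (2 * PI - 0) * (M * / r ^ n) -> Rabs (/ (2 * PI) * I) <= M * / r ^ n).
  { intros I HI. rewrite Rabs_mult, Rabs_pos_eq by (left; apply Rinv_0_lt_compat; lra).
    apply Rmult_le_reg_l with (2 * PI); [lra|]. rewrite <- Rmult_assoc, Rinv_r by lra. lra. }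
  assert (H : Cmod (tcoef f r n) <= 2 * (M * / r ^ n)).
  { eapply Rle_trans; [apply Cmod_le_sum|]. unfold tcoef; simpl fst; simpl snd.
    replace (2 * (M * / r ^ n)) with (M * / r ^ n + M * / r ^ n) by ring.
    apply Rplus_le_compat; apply B; apply RInt_bound; try assumption; try lra.
    - intros th Hth. eapply Rle_trans;
      [apply (Cmod_fst (f (circ r th) * (/ circ r th) ^ n)%C) | apply Hp, Hth].
    - intros th Hth. eapply Rle_trans;
      [apply (Cmod_snd (f (circ r th) * (/ circ r th) ^ n)%C) | apply Hp, Hth]. }
  apply Rmult_le_compat_r with (r := r ^ n) in H; [|lra].
  replace (2 * (M * / r ^ n) * r ^ n) with (2 * M) in H by (field; lra). exact H.
Qed.

Lemma taylor_series (c z : C) : Cmod z < r ->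
  is_series (fun k => fst (c * (tcoef f r k * z ^ k))%C) (fst (c * f z)%C).
Proof.
  intros Hz. pose proof PI_RGT_0 as HPI. pose proof (Cmod_ge_0 z) as Hz0.
  destruct circ_bound as [M [HM HB]].
  set (K := Cmod c * (M * (r / (r - Cmod z)))).
  assert (Hq : 0 <= Cmod z / r < 1).
  { split; [apply Rdiv_le_0_compat; lra|]. apply Rmult_lt_reg_r with r; [lra|].
    unfold Rdiv. rewrite Rmult_assoc, Rinv_l by lra. lra. }
  assert (Bd : forall n, Rabs (sum_n (fun k => fst (c * (tcoef f r k * z ^ k))%C) n - fst (c * f z)%C) <= K *
    (Cmod z / r) ^ (S n)).
  { intros n. pose proof (taylor_remainder c z n Hz) as E.
    destruct (ex_RInt_ccont2 (fun th => c * (f (circ r th) * wn z (S n) th))%C 0 (2 * PI)) as [W _].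
    { intros v. apply ccont2_mult; [apply ccont2_const | apply wn_ccont2, Hz]. }
    assert (Hb : Rabs (RInt (fun th => fst (c * (f (circ r th) * wn z (S n) th))%C) 0 (2 * PI))
                <= (2 * PI - 0) * (K * (Cmod z / r) ^ (S n))).
    { apply RInt_bound; [lra | exact W|]. intros th Hth. eapply Rle_trans; [apply Cmod_fst|].
      rewrite !Cmod_mult. unfold K. rewrite Rmult_assoc. apply Rmult_le_compat_l; [apply Cmod_ge_0|].
      rewrite Rmult_assoc. apply Rmult_le_compat; try apply Cmod_ge_0; [apply HB, Hth|].
      rewrite Rmult_comm. apply wn_bound, Hz. }
    rewrite <- E, Rabs_mult, (Rabs_pos_eq (2 * PI)) in Hb by lra.
    rewrite Rabs_minus_sym. rewrite Rminus_0_r in Hb. apply Rmult_le_reg_l with (2 * PI); [lra | exact Hb]. }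
  change (is_lim_seq (sum_n (fun k => fst (c * (tcoef f r k * z ^ k))%C)) (fst (c * f z)%C)).
  apply is_lim_seq_spec. intros eps.
  assert (L : is_lim_seq (fun n => K * (Cmod z / r) ^ (S n)) 0).
  { replace (Finite 0) with (Rbar_mult K 0) by (simpl; f_equal; ring).
    apply is_lim_seq_scal_l. apply -> is_lim_seq_incr_1. apply is_lim_seq_geom. rewrite Rabs_pos_eq; lra. }
  apply is_lim_seq_spec in L. destruct (L eps) as [N HN]. exists N. intros n Hn.
  eapply Rle_lt_trans; [apply Bd|]. specialize (HN n Hn). rewrite Rminus_0_r in HN.
  eapply Rle_lt_trans; [apply Rle_abs | exact HN].
Qed.

End Expansion.

Theorem disc_holo_pser (f f' : C -> C) (R0 r : R) : disc_holo f f' R0 -> 0 < r < R0 ->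
  exists a, Rbar_le r (crad a) /\ forall z, Cmod z < r -> f z = pser a z.
Proof.
  intros Hf Hr. exists (tcoef f r). split.
  - destruct (tcoef_bound f f' R0 r Hf Hr) as [M HM]. apply crad_bound with M; [lra | exact HM].
  - intros z Hz. unfold pser, CSeries. apply injective_projections; simpl; symmetry; apply is_series_unique.
    + pose proof (taylor_series f f' R0 r Hf Hr 1 z Hz) as H. rewrite Cmult_1_l in H.
      eapply is_series_ext; [|exact H]. intros k.
      set (u := (tcoef f r k * z ^ k)%C). change (fst (1 * u)%C = fst u). simpl. ring.
    (* The imaginary part of a number is the real part of its product with [- i]. *)
    + pose proof (taylor_series f f' R0 r Hf Hr (- Ci) z Hz) as H.
      replace (snd (f z)) with (fst (- Ci * f z)%C) by (simpl; ring).
      eapply is_series_ext; [|exact H]. intros k.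
      set (u := (tcoef f r k * z ^ k)%C). change (fst (- Ci * u)%C = snd u). simpl. ring.
Qed.

(** * Real analytic functions *)

(* [ring] for equalities whose carrier is only convertible to [R] *)
Ltac rring := match goal with |- @eq _ ?a ?b => first [change (@eq R a b); ring | symmetry;
  change (@eq R b a); ring] end.

Definition analytic_at (f : R -> R) (t : R) : Prop :=
  exists a : nat -> R, locally 0 (fun h : R => is_pseries a h (f (t + h))).

Lemma analytic_at_PSeries (f : R -> R) (t : R) : analytic_at f t <->
  exists (a : nat -> R) (d : R), 0 < d /\ Rbar_lt d (CV_radius a) /\
    forall h, Rabs h < d -> f (t + h) = PSeries a h.
Proof.
  split.
  (* Convergence at [d / 2] forces the radius to be at least [d / 2], which leaves a strict margin
     at [d / 4]. *)
  - intros [a [d Hd]]. exists a, (d / 4). pose proof (cond_pos d) as Hd0.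
    split; [lra|]. split.
    + destruct (Rbar_lt_dec (d / 4) (CV_radius a)) as [H|H]; [exact H|exfalso].
      apply Rbar_not_lt_le in H.
      assert (H2 : Rbar_lt (CV_radius a) (Rabs (d / 2))).
      { rewrite Rabs_pos_eq by lra. eapply Rbar_le_lt_trans; [exact H|]. simpl. lra. }
      apply CV_disk_outside in H2. apply H2, ex_series_lim_0.
      exists (f (t + d / 2)). apply is_pseries_R, Hd.
      change (Rabs (d / 2 - 0) < d). rewrite Rabs_pos_eq; lra.
    + intros h Hh. symmetry. apply is_pseries_unique, Hd.
      change (Rabs (h - 0) < d). rewrite Rminus_0_r. lra.
  - intros [a [d [Hd [Hr H]]]]. exists a. exists (mkposreal d Hd). intros h Hh.
    change (Rabs (h - 0) < d) in Hh. rewrite Rminus_0_r in Hh. rewrite H by exact Hh.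
    apply PSeries_correct, CV_radius_inside. eapply Rbar_lt_trans; [|exact Hr]. exact Hh.
Qed.

Lemma analytic_at_ext_loc (f g : R -> R) (t : R) :
  locally t (fun s => f s = g s) -> analytic_at f t -> analytic_at g t.
Proof.
  intros [d Hd] [a [e He]]. exists a. exists (mkposreal _ (Rmin_stable_in_posreal d e)). intros h Hh.
  change (Rabs (h - 0) < Rmin d e) in Hh. rewrite Rminus_0_r in Hh.
  rewrite <- Hd.
  - apply He. change (Rabs (h - 0) < e). rewrite Rminus_0_r. eapply Rlt_le_trans; [exact Hh | apply Rmin_r].
  - change (Rabs (t + h - t) < d). replace (t + h - t) with h by rring.
    eapply Rlt_le_trans; [exact Hh | apply Rmin_l].
Qed.

Lemma analytic_at_derive (f : R -> R) (t : R) : analytic_at f t ->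
  locally t (ex_derive f) /\ analytic_at (Derive f) t.
Proof.
  intros H. apply analytic_at_PSeries in H. destruct H as [a [d [Hd [Hr H]]]].
  assert (D : forall h, Rabs h < d -> is_derive f (t + h) (PSeries (PS_derive a) h)).
  { intros h Hh.
    apply (is_derive_ext_loc (fun s => PSeries a (s - t))).
    - assert (Hp : 0 < d - Rabs h) by lra. exists (mkposreal _ Hp). intros s Hs.
      change (Rabs (s - (t + h)) < d - Rabs h) in Hs.
      replace s with (t + (s - t)) at 2 by rring. symmetry. apply H.
      replace (s - t) with (s - (t + h) + h) by rring. eapply Rle_lt_trans; [apply Rabs_triang|]. lra.
    - replace (PSeries (PS_derive a) h) with (scal 1 (PSeries (PS_derive a) h)) by (unfold scal; simpl;
      unfold mult; simpl; ring).
      apply (is_derive_comp (PSeries a) (fun s => s - t)).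
      + replace (t + h - t) with h by rring. apply is_derive_PSeries.
        eapply Rbar_lt_trans; [|exact Hr]. exact Hh.
      + auto_derive; [trivial | ring]. }
  split.
  - exists (mkposreal d Hd). intros s Hs. change (Rabs (s - t) < d) in Hs.
    exists (PSeries (PS_derive a) (s - t)). replace s with (t + (s - t)) at 1 by rring. apply D, Hs.
  - apply analytic_at_PSeries. exists (PS_derive a), d. split; [exact Hd|]. split.
    + rewrite CV_radius_derive. exact Hr.
    + intros h Hh. apply is_derive_unique, D, Hh.
Qed.

Lemma analytic_at_ex_derive (f : R -> R) (t : R) : analytic_at f t -> ex_derive f t.
Proof. intros H. apply (locally_singleton t). apply analytic_at_derive, H. Qed.

Lemma analytic_at_continuous (f : R -> R) (t : R) : analytic_at f t -> continuous f t.
Proof. intros H. apply (ex_derive_continuous f), analytic_at_ex_derive, H. Qed.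

(** * Holomorphic germs and their restrictions to the real line *)

Definition holo_at (F : C -> C) (z : C) : Prop :=
  exists F', clocally z (fun y => cder F y (F' y) /\ ccont F' y).

Lemma holo_at_ccont (F : C -> C) (z : C) : holo_at F z -> ccont F z.
Proof. intros [F' H]. apply locally_singleton in H. eapply cder_cont. apply H. Qed.

Lemma holo_at_const (c z : C) : holo_at (fun _ => c) z.
Proof. exists (fun _ => RtoC 0). apply filter_forall. intros y.
split; [apply cder_const | apply ccont_const]. Qed.

Lemma holo_at_id (z : C) : holo_at (fun y => y) z.
Proof. exists (fun _ => RtoC 1). apply filter_forall. intros y. split; [apply cder_id | apply ccont_const].
Qed.

Lemma holo_at_plus (F H : C -> C) (z : C) : holo_at F z -> holo_at H z -> holo_at (fun y => F y + H y)%C z.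
Proof.
  intros [F' HF] [H' HH]. exists (fun y => F' y + H' y)%C.
  eapply filter_imp; [|apply (filter_and _ _ HF HH)]. intros y [[A B] [A' B']].
  split; [apply cder_plus | apply ccont_plus]; assumption.
Qed.

Lemma holo_at_mult (F H : C -> C) (z : C) : holo_at F z -> holo_at H z -> holo_at (fun y => F y * H y)%C z.
Proof.
  intros [F' HF] [H' HH]. exists (fun y => F' y * H y + F y * H' y)%C.
  eapply filter_imp; [|apply (filter_and _ _ HF HH)]. intros y [[A B] [A' B']].
  split; [apply cder_mult; assumption|].
  apply ccont_plus; apply ccont_mult; try assumption; eapply cder_cont; eassumption.
Qed.

Lemma holo_at_comp (F H : C -> C) (z : C) : holo_at F (H z) -> holo_at H z -> holo_at (fun y => F (H y)) z.
Proof.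
  intros [F' HF] HH. pose proof (holo_at_ccont _ _ HH) as Hc. destruct HH as [H' HH].
  exists (fun y => H' y * F' (H y))%C.
  specialize (Hc _ HF). unfold filtermap in Hc.
  eapply filter_imp; [|apply (filter_and _ _ Hc HH)]. intros y [[A B] [A' B']].
  split; [apply cder_comp; assumption|].
  apply ccont_mult; [exact B'|]. apply (ccont_comp F' H); [|exact B]. eapply cder_cont; eassumption.
Qed.

Lemma holo_at_inv (z : C) : z <> 0%C -> holo_at (fun y => / y)%C z.
Proof.
  intros Hz. exists (fun y => - / (y * y))%C.
  pose proof (ccont_neq_0 (fun y => y) z (ccont_id z) Hz) as Hn.
  eapply filter_imp; [|exact Hn]. intros y Hy. apply Cmod_gt_0 in Hz.
  assert ((y : C) <> RtoC 0) by (apply Cmod_gt_0; lra).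
  split; [apply cder_inv; assumption|]. apply ccont_opp. apply (ccont_inv (fun y => y * y)%C).
  - apply ccont_mult; apply ccont_id.
  - apply Cmult_neq_0; assumption.
Qed.

(** The principal root on the right half-plane, by the half-angle formulas. It makes the speed and
    the chord length accessible to complexification without a logarithm. *)
Definition csqrt (z : C) : C :=
  let p := sqrt ((Cmod z + fst z) / 2) in (p, snd z / (2 * p)).

Lemma csqrt_spec (z : C) : 0 < fst z -> (csqrt z * csqrt z)%C = z /\ 0 < fst (csqrt z).
Proof.
  intros Hz. assert (Hm : 0 < Cmod z + fst z) by (pose proof (Cmod_ge_0 z); lra).
  unfold csqrt. set (p := sqrt _).
  assert (Hp : 0 < p) by (apply sqrt_lt_R0; lra).
  assert (Hpp : p * p = (Cmod z + fst z) / 2) by (apply sqrt_sqrt; lra).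
  assert (Hq : Cmod z * Cmod z = fst z * fst z + snd z * snd z).
  { replace (Cmod z * Cmod z) with (Cmod z ^ 2) by ring. rewrite Cmod2_alt. unfold Re, Im. ring. }
  split; [|exact Hp]. destruct z as [x y]. simpl in *. apply injective_projections; simpl.
  - replace (y / (2 * p) * (y / (2 * p))) with (y * y / (4 * (p * p))) by (field; lra).
    rewrite Hpp. replace (y * y) with (Cmod (x, y) * Cmod (x, y) - x * x) by lra. field. lra.
  - field. lra.
Qed.

(** Everything rests on [x - y = (csqrt x - csqrt y) * (csqrt x + csqrt y)]: the second factor is at
    least [Re (csqrt y) > 0], which gives continuity, and then its inverse is the difference
    quotient. *)
Lemma holo_at_csqrt (z : C) : 0 < fst z -> holo_at csqrt z.
Proof.
  intros Hz.
  assert (Hlip : forall y, 0 < fst y -> ccont csqrt y).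
  { intros y Hy. apply ccont_eps. intros eps He. destruct (csqrt_spec y Hy) as [Sy Py].
    exists (Rmin (fst y) (eps * fst (csqrt y))). split; [apply Rmin_glb_lt; nra|]. intros x Hx.
    pose proof (Rlt_le_trans _ _ _ Hx (Rmin_l _ _)) as H1.
    pose proof (Rlt_le_trans _ _ _ Hx (Rmin_r _ _)) as H2.
    assert (Hx0 : 0 < fst x).
    { pose proof (Cmod_fst (x - y)) as K. simpl in K. 
      assert (Rabs (fst x + - fst y) < fst y) by lra. apply Rabs_def2 in H. lra. }
    destruct (csqrt_spec x Hx0) as [Sx Px].
    assert (E : Cmod (csqrt x - csqrt y) * Cmod (csqrt x + csqrt y) = Cmod (x - y)).
    { rewrite <- Cmod_mult. f_equal. transitivity (csqrt x * csqrt x - csqrt y * csqrt y)%C; [ring|].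
      rewrite Sx, Sy. reflexivity. }
    assert (Hb : fst (csqrt y) < Cmod (csqrt x + csqrt y)).
    { eapply Rlt_le_trans; [|apply re_le_Cmod]. unfold Re. eapply Rlt_le_trans; [|apply Rle_abs]. simpl in *.
      lra. }
    pose proof (Cmod_ge_0 (csqrt x - csqrt y)). nra. }
  exists (fun y => / (csqrt y + csqrt y))%C.
  apply clocally_eps. exists (fst z). split; [exact Hz|]. intros y Hy.
  assert (Hy0 : 0 < fst y).
  { pose proof (Cmod_fst (y - z)) as K. simpl in K.
    assert (Rabs (fst y + - fst z) < fst z) by lra. apply Rabs_def2 in H. lra. }
  destruct (csqrt_spec y Hy0) as [Sy Py].
  assert (Hnz : forall a b, 0 < fst a -> 0 < fst b -> (a + b)%C <> 0%C).
  { intros a b Ha Hb E. apply (f_equal fst) in E. simpl in E. lra. }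
  split.
  - apply (cder_caratheodory csqrt (fun x => / (csqrt x + csqrt y))%C).
    + apply clocally_eps. exists (fst y). split; [exact Hy0|]. intros x Hx.
      assert (Hx0 : 0 < fst x).
      { pose proof (Cmod_fst (x - y)) as K. simpl in K.
        assert (Rabs (fst x + - fst y) < fst y) by lra. apply Rabs_def2 in H. lra. }
      destruct (csqrt_spec x Hx0) as [Sx Px].
      assert (Hn := Hnz _ _ Px Py).
      transitivity (/ (csqrt x + csqrt y) * (csqrt x * csqrt x - csqrt y * csqrt y))%C.
      * field. exact Hn.
      * rewrite Sx, Sy. reflexivity.
    + apply (ccont_inv (fun x => csqrt x + csqrt y)%C).
      * apply ccont_plus; [apply Hlip, Hy0 | apply ccont_const].
      * apply Hnz; assumption.
  - apply (ccont_inv (fun x => csqrt x + csqrt x)%C).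
    + apply ccont_plus; apply Hlip, Hy0.
    + apply Hnz; assumption.
Qed.

Lemma csqrt_RtoC (x : R) : 0 < x -> csqrt (RtoC x) = RtoC (sqrt x).
Proof.
  intros Hx. unfold csqrt. rewrite Cmod_R, Rabs_pos_eq by lra. simpl.
  replace ((x + x) / 2) with x by field. unfold RtoC. f_equal. unfold Rdiv. ring.
Qed.

Lemma holo_at_disc (F : C -> C) (z : C) : holo_at F z -> exists F' d, 0 < d /\
  disc_holo (fun y => F (z + y)%C) F' d.
Proof.
  intros [F' H]. apply clocally_eps in H. destruct H as [d [Hd H]].
  exists (fun y => F' (z + y)%C), d. split; [exact Hd|]. intros y Hy.
  destruct (H (z + y)%C) as [H1 H2]; [replace (z + y - z)%C with y by ring; exact Hy|].
  assert (D : cder (fun y => z + y)%C y (RtoC 1)).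
  { eapply cder_eq; [apply cder_plus; [apply cder_const | apply cder_id]|]. simpl. ring. }
  split.
  - eapply cder_eq; [apply (cder_comp F (fun y => z + y)%C); [exact H1 | exact D]|]. simpl. ring.
  - apply (ccont_comp F' (fun y => z + y)%C); [eapply cder_cont; exact D | exact H2].
Qed.

(** The complexified form of analyticity: closure under products, quotients and roots is inherited
    from holomorphic functions instead of being proved on power series. *)
Definition canalytic_at (f : R -> C) (t : R) : Prop :=
  exists F, holo_at F (RtoC t) /\ locally t (fun s : R => f s = F (RtoC s)).

Lemma canalytic_at_const (c : C) (t : R) : canalytic_at (fun _ => c) t.
Proof. exists (fun _ => c). split; [apply holo_at_const | apply filter_forall; reflexivity]. Qed.

Lemma canalytic_at_plus (f g : R -> C) (t : R) : canalytic_at f t -> canalytic_at g t ->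
  canalytic_at (fun s => f s + g s)%C t.
Proof.
  intros [F [HF EF]] [H [HH EH]]. exists (fun y => F y + H y)%C. split; [apply holo_at_plus; assumption|].
  eapply filter_imp; [|apply (filter_and _ _ EF EH)]. intros s [-> ->]. reflexivity.
Qed.

Lemma canalytic_at_mult (f g : R -> C) (t : R) : canalytic_at f t -> canalytic_at g t ->
  canalytic_at (fun s => f s * g s)%C t.
Proof.
  intros [F [HF EF]] [H [HH EH]]. exists (fun y => F y * H y)%C. split; [apply holo_at_mult; assumption|].
  eapply filter_imp; [|apply (filter_and _ _ EF EH)]. intros s [-> ->]. reflexivity.
Qed.

Lemma canalytic_at_comp (G : C -> C) (f : R -> C) (t : R) : holo_at G (f t) -> canalytic_at f t ->
  canalytic_at (fun s => G (f s)) t.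
Proof.
  intros HG [F [HF EF]]. exists (fun y => G (F y)). split.
  - apply holo_at_comp; [|exact HF]. apply locally_singleton in EF. rewrite <- EF. exact HG.
  - eapply filter_imp; [|exact EF]. intros s ->. reflexivity.
Qed.

(** For a real increment the powers are real, so the real and imaginary parts of the coefficients
    are the coefficients of the two parts. *)
Lemma canalytic_at_parts (f : R -> C) (t : R) : canalytic_at f t ->
  analytic_at (fun s => fst (f s)) t /\ analytic_at (fun s => snd (f s)) t.
Proof.
  intros [F [HF EF]]. destruct (holo_at_disc _ _ HF) as [F' [d [Hd HD]]].
  destruct (disc_holo_pser _ _ _ (d / 2) HD) as [a [Ha Hs]]; [lra|].
  assert (Hloc : locally 0 (fun h : R => Rabs h < d / 2)).
  { assert (Hd2 : 0 < d / 2) by lra. exists (mkposreal _ Hd2). intros h Hh.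
    change (Rabs (h - 0) < d / 2) in Hh. rewrite Rminus_0_r in Hh. exact Hh. }
  assert (Hloc2 : locally 0 (fun h : R => f (t + h) = F (RtoC (t + h)))).
  { destruct EF as [e He]. exists e. intros h Hh. apply He.
    change (Rabs (h - 0) < e) in Hh. change (Rabs (t + h - t) < e).
    replace (t + h - t) with (h - 0) by rring. exact Hh. }
  assert (K : locally 0 (fun h : R => f (t + h) = pser a (RtoC h) /\ Rbar_lt (Cmod (RtoC h)) (crad a))).
  { eapply filter_imp; [|apply (filter_and _ _ Hloc Hloc2)]. intros h [H1 H2]. rewrite H2. split.
    - rewrite RtoC_plus. apply Hs. rewrite Cmod_R. exact H1.
    - eapply Rbar_lt_le_trans; [|exact Ha]. rewrite Cmod_R. exact H1. }
  split.
  - exists (fun n => fst (a n)). eapply filter_imp; [|exact K]. intros h [-> Hr].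
    apply is_pseries_R. apply pser_summable, abs_summable_fst, ex_series_Rabs in Hr.
    apply Series_correct in Hr. unfold pser, CSeries. simpl fst at 2.
    eapply is_series_ext; [|exact Hr]. intros n. simpl.
    rewrite <- RtoC_pow. simpl. ring.
  - exists (fun n => snd (a n)). eapply filter_imp; [|exact K]. intros h [-> Hr].
    apply is_pseries_R. apply pser_summable, abs_summable_snd, ex_series_Rabs in Hr.
    apply Series_correct in Hr. unfold pser, CSeries. simpl snd at 2.
    eapply is_series_ext; [|exact Hr]. intros n. simpl.
    rewrite <- RtoC_pow. simpl. ring.
Qed.

Lemma canalytic_at_fst (f : R -> C) (t : R) : canalytic_at f t -> analytic_at (fun s => fst (f s)) t.
Proof. intros H. exact (proj1 (canalytic_at_parts f t H)). Qed.

Lemma analytic_at_canalytic (f : R -> R) (t : R) : analytic_at f t -> canalytic_at (fun s => RtoC (f s)) t.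
Proof.
  intros H. apply analytic_at_PSeries in H. destruct H as [a [d [Hd [Hr H]]]].
  set (c := fun n => RtoC (a n)).
  assert (Hc : Rbar_lt d (crad c)).
  { replace (crad c) with (CV_radius a); [exact Hr|]. apply Lub_Rbar_eqset. intros r. unfold CV_disk, c.
    split; apply ex_series_ext; intros n; rewrite Cmod_R, !Rabs_mult, Rabs_Rabsolu; reflexivity. }
  exists (fun y => pser c (y - RtoC t)%C). split.
  - exists (fun y => pser (dcoef c) (y - RtoC t)%C). apply clocally_eps. exists d. split; [exact Hd|].
    intros y Hy. assert (Hy' : Rbar_lt (Cmod (y - t)) (crad c)) by (eapply Rbar_lt_trans; [|exact Hc];
      exact Hy).
    assert (D : cder (fun y => y - RtoC t)%C y (RtoC 1)).
    { eapply cder_eq; [apply (cder_plus (fun y => y)); [apply cder_id | apply cder_const]|]. simpl. ring. }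
    split.
    + eapply cder_eq; [apply (cder_comp (pser c) (fun y => y - RtoC t)%C); [apply pser_cder;
      exact Hy' | exact D]|]. ring.
    + apply (ccont_comp (pser (dcoef c)) (fun y => y - RtoC t)%C); [eapply cder_cont; exact D|].
      apply pser_ccont. rewrite crad_dcoef. exact Hy'.
  - exists (mkposreal d Hd). intros s Hs. change (Rabs (s - t) < d) in Hs.
    replace s with (t + (s - t)) at 1 by rring. rewrite H by exact Hs.
    rewrite <- RtoC_minus. unfold pser, CSeries, c, PSeries. apply injective_projections; simpl.
    + apply Series_ext. intros n. rewrite <- RtoC_pow. simpl. ring.
    + symmetry. apply Series_zero. intros n. rewrite <- RtoC_pow. simpl. ring.
Qed.

Lemma analytic_at_const (c t : R) : analytic_at (fun _ => c) t.
Proof. apply (canalytic_at_fst (fun _ => RtoC c)), canalytic_at_const. Qed.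

Lemma analytic_at_plus (f g : R -> R) (t : R) : analytic_at f t -> analytic_at g t -> analytic_at (fun s => f
  s + g s) t.
Proof.
  intros Hf Hg. apply (canalytic_at_fst (fun s => RtoC (f s) + RtoC (g s))%C).
  apply canalytic_at_plus; apply analytic_at_canalytic; assumption.
Qed.

Lemma analytic_at_mult (f g : R -> R) (t : R) : analytic_at f t -> analytic_at g t -> analytic_at (fun s => f
  s * g s) t.
Proof.
  intros Hf Hg.
  apply (analytic_at_ext_loc (fun s => fst (RtoC (f s) * RtoC (g s))%C)); [apply filter_forall; intros s;
    simpl; rring|].
  apply (canalytic_at_fst (fun s => RtoC (f s) * RtoC (g s))%C).
  apply canalytic_at_mult; apply analytic_at_canalytic; assumption.
Qed.

Lemma analytic_at_opp (f : R -> R) (t : R) : analytic_at f t -> analytic_at (fun s => - f s) t.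
Proof.
  intros Hf. apply (analytic_at_ext_loc (fun s => -1 * f s)); [apply filter_forall; intros s; simpl; rring|].
  apply analytic_at_mult; [apply analytic_at_const | exact Hf].
Qed.

Lemma analytic_at_minus (f g : R -> R) (t : R) : analytic_at f t -> analytic_at g t -> analytic_at (fun s =>
  f s - g s) t.
Proof. intros Hf Hg. apply (analytic_at_plus f (fun s => - g s)); [exact Hf | apply analytic_at_opp, Hg]. Qed.

Lemma analytic_at_neq_0 (f : R -> R) (t : R) : continuous f t -> f t <> 0 -> locally t (fun s => f s <> 0).
Proof.
  intros Hf H0. apply (Hf (fun y => y <> 0)). exists (mkposreal _ (Rabs_pos_lt _ H0)).
  intros y Hy E. change (Rabs (y - f t) < Rabs (f t)) in Hy. rewrite E, Rminus_0_l, Rabs_Ropp in Hy. lra.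
Qed.

Lemma continuous_locally_pos (f : R -> R) (t : R) : continuous f t -> 0 < f t -> locally t (fun s => 0 < f s).
Proof.
  intros Hf H0. apply (Hf (fun y => 0 < y)). exists (mkposreal _ H0).
  intros y Hy. change (Rabs (y - f t) < f t) in Hy. apply Rabs_def2 in Hy. lra.
Qed.

Lemma analytic_at_inv (f : R -> R) (t : R) : analytic_at f t -> f t <> 0 -> analytic_at (fun s => / f s) t.
Proof.
  intros Hf H0.
  apply (analytic_at_ext_loc (fun s => fst (/ RtoC (f s))%C)).
  - eapply filter_imp; [|apply (analytic_at_neq_0 f t (analytic_at_continuous f t Hf) H0)].
    intros s Hs. rewrite <- RtoC_inv by exact Hs. reflexivity.
  - apply (canalytic_at_fst (fun s => / RtoC (f s))%C).
    apply (canalytic_at_comp (fun y => / y)%C (fun s => RtoC (f s))).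
    + apply holo_at_inv. intros E. apply H0. apply RtoC_inj in E. exact E.
    + apply analytic_at_canalytic, Hf.
Qed.

Lemma analytic_at_div (f g : R -> R) (t : R) : analytic_at f t -> analytic_at g t -> g t <> 0 ->
  analytic_at (fun s => f s / g s) t.
Proof. intros Hf Hg H0. apply (analytic_at_mult f (fun s => / g s)); [exact Hf | apply analytic_at_inv;
  assumption]. Qed.

Lemma analytic_at_sqrt (f : R -> R) (t : R) : analytic_at f t -> 0 < f t -> analytic_at (fun s => sqrt (f s))
  t.
Proof.
  intros Hf H0.
  apply (analytic_at_ext_loc (fun s => fst (csqrt (RtoC (f s))))).
  - pose proof (continuous_locally_pos f t (analytic_at_continuous f t Hf) H0) as K.
    eapply filter_imp; [|exact K]. intros s Hs. rewrite csqrt_RtoC by exact Hs. reflexivity.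
  - apply (canalytic_at_fst (fun s => csqrt (RtoC (f s)))).
    apply (canalytic_at_comp csqrt (fun s => RtoC (f s))).
    + apply holo_at_csqrt. exact H0.
    + apply analytic_at_canalytic, Hf.
Qed.

(** Continuity of [m] suffices, since the difference quotient at [t] is [m] itself. *)
Lemma is_derive_sub_mult (m : R -> R) (t : R) : continuous m t -> is_derive (fun s => (s - t) * m s) t (m t).
Proof.
  intros Hm. apply is_derive_Reals. intros eps He.
  apply (continuity_pt_filterlim m t) in Hm. pose proof (proj1 (continuity_pt_locally m t) Hm) as Hm2.
  destruct (Hm2 (mkposreal eps He)) as [d Hd]. exists d. intros h H0 Hh.
  replace (((t + h - t) * m (t + h) - (t - t) * m t) / h) with (m (t + h)) by (field; exact H0).
  apply Hd. change (Rabs (t + h - t) < d). replace (t + h - t) with h by rring. exact Hh.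
Qed.

(** Removal of a simple zero. The quotient is analytic only at [t], but the factorization holds for
    every [s], so later identities between quotients need no neighbourhood. *)
Lemma analytic_at_factor (f : R -> R) (t : R) : analytic_at f t -> f t = 0 ->
  exists g, analytic_at g t /\ g t = Derive f t /\ forall s, f s = (s - t) * g s.
Proof.
  intros [a Ha] H0.
  set (g := fun s => if Req_EM_T s t then a 1%nat else f s / (s - t)).
  assert (Hg : analytic_at g t).
  (* Dividing by [h] shifts the coefficients, as the constant one is [f t = 0]; the value [a 1]
     assigned at [t] is the one the shifted series has there. *)
  { exists (PS_decr_1 a). eapply filter_imp; [|exact Ha]. intros h Hh. unfold g.
    destruct (Req_EM_T (t + h) t) as [E|E].
    - assert (h = 0) by lra. subst h. apply (is_pseries_0 (K := R_AbsRing) (PS_decr_1 a)).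
    - replace (t + h - t) with h by rring. assert (Hn : h <> 0) by (intros ->; apply E; ring).
      assert (A0 : a 0%nat = 0).
      { apply locally_singleton in Ha. rewrite Rplus_0_r, H0 in Ha. apply is_pseries_unique in Ha.
        rewrite PSeries_0 in Ha. exact Ha. }
      pose proof (is_pseries_decr_1 (K := R_AbsRing) (V := R_NormedModule) a h (/ h) _ (Rinv_l h Hn) Hh) as K.
      rewrite A0 in K. replace (f (t + h) / h) with (scal (/ h) (plus (f (t + h)) (opp 0))); [exact K|].
      change (/ h * (f (t + h) + - 0) = f (t + h) / h). field. exact Hn. }
  assert (E : forall s, f s = (s - t) * g s).
  { intros s. unfold g. destruct (Req_EM_T s t) as [->|E]; [rewrite H0; ring|]. field. lra. }
  exists g. split; [exact Hg|]. split; [|exact E]. symmetry. apply is_derive_unique.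
  apply (is_derive_ext (fun s => (s - t) * g s)); [intros s; symmetry; apply E|].
  apply is_derive_sub_mult, analytic_at_continuous, Hg.
Qed.

Lemma analytic_at_factor2 (f : R -> R) (t : R) : analytic_at f t -> f t = 0 -> Derive f t = 0 ->
  exists g, analytic_at g t /\ g t = Derive_n f 2 t / 2 /\ forall s, f s = (s - t) ^ 2 * g s.
Proof.
  intros Hf H0 H1. destruct (analytic_at_factor f t Hf H0) as [g1 [Hg1 [E1 F1]]].
  destruct (analytic_at_factor g1 t Hg1) as [g [Hg [E2 F2]]]; [rewrite E1; exact H1|].
  assert (F : forall s, f s = (s - t) ^ 2 * g s) by (intros s; rewrite F1, F2; ring).
  exists g. split; [exact Hg|]. split; [|exact F].
  (* From [f = (s - t) ^ 2 g] one gets [f' = (s - t) m] near [t], hence [f'' t = m t = 2 g t]. *)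
  set (m := fun s => 2 * g s + (s - t) * Derive g s).
  assert (Hm : continuous m t).
  { apply (continuous_plus (fun s => 2 * g s) (fun s => (s - t) * Derive g s)).
    - apply (continuous_scal_r 2 g). apply analytic_at_continuous, Hg.
    - apply (continuous_mult (fun s => s - t) (Derive g)).
      + apply (ex_derive_continuous (fun s => s - t)). auto_derive. trivial.
      + apply analytic_at_continuous, analytic_at_derive, Hg. }
  assert (D : locally t (fun s => Derive f s = (s - t) * m s)).
  { eapply filter_imp; [|apply (proj1 (analytic_at_derive g t Hg))]. intros s Hs.
    rewrite (Derive_ext f _ s F). apply is_derive_unique. unfold m.
    auto_derive; [exact Hs|]. change (fun x => g x) with g. ring. }
  assert (D2 : Derive_n f 2 t = m t).
  { change (Derive (Derive f) t = m t). rewrite (Derive_ext_loc _ _ t D).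
    apply is_derive_unique, is_derive_sub_mult, Hm. }
  rewrite D2. unfold m. field.
Qed.

Lemma analytic_analytic_at (f : R -> R) : analytic f <-> forall t, analytic_at f t.
Proof. reflexivity. Qed.

Lemma analytic_at_id (t : R) : analytic_at (fun s => s) t.
Proof.
  apply (canalytic_at_fst RtoC). exists (fun y => y).
  split; [apply holo_at_id | apply filter_forall; reflexivity].
Qed.

Lemma analytic_at_shift (f : R -> R) (c t : R) : (forall s,
  f (s + c) = f s) -> analytic_at f t -> analytic_at f (t + c).
Proof.
  intros Hf [a Ha]. exists a. eapply filter_imp; [|exact Ha]. intros h Hh.
  replace (t + c + h) with (t + h + c) by (simpl; ring). rewrite Hf. exact Hh.
Qed.

(** * Harmonic functions as real parts *)

Lemma cder_cauchy_riemann (F : C -> C) (z l : C) :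
  differentiable_pt_lim (fun u v => fst (F (u, v))) (fst z) (snd z) (fst l) (- snd l) ->
  differentiable_pt_lim (fun u v => snd (F (u, v))) (fst z) (snd z) (snd l) (fst l) ->
  cder F z l.
Proof.
  intros H1 H2. apply cder_eps. intros eps He. assert (He2 : 0 < eps / 2) by lra.
  destruct (H1 (mkposreal _ He2)) as [d1 K1]. destruct (H2 (mkposreal _ He2)) as [d2 K2]. simpl in *.
  exists (Rmin d1 d2). split; [apply Rmin_glb_lt; apply cond_pos|].
  intros [y1 y2] Hy. destruct z as [z1 z2]. simpl in *.
  pose proof (Cmod_fst ((y1, y2) - (z1, z2))) as A1. pose proof (Cmod_snd ((y1, y2) - (z1, z2))) as A2.
  simpl in A1, A2.
  pose proof (Rmin_l d1 d2). pose proof (Rmin_r d1 d2).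
  assert (B : Rmax (Rabs (y1 - z1)) (Rabs (y2 - z2)) <= Cmod ((y1, y2) - (z1, z2))) by (apply Rmax_lub;
    assumption).
  assert (B1 : Rabs (y1 - z1) < Rmin d1 d2) by (eapply Rle_lt_trans; [exact A1 | exact Hy]).
  assert (B2 : Rabs (y2 - z2) < Rmin d1 d2) by (eapply Rle_lt_trans; [exact A2 | exact Hy]).
  specialize (K1 y1 y2 ltac:(lra) ltac:(lra)). specialize (K2 y1 y2 ltac:(lra) ltac:(lra)).
  eapply Rle_trans; [apply Cmod_le_sum|]. simpl.
  set (A := Cmod _) in *.
  match type of K1 with Rabs ?a <= _ => match goal with |- Rabs ?b + Rabs ?c <= _ => replace b with a by ring
    end end.
  match type of K2 with Rabs ?a <= _ => match goal with |- _ + Rabs ?c <= _ => replace c with a by ring end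
    end.
  assert (eps / 2 * Rmax (Rabs (y1 - z1)) (Rabs (y2 - z2)) <= eps / 2 * A) by (apply Rmult_le_compat_l; lra).
  lra.
Qed.

(** Continuity of one of the two partial derivatives is enough for joint differentiability. *)
Lemma C1_differentiable (f : R -> R -> R) (x y : R) :
  locally_2d (fun u v => ex_derive (fun z => f z v) u) x y -> ex_derive (fun z => f x z) y ->
  continuity_2d_pt (fun u v => Derive (fun z => f z v) u) x y ->
  differentiable_pt_lim f x y (Derive (fun z => f z y) x) (Derive (fun z => f x z) y).
Proof.
  intros H1 H2 H3. apply filterdiff_differentiable_pt_lim.
  eapply filterdiff_ext_lin;
    [apply (is_derive_filterdiff f x y (fun u v => Derive (fun z => f z v) u) (Derive (fun z => f x z) y))|].
  - apply locally_2d_locally in H1. eapply filter_imp; [|exact H1]. intros [u v] H. apply Derive_correct.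
    exact H.
  - apply Derive_correct, H2.
  - apply continuity_2d_pt_filterlim in H3. exact H3.
  - intros [u v]. reflexivity.
Qed.

Section Harmonic.

Variable u : R * R -> R.
Hypothesis Hu : harmonic u.

Let ux (a b : R) : R := Derive (fun z => u (z, b)) a.
Let uy (a b : R) : R := Derive (fun z => u (a, z)) b.

Lemma harmonic_differentiable (a b : R) :
  differentiable_pt_lim (fun a b => u (a, b)) a b (ux a b) (uy a b).
Proof.
  apply (C1_differentiable (fun a b => u (a, b))).
  - exists (mkposreal 1 Rlt_0_1). intros u' v' _ _. destruct (Hu u' v') as [[_ [H _]] _]. exact H.
  - destruct (Hu a b) as [[_ [_ [H _]]] _]. exact H.
  - destruct (Hu a b) as [[_ [_ [_ [[H _] _]]]] _]. exact H.
Qed.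

(** [u_x - i u_y], the derivative of any holomorphic function with real part [u]. *)
Definition cgrad (z : C) : C := (ux (fst z) (snd z), - uy (fst z) (snd z)).

Definition cgrad' (z : C) : C :=
  (Derive (fun s => ux s (snd z)) (fst z), - Derive (fun s => uy s (snd z)) (fst z)).

Lemma differentiable_pt_lim_opp (f : R -> R -> R) (x y lx ly : R) :
  differentiable_pt_lim f x y lx ly -> differentiable_pt_lim (fun a b => - f a b) x y (- lx) (- ly).
Proof.
  intros H eps. destruct (H eps) as [d Hd]. exists d. intros a b Ha Hb.
  replace (- f a b - - f x y - (- lx * (a - x) + - ly * (b - y)))
    with (- (f a b - f x y - (lx * (a - x) + ly * (b - y)))) by ring.
  rewrite Rabs_Ropp. apply Hd; assumption.
Qed.

(** The two Cauchy-Riemann equations for [u_x - i u_y] are Laplace's equation ([Lap]) and the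
    symmetry of second derivatives ([Sch]). *)
Lemma cgrad_cder (z : C) : cder cgrad z (cgrad' z).
Proof.
  destruct z as [a b].
  assert (E1 : uy = fun a b => Derive (fun z => u (a, z)) b) by reflexivity.
  assert (Lap : Derive (fun s => uy a s) b = - Derive (fun s => ux s b) a).
  { destruct (Hu a b) as [_ H]. unfold partial_derive in H. simpl in H. unfold ux, uy. 
    assert (A : Derive (fun x => Derive (fun x0 => u (x0, b)) x) a + Derive (fun x => Derive (fun x0 => u (a,
      x0)) x) b = 0) by exact H.
    lra. }
  assert (Sch : Derive (fun s => ux a s) b = Derive (fun s => uy s b) a).
  { symmetry. unfold ux, uy. apply (Schwarz (fun a b => u (a, b))).
    - exists (mkposreal 1 Rlt_0_1). intros u' v' _ _. destruct (Hu u' v') as [H _].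
      destruct H as [_ [H1 [H2 [[_ [H3 [H4 _]]] [_ [H5 [H6 _]]]]]]]. split; [exact H1|]. split; [exact H2|].
      split; [exact H5 | exact H4].
    - destruct (Hu a b) as [H _]. destruct H as [_ [_ [_ [_ [_ [_ [_ [[H _] _]]]]]]]]. exact H.
    - destruct (Hu a b) as [H _]. destruct H as [_ [_ [_ [[_ [_ [_ [_ [H _]]]]] _]]]]. exact H. }
  apply cder_cauchy_riemann; unfold cgrad, cgrad'; simpl.
  - replace (- - Derive (fun s => uy s b) a) with (Derive (fun s => ux a s) b) by (rewrite Sch; ring).
    apply (C1_differentiable ux).
    + exists (mkposreal 1 Rlt_0_1). intros u' v' _ _. destruct (Hu u' v') as [H _].
      destruct H as [_ [_ [_ [[_ [H _]] _]]]]. exact H.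
    + destruct (Hu a b) as [H _]. destruct H as [_ [_ [_ [[_ [_ [H _]]] _]]]]. exact H.
    + destruct (Hu a b) as [H _]. destruct H as [_ [_ [_ [[_ [_ [_ [[H _] _]]]] _]]]]. exact H.
  - replace (Derive (fun s => ux s b) a) with (- Derive (fun s => uy a s) b) by lra.
    apply differentiable_pt_lim_opp. apply (C1_differentiable uy).
    + exists (mkposreal 1 Rlt_0_1). intros u' v' _ _. destruct (Hu u' v') as [H _].
      destruct H as [_ [_ [_ [_ [_ [H _]]]]]]. exact H.
    + destruct (Hu a b) as [H _]. destruct H as [_ [_ [_ [_ [_ [_ [H _]]]]]]]. exact H.
    + destruct (Hu a b) as [H _]. destruct H as [_ [_ [_ [_ [_ [_ [_ [[H _] _]]]]]]]]. exact H.
Qed.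

Lemma cgrad'_ccont (z : C) : ccont cgrad' z.
Proof.
  assert (K : ccont2 (fun a b => cgrad' (a, b)) (fst z) (snd z)).
  { apply ccont2_components. unfold cgrad'; simpl. destruct (Hu (fst z) (snd z)) as [H _]. split.
    - destruct H as [_ [_ [_ [[_ [_ [_ [[H _] _]]]] _]]]]. exact H.
    - apply continuity_2d_pt_opp. destruct H as [_ [_ [_ [_ [_ [_ [_ [[H _] _]]]]]]]]. exact H. }
  apply ccont_eps. intros eps He. destruct (K eps He) as [d [Hd Hd']]. exists d. split; [exact Hd|].
  intros y Hy. pose proof (Cmod_fst (y - z)) as A1. pose proof (Cmod_snd (y - z)) as A2. simpl in A1, A2.
  specialize (Hd' (fst y) (snd y)). rewrite <- !surjective_pairing in Hd'.
  apply Hd'; eapply Rle_lt_trans; eassumption.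
Qed.

End Harmonic.

Lemma pser_shift (b : nat -> C) (y : C) : Rbar_lt (Cmod y) (crad b) ->
  pser b y = (b 0%nat + y * pser (fun n => b (S n)) y)%C.
Proof.
  intros Hy. pose proof (pser_summable b y Hy) as Hs. unfold pser at 1. rewrite (CSeries_incr_1 _ Hs).
  simpl Cpow at 1. rewrite Cmult_1_r. f_equal.
  assert (Hs' : abs_summable (fun n => b (S n) * y ^ n)%C).
  { apply pser_summable. unfold crad.
    replace (CV_radius (fun n => Cmod (b (S n)))) with (crad b); [exact Hy|].
    symmetry. apply (CV_radius_decr_1 (fun n => Cmod (b n))). }
  unfold pser. rewrite Cmult_comm, (CSeries_scal _ _ Hs'). apply CSeries_ext. intros n. rewrite Cpow_S. ring.
Qed.

Lemma crad_shift (b : nat -> C) : crad (fun n => b (S n)) = crad b.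
Proof. apply (CV_radius_decr_1 (fun n => Cmod (b n))). Qed.

Definition icoef (a : nat -> C) (n : nat) : C :=
  match n with O => RtoC 0 | S k => (a k / INR (S k))%C end.

Lemma dcoef_icoef (a : nat -> C) (n : nat) : dcoef (icoef a) n = a n.
Proof.
  unfold dcoef, icoef. field. intros E. apply RtoC_inj in E.
  apply (not_0_INR (S n)) in E; [exact E | discriminate].
Qed.

Lemma crad_icoef (a : nat -> C) : crad (icoef a) = crad a.
Proof.
  rewrite <- crad_dcoef. apply CV_radius_ext. intros n. rewrite dcoef_icoef. reflexivity.
Qed.

Lemma pser_ext (a b : nat -> C) (y : C) : (forall n, a n = b n) -> pser a y = pser b y.
Proof. intros H. apply CSeries_ext. intros n. rewrite H. reflexivity. Qed.

Lemma pser_icoef_cder (a : nat -> C) (y : C) : Rbar_lt (Cmod y) (crad a) -> cder (pser (icoef a)) y (pser a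
  y).
Proof.
  intros Hy. rewrite <- (pser_ext (dcoef (icoef a)) a) by apply dcoef_icoef.
  apply pser_cder. rewrite crad_icoef. exact Hy.
Qed.

Lemma cder_translate (F : C -> C) (w z l : C) : cder F (z - w)%C l -> cder (fun y => F (y - w)%C) z l.
Proof.
  intros H.
  assert (D : cder (fun y => y - w)%C z (RtoC 1)).
  { eapply cder_eq; [apply (cder_plus (fun y => y)); [apply cder_id | apply cder_const]|]. simpl. ring. }
  eapply cder_eq; [apply (cder_comp F (fun y => y - w)%C _ _ _ H D)|]. simpl. ring.
Qed.

(* [Psi] is a primitive of the second divided difference of [Phi] at [w]. *)
Theorem harmonic_conjugate (u : R * R -> R) (w : C) (r : R) : harmonic u -> 0 < r ->
  exists Phi Phi' Psi : C -> C, snd (Phi w) = 0 /\ ccont Psi w /\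
    forall z, Cmod (z - w) < r ->
      cder Phi z (Phi' z) /\ holo_at Phi z /\ holo_at Phi' z /\
      fst (Phi z) = u z /\ Phi' z = (fst (grad u z), - snd (grad u z)) /\
      (z <> w -> cder Psi z ((Phi z - Phi w - Phi' w * (z - w)) / ((z - w) * (z - w)))%C).
Proof.
  intros Hu Hr.
  (* The extra 1 is room: the expansion theorem yields a series on any strictly smaller disc. *)
  assert (HD : disc_holo (fun y => cgrad u (w + y)%C) (fun y => cgrad' u (w + y)%C) (r + 1)).
  { assert (D : forall y, cder (fun y => w + y)%C y (RtoC 1)).
    { intros y. eapply cder_eq; [apply cder_plus; [apply cder_const | apply cder_id]|]. simpl. ring. }
    intros y _. split.
    - eapply cder_eq; [apply (cder_comp (cgrad u) (fun y => w + y)%C); [apply cgrad_cder, Hu | apply D]|].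
      simpl. ring.
    - apply (ccont_comp (cgrad' u) (fun y => w + y)%C); [eapply cder_cont; apply D | apply cgrad'_ccont, Hu].
      }
  destruct (disc_holo_pser _ _ (r + 1) r HD) as [a [Ha Hs]]; [lra|].
  (* The integrated series vanishes at [w], so the real constant [u w] gives [Phi] a real value
     there. *)
  set (Phi := fun z : C => (RtoC (u w) + pser (icoef a) (z - w))%C).
  set (Phi' := fun z : C => pser a (z - w)%C).
  (* Dropping two coefficients of [Phi] divides its second-order remainder by [(z - w) ^ 2]; the
     outer [icoef] integrates the result. *)
  set (Psi := fun z : C => pser (icoef (fun n => icoef a (S (S n)))) (z - w)%C).
  assert (Hrad : forall z : C, Cmod (z - w) < r -> Rbar_lt (Cmod (z - w)) (crad a)).
  { intros z Hz. eapply Rbar_lt_le_trans; [|exact Ha]. exact Hz. }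
  assert (Hw : (w - w)%C = RtoC 0) by ring.
  assert (Hww : Cmod (w - w) < r) by (rewrite Hw, Cmod_0; exact Hr).
  assert (HPhi : forall z : C, Cmod (z - w) < r -> cder Phi z (Phi' z)).
  { intros z Hz. eapply cder_eq; [apply cder_plus;
    [apply cder_const | apply cder_translate, pser_icoef_cder, Hrad, Hz]|].
    unfold Phi'. ring. }
  assert (HPhi'' : forall z : C, Cmod (z - w) < r -> cder Phi' z (pser (dcoef a) (z - w)%C)).
  { intros z Hz. apply cder_translate, pser_cder, Hrad, Hz. }
  assert (HPhi''' : forall z : C, Cmod (z - w) < r -> ccont (fun z => pser (dcoef a) (z - w)%C) z).
  { intros z Hz. eapply cder_cont. apply cder_translate, pser_cder. rewrite crad_dcoef. apply Hrad, Hz. }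
  assert (Hnear : forall z : C, Cmod (z - w) < r -> clocally z (fun y : C => Cmod (y - w) < r)).
  { intros z Hz. apply clocally_eps. exists (r - Cmod (z - w)). split; [lra|]. intros y Hy.
    replace (y - w)%C with ((y - z) + (z - w))%C by ring. eapply Rle_lt_trans; [apply Cmod_triangle|]. lra. }
  assert (Hgrad : forall z : C, Cmod (z - w) < r -> Phi' z = cgrad u z).
  { intros z Hz. unfold Phi'. rewrite <- Hs by exact Hz. f_equal. ring. }
  exists Phi, Phi', Psi. split; [|split].
  - unfold Phi. rewrite Hw, pser_0. simpl. ring.
  - assert (Hcr : Rbar_lt (Cmod (w - w)) (crad (fun n => icoef a (S (S n))))).
    { rewrite (crad_shift (fun n => icoef a (S n))), crad_shift, crad_icoef. apply Hrad, Hww. }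
    apply (cder_cont Psi w _ (cder_translate (pser (icoef (fun n => icoef a (S (S n))))) w w (pser (fun n =>
      icoef a (S (S n))) (w - w)%C) (pser_icoef_cder _ _ Hcr))).
  - intros z Hz. split; [apply HPhi, Hz|]. split; [|split; [|split; [|split]]].
    + exists Phi'. eapply filter_imp; [|apply (Hnear z Hz)]. intros y Hy. split; [apply HPhi, Hy|].
      eapply cder_cont. apply HPhi'', Hy.
    + exists (fun z => pser (dcoef a) (z - w)%C). eapply filter_imp; [|apply (Hnear z Hz)]. intros y Hy.
      split; [apply HPhi'', Hy | apply HPhi''', Hy].
    + (* both sides agree at [w] and have the same derivative along the segment from [w] to [z] *)
      set (y := (z - w)%C). set (g := fun s : R => (w + RtoC s * y)%C).
      assert (Hg : forall s, pder g s y).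
      { intros s. unfold g. split; simpl; auto_derive; trivial; ring. }
      assert (Hin : forall s, 0 <= s <= 1 -> Cmod (g s - w) < r).
      { intros s Hs'. unfold g. replace (w + s * y - w)%C with (s * y)%C by ring.
        rewrite Cmod_mult, Cmod_R, Rabs_pos_eq by lra. fold y in Hz. pose proof (Cmod_ge_0 y). nra. }
      set (h := fun s => fst (Phi (g s)) - u (g s)).
      assert (Hh : forall s, 0 <= s <= 1 -> is_derive h s 0).
      { intros s Hs'. pose proof (proj1 (pder_comp Phi g s _ _ (HPhi _ (Hin s Hs')) (Hg s))) as D1.
        pose proof (derivable_pt_lim_comp_2d _ (fun s => fst (g s)) (fun s => snd (g s)) s _ _ _ _
          (harmonic_differentiable u Hu (fst (g s)) (snd (g s)))
          (proj1 (is_derive_Reals _ _ _) (proj1 (Hg s))) (proj1 (is_derive_Reals _ _ _) (proj2 (Hg s)))) as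
            D2.
        apply is_derive_Reals in D2.
        replace 0 with (minus (fst (Phi' (g s) * y)%C)
           (Derive (fun z => u (z, snd (g s))) (fst (g s)) * fst y + Derive (fun z => u (fst (g s),
             z)) (snd (g s)) * snd y)).
        - apply (is_derive_minus (fun s => fst (Phi (g s))) (fun s => u (g s)) s _ _ D1).
          eapply is_derive_ext; [|exact D2]. intros t. change (u (fst (g t), snd (g t)) = u (g t)).
          rewrite <- surjective_pairing. reflexivity.
        - rewrite (Hgrad _ (Hin s Hs')). unfold cgrad. unfold minus, plus, opp; simpl. ring. }
      assert (E : h 1 = h 0).
      { symmetry. apply (eq_is_derive h 0 1); [exact Hh | lra]. }
      unfold h, g in E. rewrite Cmult_1_l, Cmult_0_l, Cplus_0_r in E.
      replace (w + y)%C with z in E by (unfold y; ring).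
      assert (Ew : fst (Phi w) = u w) by (unfold Phi; rewrite Hw, pser_0; simpl; ring). lra.
    + rewrite (Hgrad _ Hz). unfold cgrad, grad. simpl. reflexivity.
    + intros Hne. eapply cder_eq.
      * apply cder_translate, pser_icoef_cder.
        rewrite (crad_shift (fun n => icoef a (S n))), crad_shift, crad_icoef. apply Hrad, Hz.
      * assert (Hy : (z - w)%C <> 0%C) by (intros E; apply Hne; rewrite <- (Cplus_0_r w), <- E; ring).
        unfold Phi, Phi'. rewrite Hw, !pser_0.
        rewrite (pser_shift (icoef a) (z - w)) by (rewrite crad_icoef; apply Hrad, Hz).
        rewrite (pser_shift (fun n => icoef a (S n)) (z - w)) by (rewrite crad_shift, crad_icoef;
          apply Hrad, Hz).
        assert (E1 : icoef a 1 = a 0%nat) by (simpl; field).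
        rewrite E1. simpl (icoef a 0). field. exact Hy.
Qed.

(** * Periodicity and integrals along the curve *)

(* Otherwise failed unifications unfold the defining power series. *)
Opaque analytic_at.

Lemma periodic_Z {T : Type} (f : R -> T) : periodic f -> forall (k : Z) t, f (t + 2 * PI * IZR k) = f t.
Proof.
  intros Hf.
  assert (P : forall (n : nat) t, f (t + 2 * PI * INR n) = f t).
  { induction n as [|n IH]; intros t.
    - simpl. f_equal. ring.
    - rewrite S_INR, <- (IH t), <- (Hf (t + 2 * PI * INR n)). f_equal. ring. }
  intros k t. destruct (Z.le_gt_cases 0 k) as [H|H].
  - rewrite <- (Z2Nat.id k H), <- INR_IZR_INZ. apply P.
  - rewrite <- (P (Z.to_nat (- k)) (t + 2 * PI * IZR k)). f_equal.
    rewrite INR_IZR_INZ, Z2Nat.id by lia. rewrite opp_IZR. ring.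
Qed.

Lemma reduce_mod_2PI (t : R) : exists k : Z, 0 <= t + 2 * PI * IZR k < 2 * PI.
Proof.
  pose proof PI_RGT_0. destruct (archimed (t / (2 * PI))) as [H1 H2].
  set (n := up (t / (2 * PI))) in *. exists (1 - n)%Z. rewrite minus_IZR.
  assert (E : t = 2 * PI * (t / (2 * PI))) by (field; lra).
  set (q := t / (2 * PI)) in *. rewrite E. split; nra.
Qed.

Lemma eqmod2pi_near (tau t : R) : eqmod2pi tau t -> Rabs (tau - t) < 2 * PI -> tau = t.
Proof.
  intros [k ->] H. pose proof PI_RGT_0.
  replace (t + 2 * PI * IZR k - t) with (2 * PI * IZR k) in H by ring.
  apply Rabs_def2 in H. assert (IZR k < 1) by nra. assert (-1 < IZR k) by nra.
  apply lt_IZR in H1. apply lt_IZR in H2. replace k with 0%Z by lia. ring.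
Qed.

Lemma Derive_periodic (f : R -> R) : periodic f -> periodic (Derive f).
Proof.
  intros Hf t. rewrite <- (Derive_ext (fun s => f (s + 2 * PI)) f t Hf).
  unfold Derive. f_equal. apply Lim_ext. intros h. do 2 f_equal. f_equal. ring.
Qed.

Lemma RInt_translate (f : R -> R) (a b c : R) : ex_RInt f (a + c) (b + c) ->
  ex_RInt (fun s => f (s + c)) a b /\ RInt (fun s => f (s + c)) a b = RInt f (a + c) (b + c).
Proof.
  intros H. assert (H' : ex_RInt f (1 * a + c) (1 * b + c)) by (rewrite !Rmult_1_l; exact H).
  split.
  - apply (ex_RInt_ext (fun s => scal 1 (f (1 * s + c)))).
    + intros s _. change (1 * f (1 * s + c) = f (s + c)). rewrite !Rmult_1_l. reflexivity.
    + apply (ex_RInt_comp_lin (V := R_NormedModule) f 1 c a b H').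
  - pose proof (RInt_comp_lin (V := R_CompleteNormedModule) f 1 c a b H') as E.
    rewrite !Rmult_1_l in E. rewrite <- E. apply RInt_ext. intros s _.
    change (f (s + c) = 1 * f (1 * s + c)). rewrite !Rmult_1_l. reflexivity.
Qed.

Lemma RInt_periodic (f : R -> R) : periodic f -> (forall a b, ex_RInt f a b) ->
  forall a, RInt f a (a + 2 * PI) = RInt f 0 (2 * PI).
Proof.
  intros Hp Hex a.
  assert (E : RInt f (2 * PI) (a + 2 * PI) = RInt f 0 a).
  { replace (2 * PI) with (0 + 2 * PI) at 1 by ring.
    rewrite <- (proj2 (RInt_translate f 0 a (2 * PI) (Hex _ _))). apply RInt_ext. intros s _. apply Hp. }
  rewrite <- (RInt_Chasles (V := R_CompleteNormedModule) f a 0 (a + 2 * PI)) by apply Hex.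
  rewrite <- (RInt_Chasles (V := R_CompleteNormedModule) f 0 (2 * PI) (a + 2 * PI)) by apply Hex.
  rewrite E. rewrite <- (opp_RInt_swap (V := R_CompleteNormedModule) f 0 a) by apply Hex.
  unfold plus, opp; simpl. ring.
Qed.

(** Integrability is assumed on a single period only: the truncated integrand is handled on the
    window starting at its singular parameter [t]. *)
Lemma RInt_periodic_window (f : R -> R) (t : R) : periodic f -> 0 <= t <= 2 * PI ->
  ex_RInt f t (t + 2 * PI) ->
  ex_RInt f 0 (2 * PI) /\ RInt f 0 (2 * PI) = RInt f t (t + 2 * PI).
Proof.
  intros Hp Ht Hex. pose proof PI_RGT_0.
  assert (H1 : ex_RInt f t (2 * PI)).
  { apply (ex_RInt_Chasles_1 (V := R_CompleteNormedModule) f t (2 * PI) (t + 2 * PI)); [lra | exact Hex]. }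
  assert (H2 : ex_RInt f (0 + 2 * PI) (t + 2 * PI)).
  { rewrite Rplus_0_l. apply (ex_RInt_Chasles_2 (V := R_CompleteNormedModule) f t (2 * PI) (t + 2 * PI));
    [lra | exact Hex]. }
  destruct (RInt_translate f 0 t (2 * PI) H2) as [H3 E].
  assert (H4 : ex_RInt f 0 t) by (eapply ex_RInt_ext; [intros s _; apply Hp | exact H3]).
  rewrite (RInt_ext _ f) in E by (intros s _; apply Hp). rewrite Rplus_0_l in E, H2.
  split; [apply (ex_RInt_Chasles (V := R_NormedModule) f 0 t (2 * PI)); assumption|].
  rewrite <- (RInt_Chasles (V := R_CompleteNormedModule) f 0 t (2 * PI)) by assumption.
  rewrite <- (RInt_Chasles (V := R_CompleteNormedModule) f t (2 * PI) (t + 2 * PI)) by assumption.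
  rewrite E. unfold plus; simpl. ring.
Qed.

Lemma ex_RInt_cont (f : R -> R) (a b : R) : (forall s,
  Rmin a b <= s <= Rmax a b -> continuous f s) -> ex_RInt f a b.
Proof. apply (ex_RInt_continuous (V := R_CompleteNormedModule)). Qed.

Lemma bounded_on (h : R -> R) (a b : R) : (forall s, a <= s <= b -> continuous h s) ->
  exists M, 0 < M /\ forall s, a <= s <= b -> Rabs (h s) <= M.
Proof.
  intros Hh. destruct (Rle_dec a b) as [Hab|Hab].
  - destruct (continuity_ab_maj (fun s => Rabs (h s)) a b Hab) as [m [Hm _]].
    + intros s Hs. apply (continuity_pt_comp h Rabs);
      [apply continuity_pt_filterlim, Hh, Hs | apply Rcontinuity_abs].
    + exists (Rabs (h m) + 1). split; [pose proof (Rabs_pos (h m)); lra|]. intros s Hs. specialize (Hm s Hs).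
      simpl in Hm. lra.
  - exists 1. split; [lra|]. intros s Hs. lra.
Qed.

Lemma bounded_below_on (h : R -> R) (a b : R) : (forall s, a <= s <= b -> continuous h s) ->
  (forall s, a <= s <= b -> 0 < h s) -> exists m, 0 < m /\ forall s, a <= s <= b -> m <= h s.
Proof.
  intros Hh H0. destruct (Rle_dec a b) as [Hab|Hab].
  - destruct (continuity_ab_min h a b Hab) as [m [Hm Hm']].
    + intros s Hs. apply continuity_pt_filterlim, Hh, Hs.
    + exists (h m). split; [apply H0, Hm' | exact Hm].
  - exists 1. split; [lra|]. intros s Hs. lra.
Qed.

(** The derivative of the argument of [x tau - p], namely the imaginary part of [dz / (z - p)]. *)
Definition arg_form (x : R -> C) (p : C) (tau : R) : R := snd (vel x tau / (x tau - p))%C.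

Lemma arg_form_eq (x : R -> C) (p : C) (tau : R) : arg_form x p tau =
  (fst (vsub (x tau) p) * snd (vel x tau) - snd (vsub (x tau) p) * fst (vel x tau))
   / dot (vsub (x tau) p) (vsub (x tau) p).
Proof.
  unfold arg_form, vsub, dot, Cdiv, Cinv. simpl. unfold Rdiv.
  replace ((fst (x tau) + - fst p) * ((fst (x tau) + - fst p) * 1) + (snd (x tau) + - snd p) * ((snd (x tau)
    + - snd p) * 1))
    with ((fst (x tau) - fst p) * (fst (x tau) - fst p) + (snd (x tau) - snd p) * (snd (x tau) - snd p)) by
      ring.
  ring.
Qed.

Lemma cos_eq_1_Z (th : R) : cos th = 1 -> exists k : Z, th = 2 * PI * IZR k.
Proof.
  intros H. destruct (sin_eq_0_0 (th / 2)) as [k Hk].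
  - replace th with (2 * (th / 2)) in H by field. rewrite cos_2a_sin in H. nra.
  - exists k. lra.
Qed.

(* With [q = X + i Y], the quantity [q exp (- i th) / |q|] is constant. *)
Lemma full_turn (X Y th X' Y' : R -> R) :
  (forall s, is_derive X s (X' s)) -> (forall s, is_derive Y s (Y' s)) ->
  (forall s, 0 < (X s) * (X s) + (Y s) * (Y s)) ->
  (forall s, is_derive th s ((X s * Y' s - Y s * X' s) / (X s * X s + Y s * Y s))) ->
  X (2 * PI) = X 0 -> Y (2 * PI) = Y 0 -> th 0 = 0 ->
  exists k : Z, th (2 * PI) = 2 * PI * IZR k.
Proof.
  intros DX DY HR Dth EX EY E0. pose proof PI_RGT_0.
  set (A := fun s => (X s * cos (th s) + Y s * sin (th s)) / sqrt (X s * X s + Y s * Y s)).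
  set (B := fun s => (Y s * cos (th s) - X s * sin (th s)) / sqrt (X s * X s + Y s * Y s)).
  assert (Hr : forall s, 0 < sqrt (X s * X s + Y s * Y s)) by (intros s; apply sqrt_lt_R0, HR).
  assert (Hrr : forall s, sqrt (X s * X s + Y s * Y s) ^ 2 = X s * X s + Y s * Y s) by (intros s;
    apply pow2_sqrt; left; apply HR).
  assert (DA : forall s, is_derive A s 0).
  { intros s. unfold A. pose proof (Hr s) as H1. pose proof (HR s) as H2. auto_derive.
    - repeat split; trivial; try (exists (X' s); apply DX); try (exists (Y' s); apply DY);
        try (eexists; apply Dth). lra.
    - change (fun x => X x) with X. change (fun x => Y x) with Y. change (fun x => th x) with th.
      rewrite (is_derive_unique _ _ _ (DX s)), (is_derive_unique _ _ _ (DY s)),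
        (is_derive_unique _ _ _ (Dth s)).
      pose proof (Hrr s) as H3. set (r := sqrt _) in *. set (c := cos (th s)). set (d := sin (th s)).
      rewrite <- H3.
      transitivity (((X' s * c + Y' s * d) * r ^ 2 + (Y s * c - X s * d) * (X s * Y' s - Y s * X' s)
         - (X s * c + Y s * d) * (X s * X' s + Y s * Y' s)) / r ^ 3); [field; lra|].
      rewrite H3. field. lra. }
  assert (DB : forall s, is_derive B s 0).
  { intros s. unfold B. pose proof (Hr s) as H1. pose proof (HR s) as H2. auto_derive.
    - repeat split; trivial; try (exists (X' s); apply DX); try (exists (Y' s); apply DY);
        try (eexists; apply Dth). lra.
    - change (fun x => X x) with X. change (fun x => Y x) with Y. change (fun x => th x) with th.
      rewrite (is_derive_unique _ _ _ (DX s)), (is_derive_unique _ _ _ (DY s)),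
        (is_derive_unique _ _ _ (Dth s)).
      pose proof (Hrr s) as H3. set (r := sqrt _) in *. set (c := cos (th s)). set (d := sin (th s)).
      rewrite <- H3.
      transitivity (((Y' s * c - X' s * d) * r ^ 2 + (- Y s * d - X s * c) * (X s * Y' s - Y s * X' s)
         - (Y s * c - X s * d) * (X s * X' s + Y s * Y' s)) / r ^ 3); [field; lra|].
      rewrite H3. field. lra. }
  assert (EA : A (2 * PI) = A 0).
  { symmetry. apply (eq_is_derive A 0 (2 * PI)); [intros s _; apply DA | lra]. }
  assert (EB : B (2 * PI) = B 0).
  { symmetry. apply (eq_is_derive B 0 (2 * PI)); [intros s _; apply DB | lra]. }
  unfold A in EA. unfold B in EB. rewrite EX, EY, E0, cos_0, sin_0 in EA, EB.
  pose proof (Hr 0) as H1. pose proof (HR 0) as H2. set (r := sqrt _) in *.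
  set (c := cos (th (2 * PI))) in *. set (d := sin (th (2 * PI))) in *.
  assert (F1 : X 0 * c + Y 0 * d = X 0).
  { apply (f_equal (fun v => v * r)) in EA.
    replace (X 0) with ((X 0 * 1 + Y 0 * 0) / r * r) at 2 by (field; lra).
    rewrite <- EA. field. lra. }
  assert (F2 : Y 0 * c - X 0 * d = Y 0).
  { apply (f_equal (fun v => v * r)) in EB.
    replace (Y 0) with ((Y 0 * 1 - X 0 * 0) / r * r) at 2 by (field; lra).
    rewrite <- EB. field. lra. }
  (* [F1] and [F2] say that the rotation by [- th (2 * PI)] fixes the nonzero vector [(X 0, Y 0)],
     so its cosine is 1. *)
  apply cos_eq_1_Z. fold c.
  apply Rmult_eq_reg_l with (X 0 * X 0 + Y 0 * Y 0); [|lra].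
  replace ((X 0 * X 0 + Y 0 * Y 0) * c) with (X 0 * (X 0 * c + Y 0 * d) + Y 0 * (Y 0 * c - X 0 * d)) by ring.
  rewrite F1, F2. ring.
Qed.

(** * Elementary properties of the curve and of the argument form *)

Section Curve.

Variable x : R -> C.
Hypothesis Hx : analytic_simple_closed_curve x.

Lemma curve_at1 (t : R) : analytic_at (fun s => fst (x s)) t.
Proof. apply (proj1 (analytic_analytic_at _) (curve_analytic1 x Hx)). Qed.

Lemma curve_at2 (t : R) : analytic_at (fun s => snd (x s)) t.
Proof. apply (proj1 (analytic_analytic_at _) (curve_analytic2 x Hx)). Qed.

Lemma vel_at1 (t : R) : analytic_at (fun s => fst (vel x s)) t.
Proof. apply (analytic_at_derive _ t (curve_at1 t)). Qed.

Lemma vel_at2 (t : R) : analytic_at (fun s => snd (vel x s)) t.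
Proof. apply (analytic_at_derive _ t (curve_at2 t)). Qed.

Lemma curve_pder (t : R) : pder x t (vel x t).
Proof. split; apply Derive_correct, analytic_at_ex_derive; [apply curve_at1 | apply curve_at2]. Qed.

Lemma curve_is_derive1 (t : R) : is_derive (fun s => fst (x s)) t (fst (vel x t)).
Proof. exact (proj1 (curve_pder t)). Qed.

Lemma curve_is_derive2 (t : R) : is_derive (fun s => snd (x s)) t (snd (vel x t)).
Proof. exact (proj2 (curve_pder t)). Qed.

Lemma curve_per (t : R) : x (t + 2 * PI) = x t.
Proof. apply (curve_periodic x Hx). Qed.

Lemma vel_per (t : R) : vel x (t + 2 * PI) = vel x t.
Proof.
  unfold vel. f_equal; apply Derive_periodic; intros s; rewrite curve_per; reflexivity.
Qed.

Lemma curve_inj_mod (s t : R) : x s = x t -> eqmod2pi s t.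
Proof.
  intros E. destruct (reduce_mod_2PI s) as [k Hk]. destruct (reduce_mod_2PI t) as [l Hl].
  assert (E' : s + 2 * PI * IZR k = t + 2 * PI * IZR l).
  { apply (curve_injective x Hx); try assumption.
    rewrite !(periodic_Z x (curve_periodic x Hx)). exact E. }
  exists (l - k)%Z. rewrite minus_IZR. lra.
Qed.

Lemma curve_neq (t tau : R) : t < tau < t + 2 * PI -> x tau <> x t.
Proof.
  intros H E. apply curve_inj_mod, eqmod2pi_near in E; [lra|]. rewrite Rabs_pos_eq; lra.
Qed.

Lemma speed_sq_pos (t : R) : 0 < dot (vel x t) (vel x t).
Proof.
  pose proof (curve_regular x Hx t) as H. unfold dot. destruct (vel x t) as [a b]. simpl.
  destruct (Req_dec a 0) as [->|Ha]; [|nra].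
  destruct (Req_dec b 0) as [->|Hb]; [contradiction H; reflexivity | nra].
Qed.

Lemma curve_cont1 (t : R) : continuous (fun s => fst (x s)) t.
Proof. apply analytic_at_continuous, curve_at1. Qed.

Lemma curve_cont2 (t : R) : continuous (fun s => snd (x s)) t.
Proof. apply analytic_at_continuous, curve_at2. Qed.

Lemma curve_bounded : exists M, 0 < M /\ forall t, Cmod (x t) <= M.
Proof.
  destruct (bounded_on _ 0 (2 * PI) (fun s _ => curve_cont1 s)) as [M1 [HM1 H1]].
  destruct (bounded_on _ 0 (2 * PI) (fun s _ => curve_cont2 s)) as [M2 [HM2 H2]].
  exists (M1 + M2). split; [lra|]. intros t. destruct (reduce_mod_2PI t) as [k Hk].
  rewrite <- (periodic_Z x (curve_periodic x Hx) k t).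
  eapply Rle_trans; [apply Cmod_le_sum|]. apply Rplus_le_compat; [apply H1 | apply H2]; lra.
Qed.

Lemma vel_bounded (a b : R) : exists M, 0 < M /\ forall t, a <= t <= b -> Cmod (vel x t) <= M.
Proof.
  destruct (bounded_on _ a b (fun s _ => analytic_at_continuous _ _ (vel_at1 s))) as [M1 [HM1 H1]].
  destruct (bounded_on _ a b (fun s _ => analytic_at_continuous _ _ (vel_at2 s))) as [M2 [HM2 H2]].
  exists (M1 + M2). split; [lra|]. intros t Ht.
  eapply Rle_trans; [apply Cmod_le_sum|]. apply Rplus_le_compat; [apply H1 | apply H2]; lra.
Qed.

Lemma dist_sq_at (p : C) (t : R) : analytic_at (fun s => dot (vsub (x s) p) (vsub (x s) p)) t.
Proof.
  unfold dot, vsub; simpl. apply analytic_at_plus; apply analytic_at_mult; apply analytic_at_minus;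
    (apply curve_at1 || apply curve_at2 || apply analytic_at_const).
Qed.

Lemma dot_self_pos (p q : R * R) : p <> q -> 0 < dot (vsub p q) (vsub p q).
Proof.
  intros H. unfold dot, vsub; simpl. destruct (Req_dec (fst p) (fst q)) as [E1|E1].
  - destruct (Req_dec (snd p) (snd q)) as [E2|E2].
    + contradiction H. apply injective_projections; assumption.
    + pose proof (Rsqr_pos_lt (snd p - snd q) ltac:(lra)) as A. pose proof (Rle_0_sqr (fst p - fst q)) as B.
      unfold Rsqr in *. lra.
  - pose proof (Rsqr_pos_lt (fst p - fst q) ltac:(lra)) as A. pose proof (Rle_0_sqr (snd p - snd q)) as B.
    unfold Rsqr in *. lra.
Qed.

Lemma Cmod_dot (z : C) : Cmod z ^ 2 = dot z z.
Proof. rewrite Cmod2_alt. unfold dot, Re, Im. ring. Qed.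

Lemma dist_below (p : C) (a b : R) : (forall t, a <= t <= b -> x t <> p) ->
  exists m, 0 < m /\ forall t, a <= t <= b -> m <= Cmod (x t - p).
Proof.
  intros H.
  destruct (bounded_below_on (fun s => dot (vsub (x s) p) (vsub (x s) p)) a b) as [m [Hm H']].
  - intros s _. apply analytic_at_continuous, dist_sq_at.
  - intros s Hs. apply dot_self_pos, H, Hs.
  - exists (sqrt m). split; [apply sqrt_lt_R0, Hm|]. intros t Ht. specialize (H' t Ht).
    change (vsub (x t) p) with ((x t - p)%C) in H'. rewrite <- Cmod_dot in H'.
    rewrite <- (sqrt_pow2 (Cmod (x t - p))) by apply Cmod_ge_0. apply sqrt_le_1_alt, H'.
Qed.

Lemma arg_form_at (p : C) (t : R) : x t <> p -> analytic_at (arg_form x p) t.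
Proof.
  intros H. eapply analytic_at_ext_loc; [apply filter_forall; intros s; symmetry; apply arg_form_eq|].
  apply analytic_at_div; [| apply dist_sq_at | apply Rgt_not_eq, dot_self_pos, H].
  unfold vsub; simpl. apply analytic_at_minus; apply analytic_at_mult; try apply analytic_at_minus;
    first [apply curve_at1 | apply curve_at2 | apply vel_at1 | apply vel_at2 | apply analytic_at_const].
Qed.

Lemma arg_form_ex_RInt (p : C) (a b : R) : a <= b -> (forall t,
  a <= t <= b -> x t <> p) -> ex_RInt (arg_form x p) a b.
Proof.
  intros Hab H. apply ex_RInt_cont. rewrite Rmin_left, Rmax_right by lra.
  intros s Hs. apply analytic_at_continuous, arg_form_at, H, Hs.
Qed.

(** Stated for an arc, because it is needed both for closed curves and for the part of the curve
    away from [x t] with [p = x t]. The integrands differ by [v (q - p) / ((x - q) (x - p))]. *)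
Lemma arg_form_RInt_continuous (p : C) (a b : R) : a <= b -> (forall t, a <= t <= b -> x t <> p) ->
  forall eps, 0 < eps -> exists d, 0 < d /\ forall q : C, Cmod (q - p) < d ->
    (forall t, a <= t <= b -> x t <> q) /\ Rabs (RInt (arg_form x q) a b - RInt (arg_form x p) a b) < eps.
Proof.
  intros Hab Hp eps He.
  destruct (dist_below p a b Hp) as [m [Hm Hm']]. destruct (vel_bounded a b) as [V [HV HV']].
  assert (Hk : 0 < (b - a + 1) * (V / (m / 2 * m))).
  { apply Rmult_lt_0_compat; [lra|]. apply Rdiv_lt_0_compat; nra. }
  (* Within [m / 2] of [p], the distance from [q] to the arc is still at least [m / 2]; the length
     is enlarged to [b - a + 1] so that it is positive even if [a = b]. *)
  exists (Rmin (m / 2) (eps / ((b - a + 1) * (V / (m / 2 * m))))). split.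
  { apply Rmin_glb_lt; [lra|]. apply Rdiv_lt_0_compat; assumption. }
  intros q Hq. pose proof (Rlt_le_trans _ _ _ Hq (Rmin_l _ _)) as Hq1.
  pose proof (Rlt_le_trans _ _ _ Hq (Rmin_r _ _)) as Hq2.
  assert (Hqm : forall t, a <= t <= b -> m / 2 <= Cmod (x t - q)).
  { intros t Ht. specialize (Hm' t Ht). pose proof (Cmod_triangle_minus (x t - p) (q - p)) as K.
    replace (x t - p - (q - p))%C with (x t - q)%C in K by ring. lra. }
  assert (Hqne : forall t, a <= t <= b -> x t <> q).
  { intros t Ht E. specialize (Hqm t Ht). rewrite E in Hqm. replace (q - q)%C with (RtoC 0) in Hqm by ring.
    rewrite Cmod_0 in Hqm. lra. }
  split; [exact Hqne|].
  rewrite <- (RInt_minus (V := R_CompleteNormedModule)) by (apply arg_form_ex_RInt; assumption).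
  eapply Rle_lt_trans.
  - apply (RInt_bound _ a b (V / (m / 2 * m) * Cmod (q - p)) Hab).
    + apply (ex_RInt_minus (V := R_NormedModule)); apply arg_form_ex_RInt; assumption.
    + intros t Ht. pose proof (Hqm t Ht) as A. pose proof (Hm' t Ht) as B. pose proof (HV' t Ht) as D.
      assert (N1 : (x t - q)%C <> 0%C) by (apply Cmod_gt_0; lra).
      assert (N2 : (x t - p)%C <> 0%C) by (apply Cmod_gt_0; lra).
      change (Rabs (arg_form x q t - arg_form x p t) <= V / (m / 2 * m) * Cmod (q - p)).
      unfold arg_form. eapply Rle_trans; [apply (Cmod_snd (vel x t / (x t - q) - vel x t / (x t - p))%C)|].
      replace (vel x t / (x t - q) - vel x t / (x t - p))%C with (vel x t * (q - p) / ((x t - q) * (x t -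
        p)))%C
        by (field; split; assumption).
      rewrite Cmod_div, !Cmod_mult by (apply Cmult_neq_0; assumption).
      replace (V / (m / 2 * m) * Cmod (q - p)) with (V * Cmod (q - p) * / (m / 2 * m)) by (unfold Rdiv; ring).
      unfold Rdiv at 1. pose proof (Cmod_ge_0 (q - p)). pose proof (Cmod_ge_0 (vel x t)).
      apply Rmult_le_compat; [nra | left; apply Rinv_0_lt_compat; nra | nra|].
      apply Rinv_le_contravar; [nra|]. apply Rmult_le_compat; lra.
  - apply Rlt_le_trans with ((b - a + 1) * (V / (m / 2 * m)) * (eps / ((b - a + 1) * (V / (m / 2 * m))))).
    + set (K := V / (m / 2 * m)) in *. assert (HK : 0 < K) by (apply Rdiv_lt_0_compat; nra).
      pose proof (Cmod_ge_0 (q - p)).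
      apply Rle_lt_trans with ((b - a + 1) * K * Cmod (q - p)).
      * assert (0 <= K * Cmod (q - p)) by nra. nra.
      * apply Rmult_lt_compat_l; assumption.
    + apply Req_le. field. split; [apply Rgt_not_eq; exact Hm | split; nra].
Qed.

Lemma winding_integer (p : C) : (forall t, x t <> p) -> exists k : Z,
  RInt (arg_form x p) 0 (2 * PI) = 2 * PI * IZR k.
Proof.
  intros Hp.
  assert (Hex : forall a b, ex_RInt (arg_form x p) a b).
  { intros a b. apply ex_RInt_cont. intros s _. apply analytic_at_continuous, arg_form_at, Hp. }
  apply (full_turn (fun s => fst (x s) - fst p) (fun s => snd (x s) - snd p) (RInt (arg_form x p) 0)
           (fun s => fst (vel x s)) (fun s => snd (vel x s))).
  - intros s. replace (fst (vel x s)) with (minus (fst (vel x s)) 0) by apply Rminus_0_r.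
    apply (is_derive_minus (fun s => fst (x s)) (fun _ => fst p));
      [apply curve_is_derive1 | apply (is_derive_const (fst p))].
  - intros s. replace (snd (vel x s)) with (minus (snd (vel x s)) 0) by apply Rminus_0_r.
    apply (is_derive_minus (fun s => snd (x s)) (fun _ => snd p));
      [apply curve_is_derive2 | apply (is_derive_const (snd p))].
  - intros s. apply dot_self_pos, Hp.
  - intros s. assert (D : is_derive (RInt (arg_form x p) 0) s (arg_form x p s)); [|rewrite arg_form_eq in D;
    exact D].
    apply (is_derive_RInt (V := R_NormedModule) (arg_form x p) _ 0).
    + apply filter_forall. intros y. apply (RInt_correct (V := R_CompleteNormedModule)), Hex.
    + apply analytic_at_continuous, arg_form_at, Hp.
  - rewrite <- (Rplus_0_l (2 * PI)). rewrite curve_per. reflexivity.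
  - rewrite <- (Rplus_0_l (2 * PI)). rewrite curve_per. reflexivity.
  - apply (RInt_point (V := R_CompleteNormedModule)).
Qed.

End Curve.

(** * Winding numbers *)

Lemma enorm_Cmod (p : R * R) : enorm p = Cmod p.
Proof. unfold enorm, Cmod, dot. f_equal. simpl. ring. Qed.

Section Winding.

Variable x : R -> C.
Hypothesis Hx : analytic_simple_closed_curve x.

Lemma winding_number_arg_form (p : C) : winding_number x p = / (2 * PI) * RInt (arg_form x p) 0 (2 * PI).
Proof. unfold winding_number. f_equal. apply RInt_ext. intros t _. symmetry. apply arg_form_eq. Qed.

(** The integral depends continuously on the point along the path and takes values in the multiples
    of 2 pi, hence is constant. *)
Lemma winding_joined (p q : C) : joined_off x p q ->
  RInt (arg_form x p) 0 (2 * PI) = RInt (arg_form x q) 0 (2 * PI).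
Proof.
  intros [gam [Hc [Hp [Hq Hoff]]]]. pose proof PI_RGT_0 as HPI.
  set (w := fun s => RInt (arg_form x (gam s)) 0 (2 * PI)).
  assert (Hint : forall s, 0 <= s <= 1 -> exists k : Z, w s = 2 * PI * IZR k).
  { intros s Hs. apply (winding_integer x Hx). intros t E. apply (Hoff s t Hs). symmetry. exact E. }
  assert (Hw : forall s, 0 <= s <= 1 -> continuity_pt w s).
  { intros s Hs. apply continuity_pt_locally. intros eps.
    destruct (arg_form_RInt_continuous x Hx (gam s) 0 (2 * PI)) with (eps := pos eps) as [d [Hd H]].
    - lra.
    - intros t _ E. apply (Hoff s t Hs). symmetry. exact E.
    - apply cond_pos.
    - assert (Hd2 : 0 < d / 2) by lra.
      eapply filter_imp; [|apply (proj1 (filterlim_locally gam (gam s)) (Hc s Hs) (mkposreal _ Hd2))].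
      intros s' [B1 B2]. apply H. change (Rabs (fst (gam s') - fst (gam s)) < d / 2) in B1.
      change (Rabs (snd (gam s') - snd (gam s)) < d / 2) in B2.
      eapply Rle_lt_trans; [apply Cmod_le_sum|]. simpl. unfold Rminus in *. lra. }
  assert (Hlt : forall (h : R -> R), (forall s, 0 <= s <= 1 -> continuity_pt h s) ->
     (forall s, 0 <= s <= 1 -> exists k : Z, h s = 2 * PI * IZR k) -> ~ h 0 < h 1).
  { intros h Hhc Hhi Hlt. destruct (Hhi 0) as [k Hk]; [lra|]. destruct (Hhi 1) as [l Hl]; [lra|].
    assert (Hkl : (k < l)%Z) by (apply lt_IZR; nra).
    assert (Hkl' : IZR k + 1 <= IZR l) by (rewrite <- plus_IZR; apply IZR_le; lia).
    (* An increase would force the value at a half-integer, which is not attained; a decrease is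
       treated by negating [w]. *)
    destruct (Ranalysis5.IVT_interv (fun s => h s - 2 * PI * (IZR k + / 2)) 0 1) as [s [Hs E]].
    - intros s Hs. apply continuity_pt_minus; [apply Hhc, Hs | apply continuity_pt_const; intros ? ?;
      reflexivity].
    - lra.
    - rewrite Hk. nra.
    - rewrite Hl. nra.
    - destruct (Hhi s Hs) as [m Hm]. rewrite Hm in E.
      assert (E' : IZR m = IZR k + / 2) by nra.
      assert (IZR k < IZR m) by lra. assert (IZR m < IZR (k + 1)) by (rewrite plus_IZR; lra).
      apply lt_IZR in H, H0. lia. }
  change (gam 0 = p) in Hp. rewrite <- Hp, <- Hq. change (w 0 = w 1).
  destruct (Rtotal_order (w 0) (w 1)) as [H|[H|H]]; [|exact H|]; exfalso.
  - exact (Hlt w Hw Hint H).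
  - apply (Hlt (fun s => - w s)); [|intros s Hs|lra].
    + intros s Hs. apply continuity_pt_opp, Hw, Hs.
    + destruct (Hint s Hs) as [k Hk]. exists (- k)%Z. rewrite opp_IZR. lra.
Qed.

(** At distance more than [2 V] from the curve the argument form is at most 1/2, so the integer is
    less than 1 in absolute value. *)
Lemma winding_far : exists B, forall p : C, B < Cmod p -> RInt (arg_form x p) 0 (2 * PI) = 0.
Proof.
  pose proof PI_RGT_0 as HPI.
  destruct (curve_bounded x Hx) as [M [HM HM']]. destruct (vel_bounded x Hx 0 (2 * PI)) as [V [HV HV']].
  exists (M + 2 * V). intros p Hp.
  assert (Hd : forall t, 2 * V < Cmod (x t - p)).
  { intros t. specialize (HM' t). rewrite Cmod_minus_sym. pose proof (Cmod_triangle_minus p (x t)). lra. }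
  assert (Hne : forall t, x t <> p).
  { intros t E. specialize (Hd t). rewrite E in Hd. replace (p - p)%C with (RtoC 0) in Hd by ring.
    rewrite Cmod_0 in Hd. lra. }
  destruct (winding_integer x Hx p Hne) as [k Hk].
  assert (Hb : Rabs (RInt (arg_form x p) 0 (2 * PI)) <= (2 * PI - 0) * / 2).
  { apply RInt_bound; [lra | apply (arg_form_ex_RInt x Hx); [lra | intros t _; apply Hne]|].
    intros t Ht. unfold arg_form. eapply Rle_trans; [apply (Cmod_snd (vel x t / (x t - p))%C)|].
    assert (N : (x t - p)%C <> 0%C) by (apply Cmod_gt_0; specialize (Hd t); lra).
    rewrite Cmod_div by exact N. specialize (Hd t). specialize (HV' t Ht).
    apply Rmult_le_reg_r with (Cmod (x t - p)); [lra|]. unfold Rdiv. rewrite Rmult_assoc, Rinv_l; lra. }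
  rewrite Hk in Hb |- *. rewrite Rabs_mult, (Rabs_pos_eq (2 * PI)) in Hb by lra.
  assert (Hk1 : Rabs (IZR k) < 1) by nra. apply Rabs_def2 in Hk1. destruct Hk1 as [K1 K2].
  apply lt_IZR in K1. assert (K3 : IZR (-1) < IZR k) by (simpl; lra). apply lt_IZR in K3.
  replace k with 0%Z by lia. apply Rmult_0_r.
Qed.

Lemma winding_0_or_1 (p : C) : (forall t, x t <> p) ->
  RInt (arg_form x p) 0 (2 * PI) = 0 \/ RInt (arg_form x p) 0 (2 * PI) = 2 * PI.
Proof.
  intros Hp. pose proof PI_RGT_0 as HPI.
  destruct (classic (in_interior x p)) as [Hin|Hout].
  - right. pose proof (curve_counterclockwise x Hx p Hin) as H. rewrite winding_number_arg_form in H.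
    apply Rmult_eq_reg_l with (/ (2 * PI)); [|apply Rinv_neq_0_compat; lra]. rewrite H. field. lra.
  - left. destruct winding_far as [B HB].
    destruct (classic (exists q, joined_off x p q /\ B < enorm q)) as [[q [Hq1 Hq2]]|Hn].
    + rewrite (winding_joined p q Hq1). apply HB. rewrite <- enorm_Cmod. exact Hq2.
    + exfalso. apply Hout. split; [exact Hp|]. exists B. intros q Hq.
      apply Rnot_lt_le. intros Hlt. apply Hn. exists q. split; assumption.
Qed.

(* For [e = 1] (resp. [-1]), the argument of [X + i Y] measured from the downward (resp. upward)
   direction; by the half-angle formula it is smooth off the opposite vertical ray. *)
Definition half_angle (e X Y : R) : R := e * (2 * atan (X / (sqrt (X * X + Y * Y) - e * Y))).

(** The denominator vanishes exactly on the closed vertical ray [X = 0], [e Y >= 0], which is the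
    branch cut. *)
Lemma half_angle_denom (e X Y : R) : e = 1 \/ e = -1 -> X <> 0 \/ e * Y < 0 ->
  0 < sqrt (X * X + Y * Y) - e * Y /\ 0 < X * X + Y * Y.
Proof.
  intros He H.
  assert (H2 : 0 < X * X + Y * Y).
  { destruct H as [H|H]; [|destruct He; subst e; nra].
    pose proof (Rsqr_pos_lt X H) as K. unfold Rsqr in K. nra. }
  split; [|exact H2].
  assert (Hr : 0 < sqrt (X * X + Y * Y)) by (apply sqrt_lt_R0, H2).
  destruct H as [H|H]; [|lra].
  assert (Hee : (e * Y) * (e * Y) = Y * Y) by (destruct He; subst e; ring).
  destruct (Rle_dec (e * Y) 0) as [Hs|Hs]; [lra|].
  assert (Hrr : sqrt (X * X + Y * Y) * sqrt (X * X + Y * Y) = X * X + Y * Y) by (apply sqrt_sqrt; lra).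
  pose proof (Rsqr_pos_lt X H) as K. unfold Rsqr in K. nra.
Qed.

Lemma half_angle_derive (e : R) (X Y : R -> R) (X' Y' s : R) : e = 1 \/ e = -1 ->
  is_derive X s X' -> is_derive Y s Y' -> X s <> 0 \/ e * Y s < 0 ->
  is_derive (fun s => half_angle e (X s) (Y s)) s ((X s * Y' - Y s * X') / (X s * X s + Y s * Y s)).
Proof.
  intros He DX DY H. destruct (half_angle_denom e (X s) (Y s) He H) as [H1 H2].
  assert (Hr : 0 < sqrt (X s * X s + Y s * Y s)) by (apply sqrt_lt_R0, H2).
  assert (Hrr : sqrt (X s * X s + Y s * Y s) ^ 2 = X s * X s + Y s * Y s) by (apply pow2_sqrt; lra).
  unfold half_angle. auto_derive.
  - repeat split; try (exists X'; exact DX); try (exists Y'; exact DY); trivial. lra.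
  - change (fun x => X x) with X. change (fun x => Y x) with Y.
    rewrite (is_derive_unique _ _ _ DX), (is_derive_unique _ _ _ DY).
    set (r := sqrt _) in *. set (a := X s) in *. set (b := Y s) in *. rewrite <- Hrr.
    (* This half-angle identity turns the derivative of the arctangent into a fraction with
       denominator [r ^ 2]. *)
    assert (N : a * a + (r - e * b) * (r - e * b) = 2 * r * (r - e * b)).
    { destruct He; subst e; lra. }
    assert (Hn : a * a + (r - e * b) * (r - e * b) <> 0) by (rewrite N; apply Rgt_not_eq;
      apply Rmult_lt_0_compat; lra).
    transitivity (e * 2 * ((X' * (r - e * b) - a * ((a * X' + b * Y') / r - e * Y')) / (a * a + (r - e * b) *
      (r - e * b)))).
    + field. repeat split; lra.
    + rewrite N. replace (X' * (r - e * b) - a * ((a * X' + b * Y') / r - e * Y'))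
        with ((X' * (r ^ 2 - a * a) - e * b * X' * r - a * b * Y' + e * a * Y' * r) / r) by (field; lra).
      replace (r ^ 2 - a * a) with (b * b) by lra.
      destruct He; subst e; field; lra.
Qed.

End Winding.

(** * The principal-value winding number at a point of the curve *)

Arguments vel : simpl never.

Lemma half_angle_scale_pos (e s X Y : R) : 0 < s -> half_angle e (s * X) (s * Y) = half_angle e X Y.
Proof.
  intros Hs. unfold half_angle. do 3 f_equal.
  replace (s * X * (s * X) + s * Y * (s * Y)) with ((s * s) * (X * X + Y * Y)) by ring.
  rewrite sqrt_mult_alt by nra. rewrite sqrt_square by lra.
  replace (s * sqrt (X * X + Y * Y) - e * (s * Y)) with (s * (sqrt (X * X + Y * Y) - e * Y)) by ring.
  unfold Rdiv. rewrite Rinv_mult. set (i := / (sqrt (X * X + Y * Y) - e * Y)).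
  replace (X * i) with (s * / s * (X * i)) by (rewrite Rinv_r by lra; ring). ring.
Qed.

Lemma half_angle_opp (e X Y : R) : half_angle e (- X) (- Y) = half_angle (- e) X Y.
Proof.
  unfold half_angle. replace (- X * - X + - Y * - Y) with (X * X + Y * Y) by ring.
  replace (sqrt (X * X + Y * Y) - e * - Y) with (sqrt (X * X + Y * Y) - - e * Y) by ring.
  unfold Rdiv. rewrite Ropp_mult_distr_l_reverse, atan_opp. ring.
Qed.

(** A negative factor reflects the plane through the origin and so exchanges the two reference
    directions; this is how points just before [x t] are compared with points just after it. *)
Lemma half_angle_scale_neg (e s X Y : R) : s < 0 -> half_angle e (s * X) (s * Y) = half_angle (- e) X Y.
Proof.
  intros Hs. rewrite <- (half_angle_scale_pos (- e) (- s)) by lra. rewrite <- half_angle_opp.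
  f_equal; ring.
Qed.

(** Since [(r - Y) (r + Y) = X ^ 2], the two arctangents have reciprocal arguments and sum to pi/2.
    With the opposite sign for [X < 0], this produces the jump 2 pi across the curve. *)
Lemma half_angle_diff_pos (X Y : R) : 0 < X -> half_angle 1 X Y - half_angle (-1) X Y = PI.
Proof.
  intros HX.
  destruct (half_angle_denom 1 X Y) as [H1 H2]; [lra | lra|].
  destruct (half_angle_denom (-1) X Y) as [H3 _]; [lra | lra|].
  unfold half_angle. set (r := sqrt _) in *.
  assert (Hrr : r * r = X * X + Y * Y) by (apply sqrt_sqrt; lra).
  assert (E : X / (r - -1 * Y) = / (X / (r - 1 * Y))).
  { rewrite Rinv_div. apply Rmult_eq_reg_r with ((r - -1 * Y) * X); [|nra]. field_simplify; nra. }
  rewrite E, atan_inv by (apply Rdiv_lt_0_compat; lra). field.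
Qed.

Lemma half_angle_diff_neg (X Y : R) : X < 0 -> half_angle 1 X Y - half_angle (-1) X Y = - PI.
Proof.
  intros HX. pose proof (half_angle_diff_pos (- X) (- Y)) as H.
  rewrite !half_angle_opp in H. replace (Ropp (-1)) with 1 in H by ring.
  replace (Ropp 1) with (-1) in H by ring. lra.
Qed.

Lemma is_derive_affine2 (f g : R -> R) (s a b c1 c2 df dg : R) : is_derive f s df -> is_derive g s dg ->
  is_derive (fun s => a * (f s - c1) + b * (g s - c2)) s (a * df + b * dg).
Proof.
  intros Hf Hg. auto_derive.
  - repeat split; [exists df; exact Hf | exists dg; exact Hg].
  - change (fun x => f x) with f. change (fun x => g x) with g.
    rewrite (is_derive_unique _ _ _ Hf), (is_derive_unique _ _ _ Hg). ring.
Qed.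

Section Frame.

Variable x : R -> C.
Hypothesis Hx : analytic_simple_closed_curve x.
Variable t : R.

(** Coordinates of the chord along the tangent and the left normal at [x t], both multiplied by the
    speed so that no square root occurs. *)
Definition frame1 (tau : R) : R :=
  fst (vel x t) * (fst (x tau) - fst (x t)) + snd (vel x t) * (snd (x tau) - snd (x t)).
Definition frame2 (tau : R) : R :=
  fst (vel x t) * (snd (x tau) - snd (x t)) - snd (vel x t) * (fst (x tau) - fst (x t)).

Let vv := dot (vel x t) (vel x t).

(** The point on the normal line at [x t] with frame coordinates [(0, c)]; it is on the left of the
    curve for small [c > 0]. *)
Definition offset (c : R) : C :=
  (x t + (c / dot (vel x t) (vel x t))%R * ((- snd (vel x t))%R, fst (vel x t)))%C.

Lemma frame1_at (s : R) : analytic_at frame1 s.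
Proof.
  unfold frame1. apply analytic_at_plus; apply analytic_at_mult; try apply analytic_at_minus;
    first [apply analytic_at_const | apply (curve_at1 x Hx) | apply (curve_at2 x Hx)].
Qed.

Lemma frame2_at (s : R) : analytic_at frame2 s.
Proof.
  unfold frame2. apply analytic_at_minus; apply analytic_at_mult; try apply analytic_at_minus;
    first [apply analytic_at_const | apply (curve_at1 x Hx) | apply (curve_at2 x Hx)].
Qed.

Lemma frame1_derive (s : R) : is_derive frame1 s (fst (vel x t) * fst (vel x s) + snd (vel x t) * snd (vel x
  s)).
Proof.
  apply (is_derive_affine2 (fun s => fst (x s)) (fun s => snd (x s)));
    [apply curve_is_derive1 | apply curve_is_derive2]; exact Hx.
Qed.

Lemma frame2_derive (s : R) : is_derive frame2 s (fst (vel x t) * snd (vel x s) - snd (vel x t) * fst (vel x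
  s)).
Proof.
  apply (is_derive_ext (fun s => fst (vel x t) * (snd (x s) - snd (x t)) + - snd (vel x t) * (fst (x s) - fst
    (x t)))).
  - intros u. unfold frame2.
    change (@eq R (fst (vel x t) * (snd (x u) - snd (x t)) + - snd (vel x t) * (fst (x u) - fst (x t)))
      (fst (vel x t) * (snd (x u) - snd (x t)) - snd (vel x t) * (fst (x u) - fst (x t)))). ring.
  - replace (fst (vel x t) * snd (vel x s) - snd (vel x t) * fst (vel x s))
      with (fst (vel x t) * snd (vel x s) + - snd (vel x t) * fst (vel x s)) by ring.
    apply (is_derive_affine2 (fun s => snd (x s)) (fun s => fst (x s)));
      [apply curve_is_derive2 | apply curve_is_derive1]; exact Hx.
Qed.

Lemma vv_pos : 0 < vv.
Proof. apply speed_sq_pos, Hx. Qed.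

(** The frame is a rotation followed by a scaling, which leaves the argument form unchanged. *)
Lemma frame_arg_form (c s : R) : arg_form x (offset c) s =
  (frame1 s * (fst (vel x t) * snd (vel x s) - snd (vel x t) * fst (vel x s))
    - (frame2 s - c) * (fst (vel x t) * fst (vel x s) + snd (vel x t) * snd (vel x s)))
  / (frame1 s * frame1 s + (frame2 s - c) * (frame2 s - c)).
Proof.
  pose proof vv_pos as Hv. rewrite arg_form_eq.
  set (q1 := fst (vsub (x s) (offset c))). set (q2 := snd (vsub (x s) (offset c))).
  assert (E1 : frame1 s = fst (vel x t) * q1 + snd (vel x t) * q2).
  { unfold frame1, q1, q2, vsub, offset. fold vv. simpl. ring. }
  assert (E2 : frame2 s - c = fst (vel x t) * q2 - snd (vel x t) * q1).
  { unfold frame2, q1, q2, vsub, offset. unfold vv, dot in *.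
    set (v1 := fst (vel x t)) in *. set (v2 := snd (vel x t)) in *. simpl. field. lra. }
  rewrite E1, E2. unfold dot. fold q1 q2.
  replace ((fst (vel x t) * q1 + snd (vel x t) * q2) * (fst (vel x t) * q1 + snd (vel x t) * q2)
    + (fst (vel x t) * q2 - snd (vel x t) * q1) * (fst (vel x t) * q2 - snd (vel x t) * q1))
    with (vv * (q1 * q1 + q2 * q2)) by (unfold vv, dot; ring).
  unfold Rdiv. rewrite Rinv_mult. set (i := / (q1 * q1 + q2 * q2)).
  transitivity ((vv * / vv) * ((q1 * snd (vel x s) - q2 * fst (vel x s)) * i)).
  - rewrite Rinv_r by lra. ring.
  - unfold vv at 1, dot. ring.
Qed.

Lemma frame_neq (e c s : R) : e = 1 \/ e = -1 -> frame1 s <> 0 \/ e * (frame2 s - c) < 0 -> x s <> offset c.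
Proof.
  intros He H E. pose proof vv_pos as Hv.
  destruct (half_angle_denom e (frame1 s) (frame2 s - c) He H) as [_ K].
  assert (E1 : frame1 s = 0) by (unfold frame1; rewrite E; unfold offset; simpl; ring).
  assert (E2 : frame2 s - c = 0).
  { unfold frame2. rewrite E. unfold offset. unfold vv, dot in *.
    set (v1 := fst (vel x t)) in *. set (v2 := snd (vel x t)) in *. simpl. field. lra. }
  rewrite E1, E2 in K. lra.
Qed.

(** On an arc that avoids the branch cut issuing from the offset point, the half-angle formula is a
    primitive. *)
Lemma arc_integral (e c a b : R) : a <= b -> e = 1 \/ e = -1 ->
  (forall s, a <= s <= b -> frame1 s <> 0 \/ e * (frame2 s - c) < 0) ->
  RInt (arg_form x (offset c)) a b
  = half_angle e (frame1 b) (frame2 b - c) - half_angle e (frame1 a) (frame2 a - c).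
Proof.
  intros Hab He H.
  apply (RInt_primitive (fun s => half_angle e (frame1 s) (frame2 s - c)));
    rewrite Rmin_left, Rmax_right by lra; intros s Hs.
  - rewrite frame_arg_form.
    apply (half_angle_derive e frame1 (fun s => frame2 s - c));
      [exact He | apply frame1_derive | | apply H, Hs].
    replace (fst (vel x t) * snd (vel x s) - snd (vel x t) * fst (vel x s))
      with (minus (fst (vel x t) * snd (vel x s) - snd (vel x t) * fst (vel x s)) 0) by apply Rminus_0_r.
    apply (is_derive_minus frame2 (fun _ => c)); [apply frame2_derive | apply (is_derive_const c)].
  - apply analytic_at_continuous, arg_form_at; [exact Hx|]. apply (frame_neq e); [exact He | apply H, Hs].
Qed.

Lemma offset_0 : offset 0 = x t.
Proof. unfold offset. replace (0 / dot (vel x t) (vel x t)) with 0 by (unfold Rdiv; ring). ring. Qed.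

Lemma frame_t : frame1 t = 0 /\ frame2 t = 0.
Proof. unfold frame1, frame2. split; ring. Qed.

Lemma frame_factor : exists (X1 Y1 : R -> R) (d : R),
  0 < d < PI /\ analytic_at X1 t /\ analytic_at Y1 t /\ X1 t = vv /\ Y1 t = 0 /\
  (forall s, frame1 s = (s - t) * X1 s) /\ (forall s, frame2 s = (s - t) * Y1 s) /\
  (forall s, Rabs (s - t) <= d -> 0 < X1 s).
Proof.
  destruct (analytic_at_factor frame1 t (frame1_at t) (proj1 frame_t)) as [X1 [HX [EX FX]]].
  destruct (analytic_at_factor frame2 t (frame2_at t) (proj2 frame_t)) as [Y1 [HY [EY FY]]].
  rewrite (is_derive_unique _ _ _ (frame1_derive t)) in EX.
  rewrite (is_derive_unique _ _ _ (frame2_derive t)) in EY.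
  pose proof vv_pos as Hv. pose proof PI_RGT_0 as HPI.
  change (X1 t = vv) in EX.
  assert (L : locally t (fun s => 0 < X1 s)).
  { apply continuous_locally_pos; [apply analytic_at_continuous, HX | rewrite EX; exact Hv]. }
  destruct L as [d Hd]. exists X1, Y1, (Rmin (d / 2) (PI / 2)). pose proof (cond_pos d).
  pose proof (Rmin_l (d / 2) (PI / 2)). pose proof (Rmin_r (d / 2) (PI / 2)).
  assert (0 < Rmin (d / 2) (PI / 2)) by (apply Rmin_glb_lt; lra).
  repeat split; try assumption; try lra.
  intros s Hs. apply Hd. change (Rabs (s - t) < d). lra.
Qed.

Lemma offset_dist (c : R) : Cmod (offset c - x t) = Rabs c / sqrt vv.
Proof.
  pose proof vv_pos as Hv. unfold offset. fold vv.
  replace (x t + (c / vv)%R * ((- snd (vel x t))%R, fst (vel x t)) - x t)%C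
    with ((c / vv)%R * ((- snd (vel x t))%R, fst (vel x t)))%C by ring.
  rewrite Cmod_mult, Cmod_R.
  replace (Cmod ((- snd (vel x t))%R, fst (vel x t))) with (sqrt vv).
  2:{ unfold Cmod, vv, dot. f_equal. simpl. ring. }
  unfold Rdiv. rewrite Rabs_mult, (Rabs_pos_eq (/ vv)) by (left; apply Rinv_0_lt_compat, Hv).
  assert (Hs : 0 < sqrt vv) by (apply sqrt_lt_R0, Hv).
  replace (/ vv) with (/ (sqrt vv * sqrt vv)) by (rewrite sqrt_sqrt by lra; reflexivity). field. lra.
Qed.

(* The winding numbers of the points just off the curve at [x t], on the side given by [e],
   expressed by continuity through the integral along the curve away from [x t]. *)
Lemma side_winding (e d : R) : e = 1 \/ e = -1 -> 0 < d < PI ->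
  (forall s, 0 < Rabs (s - t) <= d -> frame1 s <> 0) ->
  let L := half_angle e (frame1 (t + d)) (frame2 (t + d)) - half_angle e (frame1 (t - d)) (frame2 (t - d))
           + RInt (arg_form x (x t)) (t + d) (t + 2 * PI - d) in
  L = 0 \/ L = 2 * PI.
Proof.
  intros He Hd HX L. pose proof PI_RGT_0 as HPI. pose proof vv_pos as Hv.
  assert (Hc : forall s, frame1 s <> 0 -> continuous (fun c => half_angle e (frame1 s) (frame2 s - c)) 0).
  { intros s Hs. apply (ex_derive_continuous (fun c => half_angle e (frame1 s) (frame2 s - c))). eexists.
    apply (half_angle_derive e (fun _ => frame1 s) (fun c => frame2 s - c) 0 (-1));
      [exact He | apply (is_derive_const (frame1 s)) | auto_derive; [trivial | ring] | left; exact Hs]. }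
  assert (HX1 : frame1 (t + d) <> 0) by (apply HX; replace (t + d - t) with d by ring; rewrite Rabs_pos_eq;
    lra).
  assert (HX2 : frame1 (t - d) <> 0).
  { apply HX. replace (t - d - t) with (- d) by ring. rewrite Rabs_Ropp, Rabs_pos_eq; lra. }
  destruct (Req_dec L 0) as [|L0]; [left; assumption|].
  destruct (Req_dec L (2 * PI)) as [|L1]; [right; assumption|]. exfalso.
  (* The distance from [L] to the two admissible values. An off-curve winding integral within [eta]
     of [L] will give the contradiction, with one third for each of the three pieces. *)
  set (eta := Rmin (Rabs L) (Rabs (L - 2 * PI))).
  assert (Heta : 0 < eta) by (apply Rmin_glb_lt; apply Rabs_pos_lt; lra).
  assert (He3 : 0 < eta / 3) by lra.
  destruct (proj1 (continuity_pt_locally _ 0) (proj2 (continuity_pt_filterlim _ 0) (Hc _ HX1)) (mkposreal _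
    He3)) as [d1 D1].
  destruct (proj1 (continuity_pt_locally _ 0) (proj2 (continuity_pt_filterlim _ 0) (Hc _ HX2)) (mkposreal _
    He3)) as [d2 D2].
  destruct (arg_form_RInt_continuous x Hx (x t) (t + d) (t + 2 * PI - d)) with (eps := eta / 3) as [d3 [Hd3
    D3]].
  { lra. }
  { intros s Hs. apply (curve_neq x Hx). lra. }
  { exact He3. }
  assert (Hsv : 0 < sqrt vv) by (apply sqrt_lt_R0, Hv).
  set (m := Rmin (Rmin d1 d2) (d3 * sqrt vv)).
  assert (Hm : 0 < m) by (repeat apply Rmin_glb_lt; try apply cond_pos; nra).
  (* The sign makes [e * (0 - c) < 0], so the branch cut points away from the curve and the arc
     through [x t] misses it at the parameter [t]. *)
  set (c := e * (m / 2)).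
  assert (Hca : Rabs c = m / 2).
  { unfold c. destruct He; subst e; rewrite Rabs_mult, (Rabs_pos_eq (m / 2)) by lra.
    - rewrite Rabs_R1. ring.
    - rewrite Rabs_left by lra. ring. }
  assert (Hm1 : m <= d1) by (eapply Rle_trans; [apply Rmin_l | apply Rmin_l]).
  assert (Hm2 : m <= d2) by (eapply Rle_trans; [apply Rmin_l | apply Rmin_r]).
  assert (Hm3 : m <= d3 * sqrt vv) by apply Rmin_r.
  specialize (D1 c). specialize (D2 c). destruct (D3 (offset c)) as [Hoff D3'].
  { rewrite offset_dist, Hca. apply Rmult_lt_reg_r with (sqrt vv); [exact Hsv|].
    unfold Rdiv. rewrite (Rmult_assoc _ (/ sqrt vv)), Rinv_l by lra. lra. }
  assert (D1' : Rabs (half_angle e (frame1 (t + d)) (frame2 (t + d) - c) - half_angle e (frame1 (t + d))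
    (frame2 (t + d) - 0)) < eta / 3).
  { apply D1. change (Rabs (c - 0) < d1). rewrite Rminus_0_r. lra. }
  assert (D2' : Rabs (half_angle e (frame1 (t - d)) (frame2 (t - d) - c) - half_angle e (frame1 (t - d))
    (frame2 (t - d) - 0)) < eta / 3).
  { apply D2. change (Rabs (c - 0) < d2). rewrite Rminus_0_r. lra. }
  rewrite Rminus_0_r in D1', D2'.
  assert (Hcond : forall s, t - d <= s <= t + d -> frame1 s <> 0 \/ e * (frame2 s - c) < 0).
  { intros s Hs. destruct (Req_dec s t) as [->|Hst].
    - right. rewrite (proj2 frame_t). unfold c. destruct He; subst e; lra.
    - left. apply HX. split; [apply Rabs_pos_lt; lra | apply Rabs_le; lra]. }
  assert (Hne : forall s, x s <> offset c).
  (* Every parameter is moved into one period from [t - d]: the near arc is excluded by the frame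
     condition, the far arc by closeness of the offset point to [x t]. *)
  { intros s. destruct (reduce_mod_2PI (s - (t - d))) as [k Hk].
    rewrite <- (periodic_Z x (curve_periodic x Hx) k s).
    destruct (Rle_dec (s + 2 * PI * IZR k) (t + d)) as [Hle|Hgt].
    - apply (frame_neq e); [exact He | apply Hcond; lra].
    - apply Hoff. lra. }
  assert (Hex : forall a b, ex_RInt (arg_form x (offset c)) a b).
  { intros a b. apply ex_RInt_cont. intros s _. apply analytic_at_continuous, (arg_form_at x Hx), Hne. }
  assert (W : RInt (arg_form x (offset c)) 0 (2 * PI) =
     half_angle e (frame1 (t + d)) (frame2 (t + d) - c) - half_angle e (frame1 (t - d)) (frame2 (t - d) - c)
     + RInt (arg_form x (offset c)) (t + d) (t + 2 * PI - d)).
  { rewrite <- (RInt_periodic (arg_form x (offset c))) with (a := t - d).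
    - rewrite <- (arc_integral e c (t - d) (t + d)) by (lra || assumption).
      replace (t - d + 2 * PI) with (t + 2 * PI - d) by ring.
      symmetry. apply (RInt_Chasles (V := R_CompleteNormedModule)); apply Hex.
    - intros s. unfold arg_form. rewrite (curve_per x Hx), (vel_per x Hx). reflexivity.
    - exact Hex. }
  assert (HW : Rabs (RInt (arg_form x (offset c)) 0 (2 * PI) - L) < eta).
  { rewrite W. unfold L. apply Rabs_def2 in D1', D2', D3'. apply Rabs_def1; lra. }
  pose proof (Rmin_l (Rabs L) (Rabs (L - 2 * PI))) as M1.
  pose proof (Rmin_r (Rabs L) (Rabs (L - 2 * PI))) as M2. fold eta in M1, M2.
  destruct (winding_0_or_1 x Hx (offset c) Hne) as [E|E]; rewrite E in HW; rewrite Rabs_minus_sym in HW.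
  - rewrite Rminus_0_r in HW. lra.
  - lra.
Qed.

Lemma principal_winding : forall eta, 0 < eta -> exists d, 0 < d /\ forall a b, 0 < a < d -> 0 < b < d ->
  Rabs (RInt (arg_form x (x t)) (t + b) (t + 2 * PI - a) - PI) < eta.
Proof.
  intros eta Heta. pose proof PI_RGT_0 as HPI. pose proof vv_pos as Hv.
  destruct frame_factor as [X1 [Y1 [d [Hd [HX1 [HY1 [EX [EY [FX [FY HP]]]]]]]]]].
  assert (HX : forall s, 0 < Rabs (s - t) <= d -> frame1 s <> 0).
  { intros s Hs. rewrite FX. specialize (HP s (proj2 Hs)).
    apply Rmult_integral_contrapositive. split; [|lra]. intros E. rewrite E, Rabs_R0 in Hs. lra. }
  assert (Pd : 0 < frame1 (t + d)).
  { rewrite FX. replace (t + d - t) with d by ring. apply Rmult_lt_0_compat; [lra|]. apply HP.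
    replace (t + d - t) with d by ring. rewrite Rabs_pos_eq; lra. }
  assert (Nd : frame1 (t - d) < 0).
  { rewrite FX. replace (t - d - t) with (- d) by ring. assert (0 < X1 (t - d)); [|nra]. apply HP.
    replace (t - d - t) with (- d) by ring. rewrite Rabs_Ropp, Rabs_pos_eq; lra. }
  pose proof (side_winding 1 d (or_introl eq_refl) Hd HX) as S1.
  pose proof (side_winding (-1) d (or_intror eq_refl) Hd HX) as S2. simpl in S1, S2.
  pose proof (half_angle_diff_pos _ (frame2 (t + d)) Pd) as J1.
  pose proof (half_angle_diff_neg _ (frame2 (t - d)) Nd) as J2.
  (* The two side values lie in {0, 2 pi} and, by [J1] and [J2], differ by 2 pi; so the left one is
     2 pi. *)
  assert (S : half_angle 1 (frame1 (t + d)) (frame2 (t + d)) - half_angle 1 (frame1 (t - d)) (frame2 (t - d))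
           + RInt (arg_form x (x t)) (t + d) (t + 2 * PI - d) = 2 * PI) by lra.
  clear S1 S2 J1 J2.
  (* After division by [s - t] the frame coordinates tend to [(vv, 0)], whose half-angle is
     [2 e atan 1 = e pi / 2]. *)
  assert (K : forall e, e = 1 \/ e = -1 -> exists dd, 0 < dd /\ forall s, Rabs (s - t) < dd ->
      Rabs (half_angle e (X1 s) (Y1 s) - e * (PI / 2)) < eta / 2).
  { intros e He.
    assert (Hcont : continuous (fun s => half_angle e (X1 s) (Y1 s)) t).
    { apply (ex_derive_continuous (fun s => half_angle e (X1 s) (Y1 s))). eexists.
      apply (half_angle_derive e X1 Y1 (Derive X1 t) (Derive Y1 t)); [exact He | | | left; rewrite EX; lra];
        apply Derive_correct, analytic_at_ex_derive; assumption. }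
    assert (He2 : 0 < eta / 2) by lra.
    destruct (proj1 (continuity_pt_locally _ t) (proj2 (continuity_pt_filterlim _ t) Hcont) (mkposreal _
      He2)) as [dd D].
    exists dd. split; [apply cond_pos|]. intros s Hs. specialize (D s Hs). simpl in D.
    replace (e * (PI / 2)) with (half_angle e (X1 t) (Y1 t)); [exact D|].
    rewrite EX, EY. unfold half_angle. rewrite !Rmult_0_r, Rplus_0_r, sqrt_square, Rminus_0_r by lra.
    replace (vv / vv) with 1 by (field; lra). rewrite atan_1. field. }
  destruct (K 1 (or_introl eq_refl)) as [d1 [Hd1 D1]]. destruct (K (-1) (or_intror eq_refl)) as [d2 [Hd2 D2]].
  exists (Rmin d (Rmin d1 d2)). split; [repeat apply Rmin_glb_lt; lra|].
  intros a b Ha Hb.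
  pose proof (Rmin_l d (Rmin d1 d2)). pose proof (Rmin_r d (Rmin d1 d2)).
  pose proof (Rmin_l d1 d2). pose proof (Rmin_r d1 d2).
  assert (Hex : forall u v, t < u -> u <= v -> v < t + 2 * PI -> ex_RInt (arg_form x (x t)) u v).
  { intros u v H1' H2' H3'. apply (arg_form_ex_RInt x Hx); [lra|]. intros s Hs. apply (curve_neq x Hx). lra. }
  assert (A1 : RInt (arg_form x (x t)) (t + b) (t + d)
     = half_angle 1 (frame1 (t + d)) (frame2 (t + d)) - half_angle 1 (frame1 (t + b)) (frame2 (t + b))).
  { pose proof (arc_integral 1 0 (t + b) (t + d)) as E. rewrite offset_0, !Rminus_0_r in E.
    apply E; [lra | lra|].
    intros s Hs. left. apply HX. rewrite Rabs_pos_eq by lra. lra. }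
  assert (A2 : RInt (arg_form x (x t)) (t + 2 * PI - d) (t + 2 * PI - a)
     = half_angle 1 (frame1 (t - a)) (frame2 (t - a)) - half_angle 1 (frame1 (t - d)) (frame2 (t - d))).
  { pose proof (arc_integral 1 0 (t - d) (t - a)) as E. rewrite offset_0, !Rminus_0_r in E.
    rewrite <- E; [|lra | lra|].
    - replace (t + 2 * PI - d) with (t - d + 2 * PI) by ring.
      replace (t + 2 * PI - a) with (t - a + 2 * PI) by ring.
      rewrite <- (proj2 (RInt_translate (arg_form x (x t)) (t - d) (t - a) (2 * PI) (Hex (t - d + 2 * PI) (t
        - a + 2 * PI) ltac:(lra) ltac:(lra) ltac:(lra)))).
      apply RInt_ext. intros s _. unfold arg_form. rewrite (curve_per x Hx), (vel_per x Hx). reflexivity.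
    - intros s Hs. left. apply HX. rewrite Rabs_left by lra. lra. }
  rewrite <- (RInt_Chasles (V := R_CompleteNormedModule) _ (t + b) (t + d) (t + 2 * PI - a)) by (apply Hex;
    lra).
  rewrite <- (RInt_Chasles (V := R_CompleteNormedModule) _ (t + d) (t + 2 * PI - d) (t + 2 * PI - a)) by
    (apply Hex; lra).
  rewrite A1, A2. unfold plus; simpl.
  specialize (D1 (t + b)). specialize (D2 (t - a)).
  replace (t + b - t) with b in D1 by ring. replace (t - a - t) with (- a) in D2 by ring.
  rewrite Rabs_Ropp in D2. rewrite Rabs_pos_eq in D1, D2 by lra.
  specialize (D1 ltac:(lra)). specialize (D2 ltac:(lra)).
  (* Dividing by [b > 0] keeps the reference direction and by [- a < 0] reverses it, so the limits
     are pi/2 and - pi/2 and the total is [2 pi - pi / 2 - pi / 2]. *)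
  assert (F1 : half_angle 1 (frame1 (t + b)) (frame2 (t + b)) = half_angle 1 (X1 (t + b)) (Y1 (t + b))).
  { rewrite FX, FY. apply half_angle_scale_pos. lra. }
  assert (F2 : half_angle 1 (frame1 (t - a)) (frame2 (t - a)) = half_angle (-1) (X1 (t - a)) (Y1 (t - a))).
  { rewrite FX, FY. apply half_angle_scale_neg. lra. }
  rewrite F1, F2. apply Rabs_def2 in D1, D2. apply Rabs_def1; lra.
Qed.

End Frame.

(** * The kernel and the regularized integrands *)

Lemma is_derive_log_dist (a b u : R) : 0 < (a - u) * (a - u) + b * b ->
  is_derive (fun u => - / (2 * PI) * ln (sqrt ((a - u) * (a - u) + b * b))) u
    (/ (2 * PI) * ((a - u) / ((a - u) * (a - u) + b * b))).
Proof.
  intros H. pose proof PI_RGT_0. assert (Hs : 0 < sqrt ((a - u) * (a - u) + b * b)) by (apply sqrt_lt_R0, H).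
  auto_derive.
  - repeat split; assumption.
  - pose proof (pow2_sqrt _ (Rlt_le _ _ H)) as E. replace (a + - u) with (a - u) by ring.
    set (r := sqrt _) in *. rewrite <- E. field. split; lra.
Qed.

Lemma grad_G (p q : R * R) : p <> q ->
  grad (fun q' => G p q') q = (/ (2 * PI) * ((fst p - fst q) / dot (vsub p q) (vsub p q)),
                              / (2 * PI) * ((snd p - snd q) / dot (vsub p q) (vsub p q))).
Proof.
  intros H. pose proof (dot_self_pos p q H) as Hd. unfold grad, G, enorm, dot, vsub in *. simpl in *.
  f_equal; apply is_derive_unique.
  - apply is_derive_log_dist. exact Hd.
  - rewrite Rplus_comm in Hd |- *.
    apply (is_derive_ext (fun u => - / (2 * PI) * ln (sqrt ((snd p - u) * (snd p - u) + (fst p - fst q) *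
      (fst p - fst q))))).
    + intros u. do 3 f_equal. apply Rplus_comm.
    + apply is_derive_log_dist. exact Hd.
Qed.

Lemma neq_locally (a b c d : R) : (a, b) <> (c, d) -> locally a (fun u => (u, b) <> (c, d)).
Proof.
  intros H. destruct (Req_dec b d) as [Hb|Hb].
  - assert (Ha : a <> c) by (intros E; apply H; subst; reflexivity).
    exists (mkposreal _ (Rabs_pos_lt (a - c) ltac:(lra))). intros u Hu E.
    change (Rabs (u - a) < Rabs (a - c)) in Hu. injection E as E1 _. subst u.
    rewrite Rabs_minus_sym in Hu. lra.
  - apply filter_forall. intros u E. apply Hb. injection E as _ E2. exact E2.
Qed.

Lemma neq_locally2 (a b c d : R) : (a, b) <> (c, d) -> locally b (fun v => (a, v) <> (c, d)).
Proof.
  intros H. assert (H' : (b, a) <> (d, c)) by (intros E; apply H; injection E as -> ->; reflexivity).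
  eapply filter_imp; [|apply (neq_locally _ _ _ _ H')]. intros v Hv E. apply Hv. injection E as -> ->.
  reflexivity.
Qed.

Lemma d2G_formula (p np q nq : R * R) : p <> q ->
  d2G p np q nq = dot np nq / (2 * PI * dot (vsub p q) (vsub p q))
     - dot (vsub p q) np * dot (vsub p q) nq / (PI * (dot (vsub p q) (vsub p q)) ^ 2).
Proof.
  intros H. pose proof (dot_self_pos p q H) as Hd. pose proof PI_RGT_0 as HPI.
  destruct p as [p1 p2]. destruct q as [q1 q2]. destruct np as [n1 n2]. destruct nq as [m1 m2].
  transitivity (dot (Derive (fun u => dot (grad (fun q' => G (u, p2) q') (q1, q2)) (m1, m2)) p1,
                     Derive (fun v => dot (grad (fun q' => G (p1, v) q') (q1, q2)) (m1, m2)) p2) (n1, n2));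
                       [reflexivity|].
  unfold dot, vsub in Hd. simpl in Hd.
  (* Closed form of the inner normal derivative. It is valid only off [q], so the outer derivatives
     are compared on neighbourhoods of the coordinates of [p]. *)
  set (h := fun u v => / (2 * PI) * ((u - q1) / ((u - q1) * (u - q1) + (v - q2) * (v - q2))) * m1
                      + / (2 * PI) * ((v - q2) / ((u - q1) * (u - q1) + (v - q2) * (v - q2))) * m2).
  assert (E : forall u v, (u, v) <> (q1, q2) ->
     dot (grad (fun q' => G (u, v) q') (q1, q2)) (m1, m2) = h u v).
  { intros u v Huv. rewrite grad_G by exact Huv. unfold dot, vsub, h. simpl. reflexivity. }
  assert (D1 : Derive (fun u => dot (grad (fun q' => G (u, p2) q') (q1, q2)) (m1, m2)) p1
    = / (2 * PI) * ((m1 * ((p1 - q1) * (p1 - q1) + (p2 - q2) * (p2 - q2)) - ((p1 - q1) * m1 + (p2 - q2) * m2)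
      * (2 * (p1 - q1)))
        / ((p1 - q1) * (p1 - q1) + (p2 - q2) * (p2 - q2)) ^ 2)).
  { rewrite (Derive_ext_loc _ (fun u => h u p2)).
    2:{ eapply filter_imp; [|apply (neq_locally _ _ _ _ H)]. intros u Hu. apply E, Hu. }
    apply is_derive_unique. unfold h. auto_derive.
    - repeat split; unfold Rminus in Hd; lra.
    - unfold Rminus in *. field. split; lra. }
  assert (D2 : Derive (fun v => dot (grad (fun q' => G (p1, v) q') (q1, q2)) (m1, m2)) p2
    = / (2 * PI) * ((m2 * ((p1 - q1) * (p1 - q1) + (p2 - q2) * (p2 - q2)) - ((p1 - q1) * m1 + (p2 - q2) * m2)
      * (2 * (p2 - q2)))
        / ((p1 - q1) * (p1 - q1) + (p2 - q2) * (p2 - q2)) ^ 2)).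
  { rewrite (Derive_ext_loc _ (fun v => h p1 v)).
    2:{ eapply filter_imp; [|apply (neq_locally2 _ _ _ _ H)]. intros u Hu. apply E, Hu. }
    apply is_derive_unique. unfold h. auto_derive.
    - repeat split; unfold Rminus in Hd; lra.
    - unfold Rminus in *. field. split; lra. }
  rewrite D1, D2. unfold dot, vsub. simpl fst. simpl snd. field. split; lra.
Qed.

Arguments acc : simpl never.

Lemma enorm_sq (p : R * R) : enorm p ^ 2 = dot p p.
Proof. unfold enorm. apply pow2_sqrt. unfold dot. nra. Qed.

Lemma enorm_sub_pos (p q : R * R) : p <> q -> 0 < enorm (vsub p q).
Proof. intros H. apply sqrt_lt_R0, dot_self_pos, H. Qed.

(** * Speed, normal and chord near a point of the curve *)

Section Chord.

Variable x : R -> C.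
Hypothesis Hx : analytic_simple_closed_curve x.

Lemma speed_pos (s : R) : 0 < speed x s.
Proof. apply sqrt_lt_R0, speed_sq_pos, Hx. Qed.

Lemma speed_sq (s : R) : speed x s ^ 2 = dot (vel x s) (vel x s).
Proof. apply enorm_sq. Qed.

Lemma speed_at (s : R) : analytic_at (speed x) s.
Proof.
  apply (analytic_at_sqrt (fun s => dot (vel x s) (vel x s))); [|apply speed_sq_pos, Hx].
  unfold dot. apply analytic_at_plus; apply analytic_at_mult; apply vel_at1 || apply vel_at2; exact Hx.
Qed.

Lemma normal_at1 (s : R) : analytic_at (fun s => fst (normal x s)) s.
Proof.
  apply (analytic_at_div (fun s => snd (vel x s)) (speed x));
    [apply vel_at2, Hx | apply speed_at | apply Rgt_not_eq, speed_pos].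
Qed.

Lemma normal_at2 (s : R) : analytic_at (fun s => snd (normal x s)) s.
Proof.
  apply (analytic_at_div (fun s => - fst (vel x s)) (speed x));
    [apply analytic_at_opp, vel_at1, Hx | apply speed_at | apply Rgt_not_eq, speed_pos].
Qed.

Lemma speed_per (s : R) : speed x (s + 2 * PI) = speed x s.
Proof. unfold speed. rewrite (vel_per x Hx). reflexivity. Qed.

Lemma normal_per (s : R) : normal x (s + 2 * PI) = normal x s.
Proof. unfold normal. rewrite (vel_per x Hx), speed_per. reflexivity. Qed.

Lemma normal_fst (s : R) : fst (normal x s) = snd (vel x s) / speed x s.
Proof. reflexivity. Qed.

Lemma normal_snd (s : R) : snd (normal x s) = - fst (vel x s) / speed x s.
Proof. reflexivity. Qed.

Lemma normal_unit (s : R) : dot (normal x s) (normal x s) = 1.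
Proof.
  pose proof (speed_pos s) as H. pose proof (speed_sq s) as E. unfold dot in *.
  rewrite normal_fst, normal_snd.
  apply Rmult_eq_reg_r with (speed x s ^ 2); [|apply pow_nonzero; lra].
  transitivity (fst (vel x s) * fst (vel x s) + snd (vel x s) * snd (vel x s)); [field; lra | lra].
Qed.

Lemma vel_normal (s : R) : dot (vel x s) (normal x s) = 0.
Proof. pose proof (speed_pos s). unfold dot. rewrite normal_fst, normal_snd. field. lra. Qed.

Variable t : R.

Lemma chord_factor : exists D1 D2 : R -> R, analytic_at D1 t /\ analytic_at D2 t /\
  D1 t = fst (vel x t) /\ D2 t = snd (vel x t) /\
  forall s, fst (x s) - fst (x t) = (s - t) * D1 s /\ snd (x s) - snd (x t) = (s - t) * D2 s.
Proof.
  destruct (analytic_at_factor (fun s => fst (x s) - fst (x t)) t) as [D1 [H1 [E1 F1]]].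
  { apply analytic_at_minus; [apply curve_at1, Hx | apply analytic_at_const]. } { ring. }
  destruct (analytic_at_factor (fun s => snd (x s) - snd (x t)) t) as [D2 [H2 [E2 F2]]].
  { apply analytic_at_minus; [apply curve_at2, Hx | apply analytic_at_const]. } { ring. }
  exists D1, D2. split; [exact H1|]. split; [exact H2|].
  split; [|split; [|intros s; split; [apply F1 | apply F2]]].
  - rewrite E1. apply is_derive_unique.
    replace (fst (vel x t)) with (minus (fst (vel x t)) 0) by apply Rminus_0_r.
    apply (is_derive_minus (fun s => fst (x s)) (fun _ => fst (x t)));
      [apply curve_is_derive1, Hx | apply (is_derive_const (fst (x t)))].
  - rewrite E2. apply is_derive_unique.
    replace (snd (vel x t)) with (minus (snd (vel x t)) 0) by apply Rminus_0_r.
    apply (is_derive_minus (fun s => snd (x s)) (fun _ => snd (x t)));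
      [apply curve_is_derive2, Hx | apply (is_derive_const (snd (x t)))].
Qed.

Lemma eqmod2pi_refl : eqmod2pi t t.
Proof. exists 0%Z. ring. Qed.

Lemma eqmod2pi_per (tau : R) : eqmod2pi (tau + 2 * PI) t <-> eqmod2pi tau t.
Proof.
  split; intros [k E].
  - exists (k - 1)%Z. rewrite minus_IZR. lra.
  - exists (k + 1)%Z. rewrite plus_IZR. lra.
Qed.

(** The chord length is not differentiable at [t]. Given the sign of [s - t] it becomes analytic
    there with derivative the speed, hence strictly increasing nearby. *)
Lemma chord_monotone : exists (m : R -> R) (d : R), 0 < d < PI /\ m t = 0 /\
  (forall s, enorm (vsub (x t) (x s)) = Rabs (m s)) /\
  (forall s, Rabs (s - t) <= d -> continuous m s) /\
  (forall s s', t - d <= s -> s < s' -> s' <= t + d -> m s < m s').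
Proof.
  destruct chord_factor as [D1 [D2 [H1 [H2 [E1 [E2 F]]]]]]. pose proof PI_RGT_0 as HPI.
  set (m := fun s => (s - t) * sqrt (D1 s * D1 s + D2 s * D2 s)).
  assert (Hm : analytic_at m t).
  { apply analytic_at_mult.
    - apply analytic_at_minus; [apply analytic_at_id | apply analytic_at_const].
    - apply (analytic_at_sqrt (fun s => D1 s * D1 s + D2 s * D2 s)).
      + apply analytic_at_plus; apply analytic_at_mult; assumption.
      + rewrite E1, E2. apply (speed_sq_pos x Hx). }
  assert (Dm : Derive m t = speed x t).
  { apply is_derive_unique. replace (speed x t) with (sqrt (D1 t * D1 t + D2 t * D2 t)).
    - apply (is_derive_sub_mult (fun s => sqrt (D1 s * D1 s + D2 s * D2 s))).
      apply analytic_at_continuous. apply (analytic_at_sqrt (fun s => D1 s * D1 s + D2 s * D2 s)).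
      + apply analytic_at_plus; apply analytic_at_mult; assumption.
      + rewrite E1, E2. apply (speed_sq_pos x Hx).
    - rewrite E1, E2. reflexivity. }
  destruct (analytic_at_derive m t Hm) as [L1 L2].
  assert (L3 : locally t (fun s => 0 < Derive m s)).
  { apply continuous_locally_pos; [apply analytic_at_continuous, L2 | rewrite Dm; apply speed_pos]. }
  destruct (filter_and _ _ L1 L3) as [d Hd]. pose proof (cond_pos d) as Hd0.
  exists m, (Rmin (d / 2) (PI / 2)).
  pose proof (Rmin_l (d / 2) (PI / 2)). pose proof (Rmin_r (d / 2) (PI / 2)).
  assert (0 < Rmin (d / 2) (PI / 2)) by (apply Rmin_glb_lt; lra).
  assert (Hd' : forall s, Rabs (s - t) <= Rmin (d / 2) (PI / 2) -> ex_derive m s /\ 0 < Derive m s).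
  { intros s Hs. apply Hd. change (Rabs (s - t) < d). lra. }
  split; [lra|]. split; [unfold m; ring|]. split; [|split].
  - intros s. unfold m, enorm, dot, vsub. simpl fst. simpl snd. destruct (F s) as [F1 F2].
    rewrite Rabs_mult, (Rabs_pos_eq (sqrt _)) by apply sqrt_pos.
    rewrite <- sqrt_Rsqr_abs, <- sqrt_mult_alt by apply Rle_0_sqr. f_equal. unfold Rsqr.
    replace ((fst (x t) - fst (x s)) * (fst (x t) - fst (x s))) with ((fst (x s) - fst (x t)) * (fst (x s) -
      fst (x t))) by ring.
    replace ((snd (x t) - snd (x s)) * (snd (x t) - snd (x s))) with ((snd (x s) - snd (x t)) * (snd (x s) -
      snd (x t))) by ring.
    rewrite F1, F2. ring.
  - intros s Hs. apply (ex_derive_continuous m). apply Hd', Hs.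
  - intros s s' Hs Hss Hs'.
    destruct (MVT_gen m s s' (Derive m)) as [c [Hc E]].
    + rewrite Rmin_left, Rmax_right by lra. intros u Hu. apply Derive_correct, Hd'. apply Rabs_le. lra.
    + rewrite Rmin_left, Rmax_right by lra. intros u Hu.
      apply continuity_pt_filterlim, (ex_derive_continuous m), Hd'.
      apply Rabs_le. lra.
    + rewrite Rmin_left, Rmax_right in Hc by lra.
      assert (0 < Derive m c) by (apply Hd', Rabs_le; lra). nra.
Qed.

End Chord.

Arguments normal : simpl never.

Section Regularized.

Variable x : R -> C.
Hypothesis Hx : analytic_simple_closed_curve x.
Variable t : R.

(** For small [eps] the part of the curve at distance more than [eps] is a single arc. Its end
    points can be forced within [d0] of [t], which lets all estimates be arranged beforehand. *)
Lemma truncation_window (d0 : R) : 0 < d0 -> exists eps0, 0 < eps0 /\ forall eps, 0 < eps < eps0 ->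
  exists a b, 0 < a < d0 /\ 0 < b < d0 /\ a < PI /\ b < PI /\
    enorm (vsub (x t) (x (t - a))) = eps /\ enorm (vsub (x t) (x (t + b))) = eps /\
    forall tau, t < tau < t + 2 * PI ->
      (eps < enorm (vsub (x t) (x tau)) <-> t + b < tau < t + 2 * PI - a).
Proof.
  intros Hd0. destruct (chord_monotone x Hx t) as [m [d1 [Hd1 [Hm0 [Hm [Hmc Hmi]]]]]].
  pose proof PI_RGT_0 as HPI.
  set (d := Rmin (d0 / 2) d1). pose proof (Rmin_l (d0 / 2) d1). pose proof (Rmin_r (d0 / 2) d1).
  assert (Hd : 0 < d) by (apply Rmin_glb_lt; lra). fold d in H, H0.
  (* Away from [t] the distance has a positive minimum [e1] because the curve is simple; this
     excludes distant returns to the disc of radius [eps]. *)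
  destruct (dist_below x Hx (x t) (t + d) (t + 2 * PI - d)) as [e1 [He1 He1']].
  { intros s Hs. apply (curve_neq x Hx). lra. }
  assert (Hp : 0 < m (t + d)) by (rewrite <- Hm0; apply Hmi; lra).
  assert (Hn : m (t - d) < 0) by (rewrite <- Hm0; apply Hmi; lra).
  exists (Rmin e1 (Rmin (m (t + d)) (- m (t - d)))). split; [repeat apply Rmin_glb_lt; lra|].
  intros eps [Heps Heps'].
  pose proof (Rlt_le_trans _ _ _ Heps' (Rmin_l _ _)) as K1.
  pose proof (Rlt_le_trans _ _ _ Heps' (Rmin_r _ _)) as K2.
  pose proof (Rlt_le_trans _ _ _ K2 (Rmin_l _ _)) as K3.
  pose proof (Rlt_le_trans _ _ _ K2 (Rmin_r _ _)) as K4.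
  destruct (Ranalysis5.IVT_interv (fun s => m s - eps) t (t + d)) as [sb [Hsb Eb]].
  { intros s Hs. apply continuity_pt_minus; [|apply continuity_pt_const; intros ? ?; reflexivity].
    apply continuity_pt_filterlim, Hmc, Rabs_le. lra. } { lra. } { lra. } { lra. }
  destruct (Ranalysis5.IVT_interv (fun s => m s + eps) (t - d) t) as [sa [Hsa Ea]].
  { intros s Hs. apply continuity_pt_plus; [|apply continuity_pt_const; intros ? ?; reflexivity].
    apply continuity_pt_filterlim, Hmc, Rabs_le. lra. } { lra. } { lra. } { lra. }
  simpl in Eb, Ea.
  assert (sb <> t) by (intros ->; lra). assert (sb <> t + d) by (intros ->; lra).
  assert (sa <> t) by (intros ->; lra). assert (sa <> t - d) by (intros ->; lra).
  exists (t - sa), (sb - t).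
  replace (t - (t - sa)) with sa by ring. replace (t + (sb - t)) with sb by ring.
  split; [lra|]. split; [lra|]. split; [lra|]. split; [lra|].
  split. { rewrite Hm, Rabs_left; lra. }
  split. { rewrite Hm, Rabs_pos_eq; lra. }
  intros tau Htau.
  destruct (Rlt_le_dec tau (t + d)) as [C1|C1]; [|destruct (Rle_lt_dec tau (t + 2 * PI - d)) as [C2|C2]].
  - rewrite Hm. rewrite Rabs_pos_eq by (left; rewrite <- Hm0; apply Hmi; lra). split.
    + intros Hlt. split; [|lra]. destruct (Rlt_le_dec sb tau) as [|Hle]; [assumption|].
      destruct Hle as [Hle| ->]; [|lra]. assert (m tau < m sb) by (apply Hmi; lra). lra.
    + intros [Hlt _]. assert (m sb < m tau) by (apply Hmi; lra). lra.
  - split; [intros _; lra|]. intros _. specialize (He1' tau ltac:(lra)).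
    rewrite enorm_Cmod. change (eps < Cmod (x t - x tau)). rewrite Cmod_minus_sym. lra.
  (* The end of the period is the left neighbourhood of [t], where the signed length is negative. *)
  - replace (x tau) with (x (tau - 2 * PI)) by (rewrite <- (curve_per x Hx (tau - 2 * PI)); f_equal; ring).
    rewrite Hm. rewrite Rabs_left by (rewrite <- Hm0; apply Hmi; lra). split.
    + intros Hlt. split; [lra|]. destruct (Rlt_le_dec (tau - 2 * PI) sa) as [|Hle]; [lra|].
      destruct Hle as [Hle|Hle]; [|rewrite <- Hle in Hlt; lra].
      assert (m sa < m (tau - 2 * PI)) by (apply Hmi; lra). lra.
    + intros [_ Hlt]. assert (m (tau - 2 * PI) < m sa) by (apply Hmi; lra). lra.
Qed.

Definition chord_dot1 (s : R) : R := dot (vsub (x t) (x s)) (normal x t).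
Definition chord_dot2 (s : R) : R := dot (vsub (x t) (x s)) (normal x s).

Lemma chord_dot1_at (s : R) : analytic_at chord_dot1 s.
Proof.
  unfold chord_dot1, dot, vsub. simpl fst at 1. simpl snd at 1.
  apply analytic_at_plus; apply analytic_at_mult; try apply analytic_at_minus;
    first [apply analytic_at_const | apply (curve_at1 x Hx) | apply (curve_at2 x Hx)].
Qed.

Lemma chord_dot2_at (s : R) : analytic_at chord_dot2 s.
Proof.
  unfold chord_dot2, dot, vsub. simpl fst at 1. simpl snd at 1.
  apply analytic_at_plus; apply analytic_at_mult; try apply analytic_at_minus;
    first [apply analytic_at_const | apply (curve_at1 x Hx) | apply (curve_at2 x Hx) |
      apply (normal_at1 x Hx) | apply (normal_at2 x Hx)].
Qed.

Lemma chord_dot1_derive (s : R) : Derive chord_dot1 s = - dot (vel x s) (normal x t).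
Proof.
  apply is_derive_unique.
  apply (is_derive_ext (fun s => - fst (normal x t) * (fst (x s) - fst (x t)) + - snd (normal x t) * (snd (x
    s) - snd (x t)))).
  - intros u. change (@eq R (- fst (normal x t) * (fst (x u) - fst (x t)) + - snd (normal x t) * (snd (x u) -
    snd (x t)))
      ((fst (x t) - fst (x u)) * fst (normal x t) + (snd (x t) - snd (x u)) * snd (normal x t))). ring.
  - replace (- dot (vel x s) (normal x t)) with (- fst (normal x t) * fst (vel x s) + - snd (normal x t) *
    snd (vel x s)) by (unfold dot; ring).
    apply (is_derive_affine2 (fun s => fst (x s)) (fun s => snd (x s)));
      [apply curve_is_derive1 | apply curve_is_derive2]; exact Hx.
Qed.

Lemma chord_dot1_derive2 : Derive_n chord_dot1 2 t = - dot (acc x t) (normal x t).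
Proof.
  change (Derive (Derive chord_dot1) t = - dot (acc x t) (normal x t)).
  rewrite (Derive_ext _ _ t chord_dot1_derive). apply is_derive_unique.
  apply (is_derive_ext (fun s => - fst (normal x t) * (fst (vel x s) - 0) + - snd (normal x t) * (snd (vel x
    s) - 0))).
  - intros u. change (@eq R (- fst (normal x t) * (fst (vel x u) - 0) + - snd (normal x t) * (snd (vel x u) -
    0))
      (- (fst (vel x u) * fst (normal x t) + snd (vel x u) * snd (normal x t)))). ring.
  - replace (- dot (acc x t) (normal x t)) with (- fst (normal x t) * fst (acc x t) + - snd (normal x t) *
    snd (acc x t)) by (unfold dot; ring).
    apply (is_derive_affine2 (fun s => fst (vel x s)) (fun s => snd (vel x s))).
    + apply Derive_correct, analytic_at_ex_derive, (vel_at1 x Hx).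
    + apply Derive_correct, analytic_at_ex_derive, (vel_at2 x Hx).
Qed.

(** The zero is double because the velocity is orthogonal to the normal; the coefficient is what
    gives the diagonal value of [RQ]. *)
Lemma chord_dot1_factor : exists e, analytic_at e t /\ e t = - dot (acc x t) (normal x t) / 2 /\
  forall s, chord_dot1 s = (s - t) ^ 2 * e s.
Proof.
  destruct (analytic_at_factor2 chord_dot1 t (chord_dot1_at t)) as [e [H1 [H2 H3]]].
  - unfold chord_dot1, dot, vsub. simpl fst at 1. simpl snd at 1. ring.
  - rewrite chord_dot1_derive, (vel_normal x Hx). ring.
  - exists e. rewrite chord_dot1_derive2 in H2. split; [exact H1|]. split; [exact H2 | exact H3].
Qed.

(** The moving normal is only differentiated through the first-order factor of the chord, so
    tangency at [t] again yields a double zero. *)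
Lemma chord_dot2_factor : exists e, analytic_at e t /\ forall s, chord_dot2 s = (s - t) ^ 2 * e s.
Proof.
  destruct (analytic_at_factor2 chord_dot2 t (chord_dot2_at t)) as [e [H1 [_ H3]]].
  - unfold chord_dot2, dot, vsub. simpl fst at 1. simpl snd at 1. ring.
  - destruct (chord_factor x Hx t) as [D1 [D2 [HD1 [HD2 [E1 [E2 F]]]]]].
    apply is_derive_unique.
    apply (is_derive_ext (fun s => (s - t) * (- (D1 s * fst (normal x s) + D2 s * snd (normal x s))))).
    + intros s. destruct (F s) as [F1 F2].
      change (@eq R ((s - t) * - (D1 s * fst (normal x s) + D2 s * snd (normal x s)))
        ((fst (x t) - fst (x s)) * fst (normal x s) + (snd (x t) - snd (x s)) * snd (normal x s))).
      replace (fst (x t) - fst (x s)) with (- ((s - t) * D1 s)) by (rewrite <- F1; ring).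
      replace (snd (x t) - snd (x s)) with (- ((s - t) * D2 s)) by (rewrite <- F2; ring). ring.
    + replace 0 with (- (D1 t * fst (normal x t) + D2 t * snd (normal x t))).
      * apply (is_derive_sub_mult (fun s => - (D1 s * fst (normal x s) + D2 s * snd (normal x s)))).
        apply analytic_at_continuous, analytic_at_opp, analytic_at_plus; apply analytic_at_mult;
          try assumption;
          [apply normal_at1 | apply normal_at2]; exact Hx.
      * rewrite E1, E2. pose proof (vel_normal x Hx t) as K. unfold dot in K. lra.
  - exists e. split; assumption.
Qed.

Lemma not_eqmod_locally (tau : R) : ~ eqmod2pi tau t -> locally tau (fun s => ~ eqmod2pi s t).
Proof.
  intros H.
  assert (Hne : x tau <> x t) by (intros E; apply H, (curve_inj_mod x Hx), E).
  pose proof (dot_self_pos _ _ Hne) as Hp.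
  pose proof (analytic_at_neq_0 _ tau (analytic_at_continuous _ _ (dist_sq_at x Hx (x t) tau)) (Rgt_not_eq _
    _ Hp)) as L.
  eapply filter_imp; [|exact L]. intros s Hs [k E]. apply Hs.
  rewrite E, (periodic_Z x (curve_periodic x Hx)). unfold dot, vsub. simpl fst. simpl snd. ring.
Qed.

Lemma near_eqmod : locally t (fun s => eqmod2pi s t -> s = t).
Proof.
  pose proof PI_RGT_0. assert (H2 : 0 < 2 * PI) by lra. exists (mkposreal _ H2). intros s Hs E.
  apply eqmod2pi_near; [exact E | exact Hs].
Qed.

Lemma chord_sq_at (s : R) : analytic_at (fun s => enorm (vsub (x t) (x s)) ^ 2) s.
Proof.
  apply (analytic_at_ext_loc (fun s => dot (vsub (x s) (x t)) (vsub (x s) (x t)))).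
  - apply filter_forall. intros u. rewrite enorm_sq. unfold dot, vsub. simpl fst. simpl snd. ring.
  - apply dist_sq_at, Hx.
Qed.

Lemma not_eqmod_neq (s : R) : ~ eqmod2pi s t -> x t <> x s.
Proof. intros H E. apply H, (curve_inj_mod x Hx). symmetry. exact E. Qed.

Lemma chord_sq_neq (s : R) : ~ eqmod2pi s t -> enorm (vsub (x t) (x s)) ^ 2 <> 0.
Proof.
  intros H. apply pow_nonzero, Rgt_not_eq, enorm_sub_pos, not_eqmod_neq, H.
Qed.

Lemma chord_sq_factor : exists n, analytic_at n t /\ n t = speed x t ^ 2 /\
  forall s, enorm (vsub (x t) (x s)) ^ 2 = (s - t) ^ 2 * n s.
Proof.
  destruct (chord_factor x Hx t) as [D1 [D2 [HD1 [HD2 [E1 [E2 F]]]]]].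
  exists (fun s => D1 s * D1 s + D2 s * D2 s). split; [|split].
  - apply analytic_at_plus; apply analytic_at_mult; assumption.
  - rewrite speed_sq by exact Hx. unfold dot. rewrite E1, E2. reflexivity.
  - intros s. rewrite enorm_sq. unfold dot, vsub. simpl fst. simpl snd. destruct (F s) as [F1 F2].
    replace (fst (x t) - fst (x s)) with (- ((s - t) * D1 s)) by (rewrite <- F1; ring).
    replace (snd (x t) - snd (x s)) with (- ((s - t) * D2 s)) by (rewrite <- F2; ring). ring.
Qed.

Lemma eqmod_shift_at (f : R -> R) (tau : R) : periodic f -> eqmod2pi tau t -> analytic_at f t -> analytic_at
  f tau.
Proof.
  intros Hf [k ->] H. apply analytic_at_shift; [|exact H]. intros s. apply periodic_Z, Hf.
Qed.

Variables (phi : R -> R) (U : R * R -> R * R -> R).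
Hypothesis Hphi : periodic phi.

Lemma trace_per1 (s : R) : dirichlet_trace x U (s + 2 * PI) t = dirichlet_trace x U s t.
Proof. unfold dirichlet_trace. rewrite (curve_per x Hx). reflexivity. Qed.

Lemma trace_per2 (s : R) : neumann_trace x U (s + 2 * PI) t = neumann_trace x U s t.
Proof. unfold neumann_trace. rewrite (curve_per x Hx), (normal_per x Hx). reflexivity. Qed.

Lemma RP_periodic : periodic (fun tau => RP x phi U tau t).
Proof.
  intros s. unfold RP.
  destruct (excluded_middle_informative (eqmod2pi (s + 2 * PI) t)) as [H|H];
    destruct (excluded_middle_informative (eqmod2pi s t)) as [H'|H']; try reflexivity.
  - contradiction H'. apply eqmod2pi_per, H.
  - contradiction H. apply eqmod2pi_per, H'.
  - rewrite trace_per1, Hphi, (curve_per x Hx), (normal_per x Hx). reflexivity.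
Qed.

Lemma RQ_periodic : periodic (fun tau => RQ x U tau t).
Proof.
  intros s. unfold RQ.
  destruct (excluded_middle_informative (eqmod2pi (s + 2 * PI) t)) as [H|H];
    destruct (excluded_middle_informative (eqmod2pi s t)) as [H'|H']; try reflexivity.
  - contradiction H'. apply eqmod2pi_per, H.
  - contradiction H. apply eqmod2pi_per, H'.
  - rewrite trace_per2, (curve_per x Hx). reflexivity.
Qed.

(** The double zero of [phi - P] cancels the double pole of the first kernel term. The second term
    is regular, as its numerator vanishes to order 4, and so contributes nothing at [t]. There the
    product is [1 / (2 pi |x'| ^ 2)] times half the second derivative, the prescribed diagonal
    value. *)
Lemma RP_at (tau : R) : (forall s, analytic_at (fun s => phi s - dirichlet_trace x U s t) s) ->
  phi t - dirichlet_trace x U t t = 0 -> Derive (fun s => phi s - dirichlet_trace x U s t) t = 0 ->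
  analytic_at (fun tau => RP x phi U tau t) tau.
Proof.
  intros Hg H0 H1. pose proof PI_RGT_0 as HPI. pose proof (speed_pos x Hx t) as Hsp.
  destruct (excluded_middle_informative (eqmod2pi tau t)) as [E|E].
  (* Periodicity reduces this case to [tau = t], where all the factorizations are centred. *)
  - apply eqmod_shift_at; [apply RP_periodic | exact E|].
    destruct chord_sq_factor as [n [Hn [En Fn]]].
    destruct chord_dot1_factor as [e1 [He1 [Ee1 Fe1]]]. destruct chord_dot2_factor as [e2 [He2 Fe2]].
    destruct (analytic_at_factor2 _ t (Hg t) H0 H1) as [g2 [Hg2 [Eg2 Fg2]]].
    assert (Hnt : n t <> 0) by (rewrite En; apply pow_nonzero; lra).
    apply (analytic_at_ext_loc (fun s => (dot (normal x s) (normal x t) / (2 * PI * n s)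
         - (s - t) ^ 2 * (e1 s * e2 s) / (PI * (n s * n s))) * g2 s)).
    + eapply filter_imp; [|apply (filter_and _ _ near_eqmod (analytic_at_neq_0 n t (analytic_at_continuous _
      _ Hn) Hnt))].
      intros s [Hs Hns]. unfold RP. destruct (excluded_middle_informative (eqmod2pi s t)) as [Es|Es].
      * rewrite (Hs Es), (normal_unit x Hx), En, Eg2. field. split; lra.
      * assert (Hst : s - t <> 0) by (intros E0; apply Es; replace s with t by lra; apply eqmod2pi_refl).
        replace (enorm (vsub (x t) (x s)) ^ 4) with (enorm (vsub (x t) (x s)) ^ 2 * enorm (vsub (x t) (x s))
          ^ 2) by ring.
        rewrite Fn. change (dot (vsub (x t) (x s)) (normal x t)) with (chord_dot1 s).
        change (dot (vsub (x t) (x s)) (normal x s)) with (chord_dot2 s). rewrite Fe1, Fe2.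
        rewrite (Fg2 s).
        field. repeat split; lra.
    + assert (Hsq : analytic_at (fun s => (s - t) ^ 2) t).
      { apply (analytic_at_ext_loc (fun s => (s - t) * (s - t))); [apply filter_forall; intros s; simpl;
        rring|].
        apply analytic_at_mult; apply analytic_at_minus;
          first [apply analytic_at_id | apply analytic_at_const]. }
      apply analytic_at_mult; [|exact Hg2]. apply analytic_at_minus.
      * apply analytic_at_div.
        -- unfold dot. apply analytic_at_plus; apply analytic_at_mult;
             first [apply analytic_at_const | apply (normal_at1 x Hx) | apply (normal_at2 x Hx)].
        -- apply analytic_at_mult; [apply analytic_at_const | exact Hn].
        -- apply Rmult_integral_contrapositive. split; lra.
      * apply analytic_at_div.
        -- apply (analytic_at_mult (fun s => (s - t) ^ 2) (fun s => e1 s * e2 s)); [exact Hsq|].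
          apply analytic_at_mult; assumption.
        -- apply analytic_at_mult; [apply analytic_at_const | apply analytic_at_mult; exact Hn].
        -- apply Rmult_integral_contrapositive; split; [lra|].
           apply Rmult_integral_contrapositive; split; assumption.
  - set (N := fun s => enorm (vsub (x t) (x s)) ^ 2).
    apply (analytic_at_ext_loc (fun s => (dot (normal x s) (normal x t) / (2 * PI * N s)
         - chord_dot1 s * chord_dot2 s / (PI * (N s * N s))) * (phi s - dirichlet_trace x U s t))).
    + eapply filter_imp; [|apply (not_eqmod_locally tau E)]. intros s Hs. unfold RP.
      destruct (excluded_middle_informative (eqmod2pi s t)) as [Es|Es]; [contradiction|].
      replace (enorm (vsub (x t) (x s)) ^ 4) with (N s * N s) by (unfold N; ring). reflexivity.
    + pose proof (chord_sq_neq tau E) as HN. fold (N tau) in HN.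
      apply analytic_at_mult; [|apply Hg]. apply analytic_at_minus.
      * apply analytic_at_div.
        -- unfold dot. apply analytic_at_plus; apply analytic_at_mult;
             first [apply analytic_at_const | apply (normal_at1 x Hx) | apply (normal_at2 x Hx)].
        -- apply analytic_at_mult; [apply analytic_at_const | apply chord_sq_at].
        -- apply Rmult_integral_contrapositive. split; lra.
      * apply analytic_at_div.
        -- apply analytic_at_mult; [apply chord_dot1_at | apply chord_dot2_at].
        -- apply analytic_at_mult; [apply analytic_at_const | apply analytic_at_mult; apply chord_sq_at].
        -- apply Rmult_integral_contrapositive; split; [lra|].
           apply Rmult_integral_contrapositive; split; assumption.
Qed.

(** The double zeros of the numerator and of the squared distance cancel, leaving [e1 / n], which
    equals [- x'' . n / (2 |x'| ^ 2)] at [t]. *)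
Lemma RQ_at (tau : R) : (forall s, analytic_at (fun s => neumann_trace x U s t) s) ->
  analytic_at (fun tau => RQ x U tau t) tau.
Proof.
  intros HQ. pose proof PI_RGT_0 as HPI. pose proof (speed_pos x Hx t) as Hsp.
  destruct (excluded_middle_informative (eqmod2pi tau t)) as [E|E].
  - apply eqmod_shift_at; [apply RQ_periodic | exact E|].
    destruct chord_sq_factor as [n [Hn [En Fn]]].
    destruct chord_dot1_factor as [e1 [He1 [Ee1 Fe1]]].
    assert (Hnt : n t <> 0) by (rewrite En; apply pow_nonzero; lra).
    apply (analytic_at_ext_loc (fun s => - / (2 * PI) * (e1 s / n s) * neumann_trace x U s t)).
    + eapply filter_imp; [|apply (filter_and _ _ near_eqmod (analytic_at_neq_0 n t (analytic_at_continuous _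
      _ Hn) Hnt))].
      intros s [Hs Hns]. unfold RQ. destruct (excluded_middle_informative (eqmod2pi s t)) as [Es|Es].
      * rewrite (Hs Es), En, Ee1. field. split; lra.
      * assert (Hst : s - t <> 0) by (intros E0; apply Es; replace s with t by lra; apply eqmod2pi_refl).
        rewrite Fn. change (dot (vsub (x t) (x s)) (normal x t)) with (chord_dot1 s). rewrite Fe1.
        field. repeat split; lra.
    + apply analytic_at_mult; [|apply HQ]. apply analytic_at_mult; [apply analytic_at_const|].
      apply analytic_at_div; assumption.
  - apply (analytic_at_ext_loc (fun s => - / (2 * PI) * (chord_dot1 s / enorm (vsub (x t) (x s)) ^ 2) *
    neumann_trace x U s t)).
    + eapply filter_imp; [|apply (not_eqmod_locally tau E)]. intros s Hs. unfold RQ.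
      destruct (excluded_middle_informative (eqmod2pi s t)) as [Es|Es]; [contradiction|]. reflexivity.
    + apply analytic_at_mult; [|apply HQ]. apply analytic_at_mult; [apply analytic_at_const|].
      apply analytic_at_div; [apply chord_dot1_at | apply chord_sq_at | apply chord_sq_neq, E].
Qed.

End Regularized.

(** * The limit of the truncated integrals *)

Lemma is_derive_ln_Cmod (f : R -> C) (s : R) (df : C) : pder f s df -> f s <> 0%C ->
  is_derive (fun s => ln (Cmod (f s))) s (fst (df / f s)%C).
Proof.
  intros [H1 H2] H0.
  assert (Hp : 0 < fst (f s) * fst (f s) + snd (f s) * snd (f s)).
  { apply Cmod_gt_0 in H0. pose proof (Cmod_dot (f s)) as E. unfold dot in E. nra. }
  assert (Hs : 0 < sqrt (fst (f s) * fst (f s) + snd (f s) * snd (f s))) by (apply sqrt_lt_R0, Hp).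
  apply (is_derive_ext (fun s => ln (sqrt (fst (f s) * fst (f s) + snd (f s) * snd (f s))))).
  { intros u. f_equal. unfold Cmod. f_equal. simpl. rring. }
  assert (G : forall p q : R -> R,
    is_derive p s (fst df) -> is_derive q s (snd df) -> 0 < p s * p s + q s * q s ->
     is_derive (fun s => ln (sqrt (p s * p s + q s * q s))) s ((p s * fst df + q s * snd df) / (p s * p s + q
       s * q s))).
  { intros p q D1 D2 Hpq. assert (0 < sqrt (p s * p s + q s * q s)) by (apply sqrt_lt_R0, Hpq).
    auto_derive.
    - repeat split; try assumption; try (exists (fst df); exact D1); try (exists (snd df); exact D2).
    - change (fun x => p x) with p. change (fun x => q x) with q.
      rewrite (is_derive_unique _ _ _ D1), (is_derive_unique _ _ _ D2).
      pose proof (pow2_sqrt _ (Rlt_le _ _ Hpq)) as E. set (r := sqrt (p s * p s + q s * q s)) in *.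
      transitivity ((p s * fst df + q s * snd df) / r ^ 2); [field; lra | rewrite E; reflexivity]. }
  replace (fst (df / f s)%C) with ((fst (f s) * fst df + snd (f s) * snd df) / (fst (f s) * fst (f s) + snd
    (f s) * snd (f s))).
  - apply (G (fun s => fst (f s)) (fun s => snd (f s)) H1 H2 Hp).
  - unfold Cdiv, Cinv. simpl. field. lra.
Qed.

Lemma is_lim_continuous_unique (f : R -> R) (t l : R) : continuous f t -> is_lim f t l -> f t = l.
Proof.
  intros Hf Hl. apply is_lim_unique in Hl.
  assert (H : is_lim f t (f t)) by (apply is_lim_continuity, continuity_pt_filterlim, Hf).
  apply is_lim_unique in H. rewrite Hl in H. injection H as ->. reflexivity.
Qed.

(** The normal is [- i v / s], so this is minus the tangential component of [1 / z]. *)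
Lemma snd_normal_quotient (v z : C) (s : R) : 0 < s -> s ^ 2 = dot v v -> z <> 0%C ->
  snd ((snd v / s, - fst v / s)%R / z)%C = - (fst v * fst z + snd v * snd z) / (s * Cmod z ^ 2).
Proof.
  intros Hs E Hz. apply Cmod_gt_0 in Hz. pose proof (Cmod_dot z) as Ez. unfold dot in Ez.
  rewrite Ez. assert (0 < fst z * fst z + snd z * snd z) by nra. unfold Cdiv, Cinv. simpl. field.
  split; [lra|]. lra.
Qed.

Section Main.

Variable x : R -> C.
Hypothesis Hx : analytic_simple_closed_curve x.
Variable t : R.

Let zeta (s : R) : C := (x s - x t)%C.
Let nu : C := normal x t.

Lemma zeta_Cmod (s : R) : Cmod (zeta s) = enorm (vsub (x t) (x s)).
Proof. rewrite enorm_Cmod. unfold zeta. rewrite Cmod_minus_sym. reflexivity. Qed.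

Lemma zeta_neq (s : R) : t < s < t + 2 * PI -> zeta s <> 0%C.
Proof.
  intros Hs E. apply (curve_neq x Hx t s Hs). apply Ceq_minus. exact E.
Qed.

(* The chord makes an angle [O(s - t)] with the tangent, so the projection of its inverse on the
   tangent is the inverse length up to [O(s - t)]. *)
Lemma chord_end : exists Cst d, 0 < Cst /\ 0 < d < PI /\
  (forall s, t < s < t + d -> Rabs (snd (nu / zeta s)%C + / Cmod (zeta s)) <= Cst * (s - t)) /\
  (forall s, t - d < s < t -> Rabs (snd (nu / zeta s)%C - / Cmod (zeta s)) <= Cst * (t - s)).
Proof.
  pose proof PI_RGT_0 as HPI. pose proof (speed_pos x Hx t) as Hsp.
  destruct (frame_factor x Hx t) as [X1 [Y1 [d0 [Hd0 [HX1 [_ [_ [_ [FX [_ HP]]]]]]]]]].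
  destruct (analytic_at_factor2 (frame2 x t) t) as [Y2 [HY2 [_ FY]]].
  { apply frame2_at, Hx. } { apply frame_t. }
  { rewrite (is_derive_unique _ _ _ (frame2_derive x Hx t t)). ring. }
  destruct (chord_sq_factor x Hx t) as [n [Hn [En Fn]]].
  assert (Hnt : 0 < n t) by (rewrite En; apply pow_lt, Hsp).
  pose proof (continuous_locally_pos n t (analytic_at_continuous n t Hn) Hnt) as Ln.
  set (sp := speed x t) in *.
  (* Chosen so that [Y ^ 2 / (sp ^ 2 r ^ 3) = |s - t| W s], where [Y] is the second-order normal
     deviation of the chord. *)
  set (W := fun s => Y2 s * Y2 s / (sp ^ 2 * (n s * sqrt (n s)))).
  assert (HW : continuous W t).
  { apply analytic_at_continuous. apply analytic_at_div.
    - apply analytic_at_mult; exact HY2.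
    - apply analytic_at_mult; [apply analytic_at_const|].
      apply analytic_at_mult; [exact Hn | apply analytic_at_sqrt; assumption].
    - apply Rgt_not_eq. apply Rmult_lt_0_compat; [apply pow_lt, Hsp|].
      apply Rmult_lt_0_compat; [exact Hnt | apply sqrt_lt_R0, Hnt]. }
  assert (LW : locally t (fun s => Rabs (W s) <= Rabs (W t) + 1)).
  { apply (filter_imp (fun s => Rabs (W s - W t) < 1)).
    - intros s Hs. pose proof (Rabs_triang (W s - W t) (W t)) as K.
      replace (W s - W t + W t) with (W s) in K by rring. lra.
    - apply (proj1 (continuity_pt_locally W t) (proj2 (continuity_pt_filterlim W t) HW) (mkposreal 1
      Rlt_0_1)). }
  destruct (filter_and _ _ Ln LW) as [d1 Hd1]. pose proof (cond_pos d1) as Hd1p.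
  exists (Rabs (W t) + 1), (Rmin d0 d1).
  pose proof (Rmin_l d0 d1). pose proof (Rmin_r d0 d1).
  assert (0 < Rmin d0 d1) by (apply Rmin_glb_lt; lra).
  split; [pose proof (Rabs_pos (W t)); lra|]. split; [lra|].
  (* The sign [sg] records the side of [t], so that both end estimates are one computation. *)
  assert (Common : forall s sg, (sg = 1 \/ sg = -1) -> 0 < sg * (s - t) -> Rabs (s - t) < Rmin d0 d1 ->
    Rabs (snd (nu / zeta s)%C + sg * / Cmod (zeta s)) <= (Rabs (W t) + 1) * Rabs (s - t)).
  { intros s sg Hsg Hst Hs. set (X := frame1 x t s). set (Y := frame2 x t s). set (r := Cmod (zeta s)).
    assert (Hst' : s <> t) by (intros ->; lra).
    assert (Hz : zeta s <> 0%C).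
    { intros E. apply Ceq_minus in E. apply (curve_inj_mod x Hx), eqmod2pi_near in E; [exact (Hst' E)|lra]. }
    assert (Hr : 0 < r) by (apply Cmod_gt_0, Hz).
    destruct (Hd1 s) as [Hns HWs]; [change (Rabs (s - t) < d1); lra|].
    assert (Er : r ^ 2 = (s - t) ^ 2 * n s) by (unfold r; rewrite zeta_Cmod; apply Fn).
    assert (Er1 : r = Rabs (s - t) * sqrt (n s)).
    { rewrite <- (sqrt_pow2 r) by lra. rewrite Er, sqrt_mult_alt by apply pow2_ge_0. f_equal.
      rewrite <- sqrt_Rsqr_abs. f_equal. unfold Rsqr. ring. }
    assert (Ev : sp ^ 2 = dot (vel x t) (vel x t)) by apply speed_sq.
    assert (E1 : X ^ 2 + Y ^ 2 = sp ^ 2 * r ^ 2).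
    { pose proof (Cmod_dot (zeta s)) as Ed. fold r in Ed. rewrite Ed, Ev.
      unfold X, Y, frame1, frame2, dot, zeta.
      set (v1 := fst (vel x t)). set (v2 := snd (vel x t)). simpl. ring. }
    assert (E2 : snd (nu / zeta s)%C = - X / (sp * r ^ 2)).
    { unfold nu. change (normal x t) with ((snd (vel x t) / sp, - fst (vel x t) / sp)%R : C).
      rewrite (snd_normal_quotient (vel x t) (zeta s) sp Hsp Ev Hz). reflexivity. }
    assert (HX : 0 < sg * X).
    { unfold X. rewrite FX, <- Rmult_assoc. apply Rmult_lt_0_compat; [exact Hst | apply HP; lra]. }
    assert (E4 : Y ^ 2 / (sp * r ^ 2 * (sp * r)) <= (Rabs (W t) + 1) * Rabs (s - t)).
    { unfold Y. rewrite FY. assert (Hq : 0 < sqrt (n s)) by (apply sqrt_lt_R0, Hns).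
      assert (Ha : 0 < Rabs (s - t)) by (apply Rabs_pos_lt; lra).
      replace (((s - t) ^ 2 * Y2 s) ^ 2 / (sp * r ^ 2 * (sp * r))) with (Rabs (s - t) * W s).
      + pose proof (Rle_abs (W s)). nra.
      + unfold W. rewrite Er. rewrite Er1. rewrite <- (pow2_abs (s - t)). field. repeat split; lra. }
    assert (Hsr : 0 < sp * r) by nra.
    assert (D1 : 0 < sp * r ^ 2) by (apply Rmult_lt_0_compat; [exact Hsp | apply pow_lt, Hr]).
    (* The cancellation is made explicit by [(sp r) ^ 2 - X ^ 2 = Y ^ 2]; dropping [sg * X > 0] from
       the denominator then gives [E4]. *)
    rewrite E2. replace (- X / (sp * r ^ 2) + sg * / r) with (sg * (Y ^ 2 / (sp * r ^ 2 * (sp * r + sg *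
      X)))).
    - rewrite Rabs_mult. replace (Rabs sg) with 1 by (destruct Hsg; subst sg; rewrite ?Rabs_R1, ?Rabs_m1;
      reflexivity).
      rewrite Rmult_1_l, Rabs_pos_eq.
      + eapply Rle_trans; [|exact E4]. apply Rmult_le_compat_l; [apply pow2_ge_0|].
        apply Rinv_le_contravar; [nra|]. apply Rmult_le_compat_l; lra.
      + apply Rdiv_le_0_compat; [apply pow2_ge_0|]. apply Rmult_lt_0_compat; lra.
    - replace (Y ^ 2) with ((sp * r - X) * (sp * r + X)) by (replace (Y ^ 2) with (sp ^ 2 * r ^ 2 - X ^ 2) by
      lra; ring).
      destruct Hsg; subst sg; field; repeat split; lra. }
  split; intros s Hs.
  - pose proof (Common s 1) as K. rewrite (Rabs_pos_eq (s - t)), !Rmult_1_l in K by lra. apply K; lra.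
  - pose proof (Common s (-1)) as K. rewrite (Rabs_left (s - t)) in K by lra.
    replace (t - s) with (- (s - t)) by ring.
    replace (snd (nu / zeta s)%C - / Cmod (zeta s)) with (snd (nu / zeta s)%C + -1 * / Cmod (zeta s)) by ring.
    apply K; lra.
Qed.

End Main.

(** With [H = n / (2 pi (z - p))] this reads [s d2G = Im (H' v)]. The scale [s] cancels against the
    normalization of the second normal, hence may be any positive number. *)
Lemma kernel_complex (p q v : C) (n : C) (s : R) : p <> q -> 0 < s ->
  d2G p n q (snd v / s, - fst v / s) * s
  = - snd (RtoC (/ (2 * PI)) * n * (/ (q - p) * / (q - p)) * v)%C.
Proof.
  intros Hpq Hs. pose proof PI_RGT_0 as HPI. rewrite d2G_formula by exact Hpq.
  pose proof (dot_self_pos p q Hpq) as Hd.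
  destruct p as [p1 p2]. destruct q as [q1 q2]. destruct v as [v1 v2]. destruct n as [n1 n2].
  unfold dot, vsub in *. simpl in *.
  assert (Hd2 : 0 < (q1 + - p1) * (q1 + - p1) + (q2 + - p2) * (q2 + - p2)) by lra.
  set (a := q1 + - p1) in *. set (b := q2 + - p2) in *.
  replace (p1 - q1) with (- a) by (unfold a; ring). replace (p2 - q2) with (- b) by (unfold b; ring).
  field. repeat split; lra.
Qed.

Lemma single_kernel_complex (p q n : C) : p <> q ->
  - / (2 * PI) * (dot (vsub p q) n / dot (vsub p q) (vsub p q)) = fst (RtoC (/ (2 * PI)) * n * / (q - p))%C.
Proof.
  intros Hpq. pose proof PI_RGT_0 as HPI. pose proof (dot_self_pos p q Hpq) as Hd.
  destruct p as [p1 p2]. destruct q as [q1 q2]. destruct n as [n1 n2].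
  unfold dot, vsub in *. simpl in *.
  assert (Hd2 : 0 < (q1 + - p1) * (q1 + - p1) + (q2 + - p2) * (q2 + - p2)) by lra.
  set (a := q1 + - p1) in *. set (b := q2 + - p2) in *.
  replace (p1 - q1) with (- a) by (unfold a; ring). replace (p2 - q2) with (- b) by (unfold b; ring).
  field. repeat split; lra.
Qed.

(** * An explicit primitive for the singular part of the integrand *)

Section Potential.

Variable x : R -> C.
Hypothesis Hx : analytic_simple_closed_curve x.
Variable t : R.
Variables (u : R * R -> R) (Phi Phi' Psi : C -> C).
Hypothesis HPhi0 : snd (Phi (x t)) = 0.
Hypothesis HPsi0 : ccont Psi (x t).
Hypothesis HPhi : forall s, cder Phi (x s) (Phi' (x s)) /\ holo_at Phi (x s) /\ holo_at Phi' (x s) /\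
      fst (Phi (x s)) = u (x s) /\ Phi' (x s) = (fst (grad u (x s)), - snd (grad u (x s))) /\
      (x s <> x t -> cder Psi (x s)
         ((Phi (x s) - Phi (x t) - Phi' (x t) * (x s - x t)) / ((x s - x t) * (x s - x t)))%C).

Let zeta (s : R) : C := (x s - x t)%C.
Let k : C := (RtoC (/ (2 * PI)) * normal x t)%C.

Lemma pair_canalytic (f g : R -> R) (s : R) : analytic_at f s -> analytic_at g s -> canalytic_at (fun s => (f
  s, g s)) s.
Proof.
  intros Hf Hg. apply analytic_at_canalytic in Hf. apply analytic_at_canalytic in Hg.
  pose proof (canalytic_at_plus _ _ _ Hf (canalytic_at_mult _ _ _ (canalytic_at_const Ci s) Hg)) as [F [H E]].
  exists F. split; [exact H|]. eapply filter_imp; [|exact E]. intros r <-.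
  apply injective_projections; simpl; ring.
Qed.

Lemma curve_canalytic (s : R) : canalytic_at x s.
Proof.
  destruct (pair_canalytic _ _ s (curve_at1 x Hx s) (curve_at2 x Hx s)) as [F [H E]].
  exists F. split; [exact H|]. eapply filter_imp; [|exact E]. intros r <-. apply surjective_pairing.
Qed.

Lemma vel_canalytic (s : R) : canalytic_at (vel x) s.
Proof.
  destruct (pair_canalytic _ _ s (vel_at1 x Hx s) (vel_at2 x Hx s)) as [F [H E]].
  exists F. split; [exact H|]. eapply filter_imp; [|exact E]. intros r <-. apply surjective_pairing.
Qed.

Lemma Phi_canalytic (s : R) : canalytic_at (fun s => Phi (x s)) s.
Proof. apply canalytic_at_comp; [apply HPhi | apply curve_canalytic]. Qed.

Lemma Phi'_canalytic (s : R) : canalytic_at (fun s => Phi' (x s)) s.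
Proof. apply canalytic_at_comp; [apply HPhi | apply curve_canalytic]. Qed.

Lemma normal_deriv_eq (s : R) : dot (grad u (x s)) (normal x s) = snd (Phi' (x s) * vel x s)%C / speed x s.
Proof.
  destruct (HPhi s) as [_ [_ [_ [_ [E _]]]]]. rewrite E. pose proof (speed_pos x Hx s).
  unfold dot. rewrite normal_fst, normal_snd.
  set (g := grad u (x s)). set (v := vel x s). simpl. field. lra.
Qed.

Lemma normal_deriv_at (s : R) : analytic_at (fun s => dot (grad u (x s)) (normal x s)) s.
Proof.
  apply (analytic_at_ext_loc (fun s => snd (Phi' (x s) * vel x s)%C / speed x s)).
  - apply filter_forall. intros r. symmetry. apply normal_deriv_eq.
  - apply analytic_at_div; [|apply speed_at, Hx | apply Rgt_not_eq, speed_pos, Hx].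
    apply (canalytic_at_parts (fun s => Phi' (x s) * vel x s)%C).
    apply canalytic_at_mult; [apply Phi'_canalytic | apply vel_canalytic].
Qed.

Lemma trace_at (s : R) : analytic_at (fun s => u (x s)) s.
Proof.
  apply (analytic_at_ext_loc (fun s => fst (Phi (x s)))).
  - apply filter_forall. intros r. apply HPhi.
  - apply (canalytic_at_parts (fun s => Phi (x s))), Phi_canalytic.
Qed.

(** The part of the primitive that has a limit at [t], the same from both sides. *)
Definition prim_reg (s : R) : R :=
  - snd (k * Psi (x s))%C - fst (k * / zeta s)%C * snd (Phi (x s)).

(** Integrating [Phi H' = - k Phi / zeta ^ 2] termwise gives [k (Phi(w) / zeta - Psi) - k Phi'(w)
    log zeta]. The imaginary part is taken and [Re H Im Phi] subtracted, but only [ln |zeta|] is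
    kept from the logarithm, so that [prim] is periodic. *)
Definition prim (s : R) : R :=
  snd (k * (Phi (x t) * / zeta s - Psi (x s)))%C - fst (k * / zeta s)%C * snd (Phi (x s))
   - snd (k * Phi' (x t))%C * ln (Cmod (zeta s)).

(** The first two summands are [Im (Phi H' dz) - d (Re H Im Phi)] after the terms with [Im Phi]
    cancel; the last restores the argument part of the logarithm omitted from [prim]. *)
Definition prim' (s : R) : R :=
  - snd (k * (/ zeta s * / zeta s) * vel x s)%C * fst (Phi (x s))
   - fst (k * / zeta s)%C * snd (Phi' (x s) * vel x s)%C
   + fst (k * Phi' (x t))%C * arg_form x (x t) s.

Lemma zeta_inv_canalytic (s : R) : zeta s <> 0%C -> canalytic_at (fun s => / zeta s)%C s.
Proof.
  intros H. apply (canalytic_at_comp (fun y => / y)%C zeta); [apply holo_at_inv, H|].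
  apply (canalytic_at_plus x (fun _ => - x t)%C); [apply curve_canalytic | apply canalytic_at_const].
Qed.

Lemma prim'_continuous (s : R) : zeta s <> 0%C -> continuous prim' s.
Proof.
  intros H.
  assert (H' : x s <> x t) by (intros E; apply H, (proj1 (Ceq_minus _ _) E)).
  apply analytic_at_continuous. apply analytic_at_plus; [apply analytic_at_minus|].
  - apply analytic_at_mult; [|apply (canalytic_at_parts _ _ (Phi_canalytic s))].
    apply analytic_at_opp, (canalytic_at_parts (fun s => k * (/ zeta s * / zeta s) * vel x s)%C).
    apply canalytic_at_mult; [|apply vel_canalytic]. apply canalytic_at_mult; [apply canalytic_at_const|].
    apply canalytic_at_mult; apply zeta_inv_canalytic, H.
  - apply analytic_at_mult.
    + apply (canalytic_at_parts (fun s => k * / zeta s)%C).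
      apply canalytic_at_mult; [apply canalytic_at_const | apply zeta_inv_canalytic, H].
    + apply (canalytic_at_parts (fun s => Phi' (x s) * vel x s)%C).
      apply canalytic_at_mult; [apply Phi'_canalytic | apply vel_canalytic].
  - apply analytic_at_mult; [apply analytic_at_const | apply arg_form_at; assumption].
Qed.

Lemma zeta_inv_cder (y : C) : (y - x t)%C <> 0%C -> cder (fun y => / (y - x t))%C y (- (/ (y - x t) * / (y -
  x t)))%C.
Proof.
  intros H. eapply cder_eq; [apply (cder_translate (fun y => / y)%C); apply cder_inv, H|]. simpl. field.
  exact H.
Qed.

Lemma prim_derive (s : R) : zeta s <> 0%C -> is_derive prim s (prim' s).
Proof.
  intros Hz. assert (Hne : x s <> x t) by (intros E; apply Hz, (proj1 (Ceq_minus _ _) E)).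
  destruct (HPhi s) as [DPhi [_ [_ [_ [_ DPsi]]]]]. specialize (DPsi Hne).
  pose proof (zeta_inv_cder (x s) Hz) as Dinv.
  pose proof (curve_pder x Hx s) as Dx.
  set (z := zeta s) in *. change (x s - x t)%C with z in DPsi, Dinv.
  set (E2 := ((Phi (x s) - Phi (x t) - Phi' (x t) * z) / (z * z))%C) in DPsi.
  assert (DA : cder (fun y => k * (Phi (x t) * / (y - x t) + - Psi y))%C (x s)
            (k * (Phi (x t) * - (/ z * / z) + - E2))%C).
  { eapply cder_eq.
    - apply cder_mult; [apply cder_const|]. apply cder_plus.
      + apply cder_mult; [apply cder_const | exact Dinv].
      + apply cder_opp, DPsi.
    - simpl. ring. }
  assert (DB : cder (fun y => k * / (y - x t))%C (x s) (k * - (/ z * / z))%C).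
  { eapply cder_eq; [apply cder_mult; [apply cder_const | exact Dinv]|]. simpl. ring. }
  pose proof (proj2 (pder_comp _ x s _ _ DA Dx)) as PA.
  pose proof (proj1 (pder_comp _ x s _ _ DB Dx)) as PB.
  pose proof (proj2 (pder_comp _ x s _ _ DPhi Dx)) as PV.
  assert (Dz : pder zeta s (vel x s)).
  { unfold zeta. eapply pder_eq; [apply (pder_comp (fun y => y - x t)%C x s (RtoC 1)); [|exact Dx]|].
    - eapply cder_eq; [apply (cder_plus (fun y => y)); [apply cder_id | apply cder_const]|]. simpl. ring.
    - ring. }
  pose proof (is_derive_ln_Cmod zeta s _ Dz Hz) as PL. fold z in PL.
  set (A1 := (k * (Phi (x t) * - (/ z * / z) + - E2) * vel x s)%C) in PA.
  set (B1 := (k * - (/ z * / z) * vel x s)%C) in PB.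
  set (V1 := (Phi' (x s) * vel x s)%C) in PV.
  set (L1 := (vel x s / z)%C) in PL.
  (* The second-order expansion of [Phi] at [x t], multiplied by [H']: constant and quadratic terms
     come from [A1], the linear one from the logarithm. *)
  assert (Id : A1 = (B1 * Phi (x s) + k * Phi' (x t) * L1)%C).
  { unfold A1, B1, L1, E2. field. exact Hz. }
  assert (Ep : prim' s = snd A1 - (fst B1 * snd (Phi (x s)) + fst (k * / z)%C * snd V1) - snd (k * Phi' (x
    t))%C * fst L1).
  { unfold prim'. fold z. fold V1. unfold arg_form. change (x s - x t)%C with z. fold L1.
    replace (k * (/ z * / z) * vel x s)%C with (- B1)%C by (unfold B1; ring).
    rewrite Id. set (kp := (k * Phi' (x t))%C). set (c := fst (k * / z)%C). simpl. ring. }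
  rewrite Ep.
  assert (G : forall (f g h l : R -> R) (f' g' h' l' c : R),
    is_derive f s f' -> is_derive g s g' -> is_derive h s h' -> is_derive l s l' ->
     is_derive (fun s => f s - g s * h s - c * l s) s (f' - (g' * h s + g s * h') - c * l')).
  { intros f g h l f' g' h' l' c H1 H2 H3 H4. auto_derive.
    - repeat split; try (exists f'; exact H1); try (exists g'; exact H2); try (exists h'; exact H3);
      try (exists l'; exact H4).
    - change (fun x => f x) with f. change (fun x => g x) with g. change (fun x => h x) with h.
      change (fun x => l x) with l.
      rewrite (is_derive_unique _ _ _ H1), (is_derive_unique _ _ _ H2), (is_derive_unique _ _ _ H3),
        (is_derive_unique _ _ _ H4). ring. }
  apply (G (fun s => snd (k * (Phi (x t) * / zeta s - Psi (x s)))%C) (fun s => fst (k * / zeta s)%C)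
           (fun s => snd (Phi (x s))) (fun s => ln (Cmod (zeta s))) _ _ _ _ _ PA PB PV PL).
Qed.

Lemma Cmult_RtoC_Re (a b : C) : snd a = 0 -> (b * a)%C = (RtoC (fst a) * b)%C.
Proof. intros H. destruct a as [a1 a2]. simpl in *. subst a2. apply injective_projections; simpl; ring. Qed.

(** [Phi (x t)] is real and comes out of the imaginary part, leaving the quantity estimated by
    [chord_end]. *)
Lemma prim_split (s : R) : prim s =
  fst (Phi (x t)) / (2 * PI) * snd (normal x t / zeta s)%C + prim_reg s - snd (k * Phi' (x t))%C * ln (Cmod
    (zeta s)).
Proof.
  unfold prim, prim_reg.
  replace (k * (Phi (x t) * / zeta s - Psi (x s)))%C
    with (RtoC (fst (Phi (x t)) / (2 * PI)) * (normal x t / zeta s) + - (k * Psi (x s)))%C.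
  - set (a := (normal x t / zeta s)%C). set (b := (k * Psi (x s))%C). simpl. ring.
  - replace (k * (Phi (x t) * / zeta s - Psi (x s)))%C with (k * / zeta s * Phi (x t) + - (k * Psi (x s)))%C
    by ring.
    f_equal. rewrite (Cmult_RtoC_Re (Phi (x t)) _ HPhi0). unfold k, Cdiv, Rdiv. rewrite RtoC_mult. ring.
Qed.

(** [Re (k / zeta)] is the single normal derivative of [G], which extends continuously through [t];
    multiplied by [Im Phi], which vanishes at [x t], it tends to 0. The limit left over is that of
    the [Psi] term. *)
Lemma prim_reg_limit (eta : R) : 0 < eta -> exists d, 0 < d /\ forall s,
  0 < Rabs (s - t) < d -> Rabs (prim_reg s - - snd (k * Psi (x t))%C) < eta.
Proof.
  intros Heta. pose proof PI_RGT_0 as HPI. pose proof (speed_pos x Hx t) as Hsp.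
  destruct (chord_sq_factor x Hx t) as [n [Hn [En Fn]]].
  destruct (chord_dot1_factor x Hx t) as [e1 [He1 [_ Fe1]]].
  assert (Hnt : n t <> 0) by (rewrite En; apply pow_nonzero; lra).
  (* The product [Re (k / zeta) Im Phi] with the removable singularity of the kernel filled in. *)
  set (m := fun s => - / (2 * PI) * (e1 s / n s) * snd (Phi (x s))).
  assert (Hm : continuous m t).
  { apply analytic_at_continuous. apply analytic_at_mult; [|apply (canalytic_at_parts _ _ (Phi_canalytic t))].
    apply analytic_at_mult; [apply analytic_at_const | apply analytic_at_div; assumption]. }
  assert (Em : m t = 0) by (unfold m; rewrite HPhi0; ring).
  assert (He2 : 0 < eta / 2) by lra.
  pose proof (proj1 (continuity_pt_locally m t) (proj2 (continuity_pt_filterlim m t) Hm) (mkposreal _ He2))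
    as L1.
  assert (L2 : locally t (fun s => Cmod (k * Psi (x s) - k * Psi (x t)) < eta / 2)).
  { assert (Hc : ccont (fun y => k * Psi y)%C (x t)) by (apply ccont_mult; [apply ccont_const | exact HPsi0]).
    destruct (proj1 (ccont_eps _ _) Hc _ He2) as [d [Hd HL]].
    assert (Hd2 : 0 < d / 2) by lra.
    pose proof (proj1 (continuity_pt_locally _ t) (proj2 (continuity_pt_filterlim _ t) (curve_cont1 x Hx t))
      (mkposreal _ Hd2)) as C1.
    pose proof (proj1 (continuity_pt_locally _ t) (proj2 (continuity_pt_filterlim _ t) (curve_cont2 x Hx t))
      (mkposreal _ Hd2)) as C2.
    eapply filter_imp; [|apply (filter_and _ _ C1 C2)]. intros s [B1 B2]. apply HL. simpl in B1, B2.
    eapply Rle_lt_trans; [apply Cmod_le_sum|]. simpl. unfold Rminus in *. lra. }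
  destruct (filter_and _ _ (filter_and _ _ L1 L2) (filter_and _ _ (near_eqmod t)
     (analytic_at_neq_0 n t (analytic_at_continuous _ _ Hn) Hnt))) as [d Hd].
  exists d. split; [apply cond_pos|]. intros s [Hs0 Hs].
  destruct (Hd s) as [[K1 K2] [K3 K4]]; [exact Hs|]. simpl in K1. rewrite Em, Rminus_0_r in K1.
  assert (Hst : s <> t) by (intros ->; rewrite Rminus_diag, Rabs_R0 in Hs0; lra).
  assert (Hne : x t <> x s) by (intros E; apply Hst, K3, (curve_inj_mod x Hx); symmetry; exact E).
  assert (Hm2 : fst (k * / zeta s)%C * snd (Phi (x s)) = m s).
  { unfold m. f_equal. unfold k, zeta. rewrite <- (single_kernel_complex (x t) (x s) (normal x t) Hne).
    f_equal. rewrite <- (enorm_sq (vsub (x t) (x s))), Fn.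
    change (dot (vsub (x t) (x s)) (normal x t)) with (chord_dot1 x t s). rewrite Fe1. field.
    split; [exact K4 | lra]. }
  unfold prim_reg. rewrite Hm2.
  pose proof (Cmod_snd (k * Psi (x s) - k * Psi (x t))) as K5.
  set (a := (k * Psi (x s))%C) in *. set (b := (k * Psi (x t))%C) in *.
  assert (K6 : Rabs (snd a + - snd b) < eta / 2) by (eapply Rle_lt_trans; [exact K5 | exact K2]).
  apply Rabs_def2 in K1, K6. apply Rabs_def1; lra.
Qed.

Lemma prim_per (s : R) : prim (s + 2 * PI) = prim s.
Proof. unfold prim, zeta. rewrite (curve_per x Hx). reflexivity. Qed.

Lemma normal_deriv_coef : fst (k * Phi' (x t))%C = dot (grad u (x t)) (normal x t) / (2 * PI).
Proof.
  pose proof PI_RGT_0. destruct (HPhi t) as [_ [_ [_ [_ [E _]]]]]. rewrite E. unfold k, dot.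
  set (g := grad u (x t)). set (n := normal x t). clearbody g n. simpl. field. lra.
Qed.

(* With [H = k / (z - x t)]: integrating the two kernels against the Cauchy data of [Re Phi] gives
   [Im (Phi H' dz) - d (Re H * Im Phi)]. *)
Lemma integrand_split (phi : R -> R) (s : R) : x t <> x s ->
  d2G (x t) (normal x t) (x s) (normal x s) * phi s * speed x s
  = ((dot (normal x s) (normal x t) / (2 * PI * enorm (vsub (x t) (x s)) ^ 2)
        - dot (vsub (x t) (x s)) (normal x t) * dot (vsub (x t) (x s)) (normal x s)
           / (PI * enorm (vsub (x t) (x s)) ^ 4)) * (phi s - u (x s))
     + - / (2 * PI) * (dot (vsub (x t) (x s)) (normal x t) / enorm (vsub (x t) (x s)) ^ 2)
        * dot (grad u (x s)) (normal x s)) * speed x s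
    + (prim' s - fst (k * Phi' (x t))%C * arg_form x (x t) s).
Proof.
  intros Hne. pose proof (speed_pos x Hx s) as Hsp.
  assert (EK : dot (normal x s) (normal x t) / (2 * PI * enorm (vsub (x t) (x s)) ^ 2)
        - dot (vsub (x t) (x s)) (normal x t) * dot (vsub (x t) (x s)) (normal x s)
           / (PI * enorm (vsub (x t) (x s)) ^ 4) = d2G (x t) (normal x t) (x s) (normal x s)).
  { rewrite d2G_formula by exact Hne.
    replace (enorm (vsub (x t) (x s)) ^ 4) with ((enorm (vsub (x t) (x s)) ^ 2) ^ 2) by ring.
    rewrite enorm_sq. f_equal. f_equal. unfold dot. ring. }
  rewrite EK, enorm_sq, (single_kernel_complex (x t) (x s) (normal x t) Hne), normal_deriv_eq.
  unfold prim'. fold k.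
  pose proof (kernel_complex (x t) (x s) (vel x s) (normal x t) (speed x s) Hne Hsp) as E.
  change ((snd (vel x s) / speed x s, - fst (vel x s) / speed x s)%R) with (normal x s) in E.
  fold k in E. fold (zeta s) in E |- *. rewrite <- E.
  destruct (HPhi s) as [_ [_ [_ [EP _]]]]. rewrite EP.
  set (K := d2G (x t) (normal x t) (x s) (normal x s)). set (kap := fst (k * / zeta s)%C).
  set (V := snd (Phi' (x s) * vel x s)%C). set (c := fst (k * Phi' (x t))%C). field. lra.
Qed.

End Potential.

Lemma truncated_periodic (x : R -> R * R) (phi : R -> R) (t eps : R) : analytic_simple_closed_curve x ->
  periodic phi ->
  periodic (truncated_integrand x phi t eps).
Proof.
  intros Hx Hp s. unfold truncated_integrand.
  rewrite (curve_per x Hx), (normal_per x Hx), (speed_per x Hx), Hp. reflexivity.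
Qed.

(** The integrals are compared on open intervals, so the values at the two cut points do not
    matter. *)
Lemma truncated_is_RInt (x : R -> R * R) (phi : R -> R) (t eps a b V : R) : 0 < eps ->
  0 < a < PI -> 0 < b < PI ->
  (forall tau, t < tau < t + 2 * PI -> (eps < enorm (vsub (x t) (x tau)) <-> t + b < tau < t + 2 * PI - a)) ->
  is_RInt (fun tau => d2G (x t) (normal x t) (x tau) (normal x tau) * phi tau * speed x tau) (t + b) (t + 2 *
    PI - a) V ->
  is_RInt (truncated_integrand x phi t eps) t (t + 2 * PI) V.
Proof.
  intros He Ha Hb H HV.
  assert (Z : forall c d, t <= c -> c <= d -> d <= t + 2 * PI -> (forall s,
    c < s < d -> ~ (t + b < s < t + 2 * PI - a)) ->
    is_RInt (truncated_integrand x phi t eps) c d 0).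
  { intros c d Hc Hcd Hd Hout. replace 0 with (scal (d - c) 0) by (apply Rmult_0_r).
    eapply is_RInt_ext; [|apply (is_RInt_const (V := R_NormedModule) c d 0)].
    rewrite Rmin_left, Rmax_right by lra. intros s Hs. unfold truncated_integrand.
    destruct (Rlt_dec eps (enorm (vsub (x t) (x s)))) as [Hlt|Hlt]; [|reflexivity].
    exfalso. apply (Hout s Hs), H; [lra | exact Hlt]. }
  replace V with (plus (plus 0 V) 0) by (change (0 + V + 0 = V); ring).
  apply (is_RInt_Chasles (V := R_NormedModule) _ t (t + 2 * PI - a) (t + 2 * PI)).
  - apply (is_RInt_Chasles (V := R_NormedModule) _ t (t + b) (t + 2 * PI - a)).
    + apply Z; try lra. intros s Hs. lra.
    + eapply is_RInt_ext; [|exact HV]. rewrite Rmin_left, Rmax_right by lra. intros s Hs.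
      unfold truncated_integrand.
      destruct (Rlt_dec eps (enorm (vsub (x t) (x s)))) as [Hlt|Hlt]; [reflexivity|].
      exfalso. apply Hlt, H; lra.
  - apply Z; try lra. intros s Hs. lra.
Qed.

Theorem lemma2p1 :
  forall (x : R -> R * R) (phi : R -> R) (M : nat) (U : R * R -> R * R -> R),
    analytic_simple_closed_curve x ->
    analytic phi ->
    periodic phi ->
    (1 <= M)%nat ->
    (forall t, 0 <= t <= 2 * PI -> harmonic (fun p => U p (x t))) ->
    (forall t, 0 <= t <= 2 * PI ->
       forall m : nat, (m <= M)%nat ->
         is_lim (fun tau => Derive_n (fun s => dirichlet_trace x U s t - phi s) m tau) t 0) ->
    forall t, 0 <= t <= 2 * PI ->
      is_hypersingular x phi t
        (- (neumann_trace x U t t / 2)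
         + RInt (fun tau => (RP x phi U tau t + RQ x U tau t) * speed x tau) 0 (2 * PI)) /\
      (analytic (fun tau => RP x phi U tau t) /\ periodic (fun tau => RP x phi U tau t)) /\
      (analytic (fun tau => RQ x U tau t) /\ periodic (fun tau => RQ x U tau t)).
Proof.
  intros x phi M U Hx Hphi Hper HM Hharm Hlim t Ht. pose proof PI_RGT_0 as HPI.
  set (u := fun p => U p (x t)).
  destruct (curve_bounded x Hx) as [M0 [HM0 HM0']].
  (* The disc about [x t] must contain the whole curve, whose diameter is at most [2 * M0]. *)
  destruct (harmonic_conjugate u (x t) (2 * M0 + 1) (Hharm t Ht)) as [Phi [Phi' [Psi [HPhi0 [HPsi0
    HPhi']]]]]; [lra|].
  assert (HPhi : forall s, cder Phi (x s) (Phi' (x s)) /\ holo_at Phi (x s) /\ holo_at Phi' (x s) /\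
      fst (Phi (x s)) = u (x s) /\ Phi' (x s) = (fst (grad u (x s)), - snd (grad u (x s))) /\
      (x s <> x t -> cder Psi (x s)
         ((Phi (x s) - Phi (x t) - Phi' (x t) * (x s - x t)) / ((x s - x t) * (x s - x t)))%C)).
  { intros s. apply HPhi'. eapply Rle_lt_trans; [apply Cmod_triangle|]. rewrite Cmod_opp.
    pose proof (HM0' s). pose proof (HM0' t). lra. }
  assert (Htr : forall s, analytic_at (fun s => dirichlet_trace x U s t) s).
  { intros s. apply (trace_at x Hx t u Phi Phi' Psi HPhi s). }
  assert (Hnd : forall s, analytic_at (fun s => neumann_trace x U s t) s).
  { intros s. apply (normal_deriv_at x Hx t u Phi Phi' Psi HPhi s). }
  assert (Hphia : forall s, analytic_at phi s) by (apply (proj1 (analytic_analytic_at phi) Hphi)).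
  assert (Hga : forall s, analytic_at (fun s => dirichlet_trace x U s t - phi s) s).
  { intros s. apply analytic_at_minus; [apply Htr | apply Hphia]. }
  (* The hypothesis gives limits as [tau] tends to [t]; analyticity of the trace makes them values
     at [t], for the function and its first derivative. *)
  assert (G0 : dirichlet_trace x U t t - phi t = 0).
  { apply (is_lim_continuous_unique (fun s => dirichlet_trace x U s t - phi s)).
    - apply analytic_at_continuous, Hga.
    - apply (Hlim t Ht 0%nat). lia. }
  assert (G1 : Derive (fun s => dirichlet_trace x U s t - phi s) t = 0).
  { apply (is_lim_continuous_unique (Derive (fun s => dirichlet_trace x U s t - phi s))).
    - apply analytic_at_continuous, analytic_at_derive, Hga.
    - apply (Hlim t Ht 1%nat HM). }
  assert (Hg : forall s, analytic_at (fun s => phi s - dirichlet_trace x U s t) s).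
  { intros s. apply analytic_at_minus; [apply Hphia | apply Htr]. }
  assert (G1' : Derive (fun s => phi s - dirichlet_trace x U s t) t = 0).
  { rewrite (Derive_ext _ (fun s => - (dirichlet_trace x U s t - phi s))) by (intros s; ring).
    rewrite Derive_opp, G1. ring. }
  assert (HRP : forall s, analytic_at (fun tau => RP x phi U tau t) s).
  { intros s. apply (RP_at x Hx t phi U Hper); [exact Hg | lra | exact G1']. }
  assert (HRQ : forall s, analytic_at (fun tau => RQ x U tau t) s).
  { intros s. apply (RQ_at x Hx t U); exact Hnd. }
  assert (PRP := RP_periodic x Hx t phi U Hper). assert (PRQ := RQ_periodic x Hx t U).
  split; [|split; (split; [apply analytic_analytic_at; assumption | assumption])].
  set (F := fun tau => (RP x phi U tau t + RQ x U tau t) * speed x tau).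
  assert (HF : forall s, continuous F s).
  { intros s. apply analytic_at_continuous, analytic_at_mult; [apply analytic_at_plus;
    auto | apply speed_at, Hx]. }
  assert (HFex : forall a b, ex_RInt F a b) by (intros a b; apply ex_RInt_cont; intros s _; apply HF).
  assert (HFper : RInt F 0 (2 * PI) = RInt F t (t + 2 * PI)).
  { symmetry. apply RInt_periodic; [|exact HFex]. intros s. unfold F.
    rewrite (PRP s), (PRQ s), (speed_per x Hx). reflexivity. }
  (* The coefficient of the argument form; its principal value pi will produce [Q(t,t) / 2]. *)
  set (cq := neumann_trace x U t t / (2 * PI)).
  set (pr := prim x t Phi Phi' Psi).
  (* An exact formula on the truncated arc, before any limit; periodicity of [prim] brings the far
     end [t + 2 * PI - a] back to [t - a]. *)
  assert (HW : forall a b, 0 < a < PI -> 0 < b < PI ->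
    is_RInt (fun tau => d2G (x t) (normal x t) (x tau) (normal x tau) * phi tau * speed x tau) (t + b) (t + 2
      * PI - a)
      (RInt F (t + b) (t + 2 * PI - a) + (pr (t - a) - pr (t + b) - cq * RInt (arg_form x (x t)) (t + b) (t +
        2 * PI - a)))).
  { intros a b Ha Hb.
    assert (Hin : forall s, Rmin (t + b) (t + 2 * PI - a) <= s <= Rmax (t + b) (t + 2 * PI - a) -> t < s < t
      + 2 * PI).
    { rewrite Rmin_left, Rmax_right by lra. intros s Hs. lra. }
    apply (is_RInt_ext (fun s => plus (F s) (minus (prim' x t Phi Phi' s) (scal cq (arg_form x (x t) s))))).
    - intros s Hs. assert (Hs' : t < s < t + 2 * PI) by (apply Hin; lra).
      assert (Hne : x t <> x s) by (intros E; apply (curve_neq x Hx t s Hs'); symmetry; exact E).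
      rewrite (integrand_split x Hx t u Phi Phi' Psi HPhi phi s Hne),
        (normal_deriv_coef x t u Phi Phi' Psi HPhi).
      unfold F, RP, RQ. destruct (excluded_middle_informative (eqmod2pi s t)) as [E|E].
      + exfalso. apply Hne. destruct E as [j ->]. symmetry. apply periodic_Z, (curve_periodic x Hx).
      + reflexivity.
    - apply (is_RInt_plus (V := R_NormedModule)).
      + apply (RInt_correct (V := R_CompleteNormedModule)), HFex.
      + apply (is_RInt_minus (V := R_NormedModule)).
        * replace (pr (t - a)) with (pr (t + 2 * PI - a)).
          -- apply (is_RInt_derive (V := R_CompleteNormedModule)).
             ++ intros s Hs. apply (prim_derive x Hx t u Phi Phi' Psi HPhi).
               apply (zeta_neq x Hx t s (Hin s Hs)).
             ++ intros s Hs. apply (prim'_continuous x Hx t u Phi Phi' Psi HPhi).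
               apply (zeta_neq x Hx t s (Hin s Hs)).
          -- unfold pr. rewrite <- (prim_per x Hx t Phi Phi' Psi (t - a)). f_equal. ring.
        * apply (is_RInt_scal (V := R_NormedModule)). apply (RInt_correct (V := R_CompleteNormedModule)).
          apply (arg_form_ex_RInt x Hx); [lra|]. intros s Hs. apply (curve_neq x Hx). lra. }
  assert (Trunc : forall eps a b, 0 < eps -> 0 < a < PI -> 0 < b < PI ->
     (forall tau, t < tau < t + 2 * PI -> (eps < enorm (vsub (x t) (x tau)) <-> t + b < tau < t + 2 * PI -
       a)) ->
     ex_RInt (truncated_integrand x phi t eps) 0 (2 * PI) /\
     RInt (truncated_integrand x phi t eps) 0 (2 * PI) =
     RInt F (t + b) (t + 2 * PI - a) + (pr (t - a) - pr (t + b) - cq * RInt (arg_form x (x t)) (t + b) (t + 2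
       * PI - a))).
  { intros eps a b He Ha Hb H.
    pose proof (truncated_is_RInt x phi t eps a b _ He Ha Hb H (HW a b Ha Hb)) as HI.
    destruct (RInt_periodic_window (truncated_integrand x phi t eps) t (truncated_periodic x phi t eps Hx
      Hper) Ht) as [E1 E2].
    - eexists. exact HI.
    - split; [exact E1|]. rewrite E2. apply is_RInt_unique. exact HI. }
  split.
  - destruct (truncation_window x Hx t 1 Rlt_0_1) as [e0 [He0 Hw]].
    exists (mkposreal _ He0). intros eps Heps Hpos. change (Rabs (eps - 0) < e0) in Heps.
    rewrite Rminus_0_r, Rabs_pos_eq in Heps by lra.
    destruct (Hw eps (conj Hpos Heps)) as [a [b [Ha [Hb [Ha' [Hb' [_ [_ H]]]]]]]].
    apply (Trunc eps a b Hpos); [lra | lra | exact H].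
  - apply (proj2 (filterlim_locally _ _)). intros eta.
    pose proof (cond_pos eta) as Heta. assert (He4 : 0 < eta / 6) by lra.
    destruct (chord_end x Hx t) as [Ce [de [HCe [Hde [CE1 CE2]]]]].
    destruct (prim_reg_limit x Hx t u Phi Phi' Psi HPhi0 HPsi0 HPhi (eta / 6) He4) as [dp [Hdp HP]].
    (* The [+ 1] covers [cq = 0]. *)
    assert (Hcq : 0 < eta / (6 * (Rabs cq + 1))) by (apply Rdiv_lt_0_compat; pose proof (Rabs_pos cq); lra).
    destruct (principal_winding x Hx t _ Hcq) as [dw [Hdw HPW]].
    destruct (bounded_on F t (t + 2 * PI) (fun s _ => HF s)) as [MF [HMF HMF']].
    set (Kp := Rabs (phi t) / (2 * PI) * Ce).
    assert (HKp : 0 <= Kp).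
    { apply Rmult_le_pos; [apply Rdiv_le_0_compat; [apply Rabs_pos | lra] | lra]. }
    (* Since [a + b < 2 * d0], the last bound makes the missing end arcs of [F] and the two chord
       errors together at most [eta / 6]. *)
    set (d0 := Rmin (Rmin de dp) (Rmin dw (eta / (12 * (MF + Kp + 1))))).
    assert (Hd0 : 0 < d0).
    { repeat apply Rmin_glb_lt; try lra. apply Rdiv_lt_0_compat; lra. }
    destruct (truncation_window x Hx t d0 Hd0) as [e0 [He0 Hw]].
    exists (mkposreal _ He0). intros eps Heps Hpos. change (Rabs (eps - 0) < e0) in Heps.
    rewrite Rminus_0_r, Rabs_pos_eq in Heps by lra.
    destruct (Hw eps (conj Hpos Heps)) as [a [b [Ha [Hb [Ha' [Hb' [Ea [Eb H]]]]]]]].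
    destruct (Trunc eps a b Hpos ltac:(lra) ltac:(lra) H) as [_ ET].
    match goal with |- ball ?l _ ?v => change (Rabs (v - l) < eta) end.
    rewrite ET. fold F. rewrite HFper.
    assert (Q1 : d0 <= de) by (eapply Rle_trans; [apply Rmin_l | apply Rmin_l]).
    assert (Q2 : d0 <= dp) by (eapply Rle_trans; [apply Rmin_l | apply Rmin_r]).
    assert (Q3 : d0 <= dw) by (eapply Rle_trans; [apply Rmin_r | apply Rmin_l]).
    assert (Q4 : d0 <= eta / (12 * (MF + Kp + 1))) by (eapply Rle_trans; [apply Rmin_r | apply Rmin_r]).
    assert (Q5 : (MF + Kp + 1) * d0 <= eta / 12).
    { apply Rmult_le_compat_l with (r := MF + Kp + 1) in Q4; [|lra].
      replace ((MF + Kp + 1) * (eta / (12 * (MF + Kp + 1)))) with (eta / 12) in Q4 by (field; lra). exact Q4.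
      }
    assert (T1 : Rabs (RInt F (t + b) (t + 2 * PI - a) - RInt F t (t + 2 * PI)) <= MF * (a + b)).
    { rewrite <- (RInt_Chasles (V := R_CompleteNormedModule) F t (t + b) (t + 2 * PI)) by apply HFex.
      rewrite <- (RInt_Chasles (V := R_CompleteNormedModule) F (t + b) (t + 2 * PI - a) (t + 2 * PI)) by
        apply HFex.
      assert (B1 : Rabs (RInt F t (t + b)) <= (t + b - t) * MF).
      { apply RInt_bound; [lra | apply HFex | intros s Hs; apply HMF'; lra]. }
      assert (B2 : Rabs (RInt F (t + 2 * PI - a) (t + 2 * PI)) <= (t + 2 * PI - (t + 2 * PI - a)) * MF).
      { apply RInt_bound; [lra | apply HFex | intros s Hs; apply HMF'; lra]. }
      set (I1 := RInt F t (t + b)) in *. set (I2 := RInt F (t + b) (t + 2 * PI - a)) in *.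
      set (I3 := RInt F (t + 2 * PI - a) (t + 2 * PI)) in *.
      change (Rabs (I2 - (I1 + (I2 + I3))) <= MF * (a + b)).
      replace (I2 - (I1 + (I2 + I3))) with (- (I1 + I3)) by ring. rewrite Rabs_Ropp.
      eapply Rle_trans; [apply Rabs_triang|]. lra. }
    assert (HPt : fst (Phi (x t)) = phi t).
    { destruct (HPhi t) as [_ [_ [_ [E _]]]]. rewrite E. change (u (x t)) with (dirichlet_trace x U t t).
      lra. }
    unfold pr. rewrite !(prim_split x t Phi Phi' Psi HPhi0), HPt.
    assert (Ca : Cmod (x (t - a)%R - x t) = eps) by (rewrite zeta_Cmod; exact Ea).
    assert (Cb : Cmod (x (t + b)%R - x t) = eps) by (rewrite zeta_Cmod; exact Eb).
    rewrite Ca, Cb.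
    specialize (CE1 (t + b) ltac:(lra)). specialize (CE2 (t - a) ltac:(lra)). cbv zeta in CE1, CE2.
    rewrite Cb in CE1. rewrite Ca in CE2.
    replace (t + b - t) with b in CE1 by ring. replace (t - (t - a)) with a in CE2 by ring.
    pose proof (HP (t + b)) as P1. pose proof (HP (t - a)) as P2.
    replace (t + b - t) with b in P1 by ring. replace (t - a - t) with (- a) in P2 by ring.
    rewrite Rabs_Ropp in P2. rewrite Rabs_pos_eq in P1, P2 by lra.
    specialize (P1 ltac:(lra)). specialize (P2 ltac:(lra)).
    specialize (HPW a b ltac:(lra) ltac:(lra)).
    set (J := RInt (arg_form x (x t)) (t + b) (t + 2 * PI - a)) in *.
    set (S1 := snd (normal x t / (x (t + b)%R - x t))%C) in *.
    set (S2 := snd (normal x t / (x (t - a)%R - x t))%C) in *.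
    set (R1 := prim_reg x t Phi Psi (t + b)) in *. set (R2 := prim_reg x t Phi Psi (t - a)) in *.
    set (c0 := - snd (RtoC (/ (2 * PI)) * normal x t * Psi (x t))%C) in *.
    set (lg := snd (RtoC (/ (2 * PI)) * normal x t * Phi' (x t))%C * ln eps).
    set (IF := RInt F (t + b) (t + 2 * PI - a)) in *. set (IF0 := RInt F t (t + 2 * PI)) in *.
    assert (Ecq : neumann_trace x U t t / 2 = cq * PI) by (unfold cq; field; lra). rewrite Ecq.
    (* Both chords have length [eps], so the logarithms cancel, as does the common limit [c0]; the
       divergence [phi t / (PI * eps)] is shared equally between the two ends. *)
    match goal with |- Rabs ?e < _ => replace e with ((IF - IF0) + phi t / (2 * PI) * ((S2 - / eps) - (S1 + /
      eps))
        + ((R2 - c0) - (R1 - c0)) - cq * (J - PI)) by (field; split; lra) end.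
    assert (T2 : Rabs (phi t / (2 * PI) * ((S2 - / eps) - (S1 + / eps))) <= Kp * (a + b)).
    { unfold Kp. rewrite Rabs_mult. unfold Rdiv at 1.
      rewrite Rabs_mult, (Rabs_pos_eq (/ (2 * PI))) by (left; apply Rinv_0_lt_compat; lra).
      fold (Rabs (phi t) / (2 * PI)). rewrite Rmult_assoc. apply Rmult_le_compat_l.
      - apply Rdiv_le_0_compat; [apply Rabs_pos | lra].
      - replace (Ce * (a + b)) with (Ce * a + Ce * b) by ring.
        eapply Rle_trans; [apply Rabs_triang|]. rewrite Rabs_Ropp. lra. }
    assert (T3 : Rabs (cq * (J - PI)) <= eta / 6).
    { rewrite Rabs_mult. pose proof (Rabs_pos cq) as Hc.
      apply Rle_trans with ((Rabs cq + 1) * (eta / (6 * (Rabs cq + 1)))).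
      - apply Rmult_le_compat; try apply Rabs_pos; lra.
      - apply Req_le. field. lra. }
    assert (T4 : (MF + Kp) * (a + b) <= eta / 6) by nra.
    (* The budget is [eta / 6] for [T1] and [T2] together, for each regular end term and for the
       winding term, hence less than [eta] in all. *)
    apply Rabs_le_between in T1, T2, T3. apply Rabs_def2 in P1, P2. apply Rabs_def1; lra.
Qed.
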